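(* Let $\lambda=(\lambda^+|\lambda^-)$ be a dominant integral weight of $G=GL(m|n)$. Assume $1\leq i<m$ and $\lambda^+_i\neq\lambda^+_{i+1}$, or $i=m$ and $\lambda^+_m\neq 0$. Assume $1\leq j\leq n$ is such that $\lambda^-_{j-1}\neq\lambda^-_j$ if $j>1$. Then the vector \[\pi_{ij}=\frac{v}{D^+(1,\ldots,i)\,D^-(m+1,\ldots,m+j-1)}\sum_{r=i}^m D^+(1,\ldots,i-1,r)\sum_{s=1}^{j}(-1)^{s+j}D^-(m+1,\ldots,\widehat{m+s},\ldots,m+j)\,y_{r,m+s}\] is a $G_{ev}$-primitive vector of $F_1$. If $\mathrm{char}(K)=0$, then the set of all vectors $\pi_{ij}$ with $(i,j)$ such that [$1\leq i<m$ and $\lambda^+_i\neq\lambda^+_{i+1}$, or $i=m$ and $\lambda^+_m\neq 0$] and [$1\leq j\leq n$, with $\lambda^-_{j-1}\neq\lambda^-_j$ if $j>1$] forms a complete set of $G_{ev}$-primitive vectors in $F_1$ (up to scalar multiples). Consequently, $F_1$ is a direct sum of irreducible $G_{ev}$-modules with highest vectors $\pi_{ij}$.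
   Context: $K$ is an algebraically closed field of characteristic $\neq 2$, and $m,n\geq 1$. Put $|i|=0$ for $1\le i\le m$ and $|i|=1$ for $m+1\le i\le m+n$ (mod 2). $A(m|n)$ is the free supercommutative $K$-superalgebra on generators $c_{ij}$ ($1\le i,j\le m+n$) of parity $|i|+|j|$. Write the generic matrix $C=(c_{ij})$ in blocks $C_{11}$ ($m\times m$), $C_{12}$, $C_{21}$, $C_{22}$ ($n\times n$). $K[G]$, the coordinate ring of $G=GL(m|n)$, is the localization of $A(m|n)$ at $\det(C_{11})\det(C_{22})$. $G$ acts on $K[G]$ by $C\mapsto Cg$. $G_{ev}\cong GL(m)\times GL(n)$ is the even subgroup of block diagonal matrices. Let $(A_{ij})$ be the adjugate of $C_{11}$. For $1\le i\le m<j\le m+n$ put $y_{ij}=\det(C_{11})^{-1}\sum_{a=1}^m A_{ia}c_{aj}$. For $m+1\le k,l\le m+n$ put $\phi(c_{kl})=c_{kl}-\sum_{a=1}^m c_{ka}y_{al}$. For $1\le i_1,\dots,i_s\le m$, $D^+(i_1,\dots,i_s)=\det(c_{a,i_b})_{1\le a,b\le s}$. For $m+1\le j_1,\dots,j_s\le m+n$, $D^-(j_1,\dots,j_s)=\det(\phi(c_{m+a,j_b}))_{1\le a,b\le s}$; an empty determinant is $1$, in particular $D^-(m+1,\dots,m+j-1)=1$ for $j=1$ and $D^-(m+1,\ldots,\widehat{m+s},\ldots,m+j)=1$ for $s=j=1$. A hat means omission. A weight $\lambda=(\lambda^+|\lambda^-)\in\mathbb Z^{m+n}$ is dominant if $\lambda^+_1\ge\dots\ge\lambda^+_m$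 and $\lambda^-_1\ge\dots\ge\lambda^-_n$. The induced $G_{ev}$-module $H^0_{G_{ev}}(\lambda)\cong H^0_{GL(m)}(\lambda^+)\otimes H^0_{GL(n)}(\lambda^-)$ (induction from the lower triangular Borel subgroup; highest weight $\lambda$) is identified with the subspace of $K[G]$ spanned by all products $D^+(1,\dots,m)^{\lambda^+_m}\,b^+\,D^-(m+1,\dots,m+n)^{\lambda^-_n}\,b^-$, where $b^+$ is a product, over the columns of the Young diagram of $\lambda^+-\lambda^+_m(1,\dots,1)$, of determinants $D^+(\cdot)$ of size the column length with arguments in $\{1,\dots,m\}$, and $b^-$ is a product, over the columns of the diagram of $\lambda^--\lambda^-_n(1,\dots,1)$, of determinants $D^-(\cdot)$ of size the column length with arguments in $\{m+1,\dots,m+n\}$. Its highest weight vector is \[v=\prod_{a=1}^m D^+(1,\ldots,a)^{\lambda^+_a-\lambda^+_{a+1}}\prod_{b=1}^n D^-(m+1,\ldots,m+b)^{\lambda^-_b-\lambda^-_{b+1}},\qquad \lambda^+_{m+1}=\lambda^-_{n+1}=0.\] Let $Y$ be the $G_{ev}$-module spanned by all $y_{ij}$. The first floor is $F_1=H^0_{G_{ev}}(\lambda)\otimes Y$, identified with the $G_{ev}$-submodule of $K[G]$ spanned by the products $w\,y_{ij}$ with $w\in H^0_{G_{ev}}(\lambda)$. A nonzero vector $w$ is $G_{ev}$-primitive if the line spanned by $w$ is stabilized by the upper triangular Borel subgroup of $G_{ev}$ (i.e. $w$ is a highest weight vector for $G_{ev}$).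
   Formalization: In characteristic 0, when λ^+_m = 0, the index set is enlarged to allow i = m, since the claim fails otherwise (for m = n = 1, λ = (0|0), F_1 = K·y_12 is primitive but the stated index set is empty); for λ^+_m ≠ 0 the claim is as stated. *)

(* Defs.v *)
From HB Require Import structures.
From mathcomp Require Import all_boot all_order all_algebra fraction.
From mathcomp Require Import mpoly.
From mathcomp Require Import boolp.

Set Implicit Arguments.
Unset Strict Implicit.
Unset Printing Implicit Defensive.

Import Order.TTheory GRing.Theory Num.Theory.

Local Open Scope ring_scope.

Section Exterior.

Variables (R : comNzRingType) (N : nat).
Implicit Types A B S : {set 'I_N}.

(* [f : exterior R N] stands for [\sum_S f S *: xi_S], where
   [xi_S = xi_(s1) * ... * xi_(sk)] for [S = {s1 < ... < sk}]. *)
Definition exterior := {ffun {set 'I_N} -> R}.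

HB.instance Definition _ :=
  GRing.Zmodule.copy exterior {ffun {set 'I_N} -> R}.

Definition inversions A B : nat := (\sum_(a in A) \sum_(b in B) (b < a))%N.

Definition ext_mul (f g : exterior) : exterior :=
  [ffun S => \sum_(A in powerset S)
     (-1) ^+ inversions A (S :\: A) * (f A * g (S :\: A))].

Definition ext_const (r : R) : exterior :=
  [ffun S => if S == set0 then r else 0].

Definition ext_gen (i : 'I_N) : exterior := [ffun S => (S == [set i])%:R].

Lemma inversions0s A : inversions set0 A = 0%N.
Proof. by rewrite /inversions big_set0. Qed.

Lemma inversionss0 A : inversions A set0 = 0%N.
Proof. by rewrite /inversions big1 // => a _; rewrite big_set0. Qed.

Lemma inversionsUl A B S : [disjoint A & B] ->
  inversions (A :|: B) S = (inversions A S + inversions B S)%N.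
Proof. by move=> dAB; rewrite /inversions -bigU //; apply: eq_bigl => x; rewrite inE. Qed.

Lemma inversionsUr A B S : [disjoint A & B] ->
  inversions S (A :|: B) = (inversions S A + inversions S B)%N.
Proof.
move=> dAB; rewrite /inversions -big_split /=; apply: eq_bigr => a _.
by rewrite -bigU //; apply: eq_bigl => x; rewrite inE.
Qed.

Lemma ext_mulA : associative ext_mul.
Proof.
move=> f g h; apply/ffunP => S; rewrite !ffunE.
transitivity (\sum_(A in powerset S) \sum_(B in powerset (S :\: A))
  (-1) ^+ (inversions A (S :\: A) + inversions B (S :\: A :\: B))
   * (f A * (g B * h (S :\: A :\: B)))).
  apply: eq_bigr => A _; rewrite ffunE !mulr_sumr; apply: eq_bigr => B _.
  by rewrite exprD -!mulrA; congr (_ * _); rewrite !mulrA; congr (_ * _ * _); rewrite mulrC.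
symmetry.
transitivity (\sum_(U in powerset S) \sum_(A in powerset U)
  (-1) ^+ (inversions U (S :\: U) + inversions A (U :\: A))
   * (f A * (g (U :\: A) * h (S :\: U)))).
  apply: eq_bigr => U _; rewrite ffunE mulr_suml mulr_sumr.
  by apply: eq_bigr => A _; rewrite exprD -!mulrA.
rewrite (exchange_big_dep (mem (powerset S))) /=; last first.
  by move=> U A; rewrite !powersetE => /[swap]; apply: subset_trans.
apply: eq_bigr => A; rewrite powersetE => sAS.
rewrite (reindex_onto (fun B => A :|: B) (fun U => U :\: A)) /=; last first.
  by move=> U /andP[_]; rewrite powersetE => sAU; rewrite setDE setUIr setUCr setIT; apply/setUidPr.
have condE B : [&& A :|: B \subset S, A \subset A :|: B
                    & (A :|: B) :\: A == B] = (B \subset S :\: A).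
  rewrite subUset sAS subsetUl subsetD; case: (B \subset S) => //=.
  rewrite setDUl setDv set0U; apply/eqP/idP => [/setDidPl //|/setDidPl //].
apply: eq_big => [B|B]; first by rewrite !powersetE -condE andbA.
rewrite !powersetE -andbA condE subsetD => /andP[sBS dBA].
have dAB : [disjoint A & B] by rewrite disjoint_sym.
have -> : (A :|: B) :\: A = B by rewrite setDUl setDv set0U; apply/setDidPl.
have -> : S :\: (A :|: B) = S :\: A :\: B by rewrite setDDl.
congr (_ ^+ _ * _).
have sBSA : B \subset S :\: A by rewrite subsetD sBS.
have eSA : S :\: A = B :|: (S :\: A :\: B).
  by rewrite [_ :\: B]setDE setUIr setUCr setIT; apply/esym/setUidPr.
have dB : [disjoint B & S :\: A :\: B].
  by rewrite disjoint_sym disjoints_subset setDE subsetIr.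
by rewrite inversionsUl // [in RHS]eSA inversionsUr // -eSA addnC addnA.
Qed.

Lemma ext_constE (r : R) S : ext_const r S = if S == set0 then r else 0.
Proof. by rewrite ffunE. Qed.

Lemma ext_const_mulE (r : R) (f : exterior) S :
  ext_mul (ext_const r) f S = r * f S.
Proof.
rewrite ffunE (bigD1 set0) ?powersetE ?sub0set //= big1 => [|A /andP[_ nA]].
  by rewrite addr0 ext_constE eqxx inversions0s setD0 mul1r.
by rewrite ext_constE (negPf nA) mul0r mulr0.
Qed.

Lemma ext_mul_constE (r : R) (f : exterior) S :
  ext_mul f (ext_const r) S = f S * r.
Proof.
rewrite ffunE (bigD1 S) ?powersetE //= big1 => [|A].
  by rewrite addr0 setDv ext_constE eqxx inversionss0 mul1r.
rewrite powersetE => /andP[sAS nAS].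
rewrite ext_constE ifN ?mulr0 // setD_eq0; apply: contra nAS => sSA.
by rewrite eqEsubset sAS.
Qed.

Lemma ext_mul1l : left_id (ext_const 1) ext_mul.
Proof. by move=> f; apply/ffunP => S; rewrite ext_const_mulE mul1r. Qed.

Lemma ext_mul1r : right_id (ext_const 1) ext_mul.
Proof. by move=> f; apply/ffunP => S; rewrite ext_mul_constE mulr1. Qed.

Lemma ext_mulDl : left_distributive ext_mul +%R.
Proof.
move=> f g h; apply/ffunP => S; rewrite !ffunE -big_split /=.
by apply: eq_bigr => A _; rewrite ffunE mulrDl mulrDr.
Qed.

Lemma ext_mulDr : right_distributive ext_mul +%R.
Proof.
move=> f g h; apply/ffunP => S; rewrite !ffunE -big_split /=.
by apply: eq_bigr => A _; rewrite ffunE !mulrDr.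
Qed.

Lemma ext_const1_neq0 : ext_const 1 != 0.
Proof.
by apply/eqP => /ffunP/(_ set0); rewrite ext_constE !ffunE eqxx => /eqP; rewrite oner_eq0.
Qed.

HB.instance Definition _ := GRing.Zmodule_isNzRing.Build exterior
  ext_mulA ext_mul1l ext_mul1r ext_mulDl ext_mulDr ext_const1_neq0.

Lemma ext_const_is_zmod_morphism : zmod_morphism ext_const.
Proof.
by move=> a b; apply/ffunP => S; rewrite !ffunE; case: eqP => // _; rewrite subr0.
Qed.

Lemma ext_const_is_monoid_morphism : monoid_morphism ext_const.
Proof.
split=> // a b; apply/ffunP => S; rewrite ext_const_mulE !ext_constE.
by case: eqP => // _; rewrite mulr0.
Qed.

HB.instance Definition _ :=
  GRing.isZmodMorphism.Build R exterior ext_const ext_const_is_zmod_morphism.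
HB.instance Definition _ :=
  GRing.isMonoidMorphism.Build R exterior ext_const ext_const_is_monoid_morphism.

Lemma ext_const_comm (r : R) (f : exterior) : ext_const r * f = f * ext_const r.
Proof. by apply/ffunP => S; rewrite ext_const_mulE ext_mul_constE mulrC. Qed.

(* Inverses are taken in the whole (non-commutative) algebra. *)
Definition ext_unit : {pred exterior} :=
  fun x => `[< exists y : exterior, y * x = 1 /\ x * y = 1 >].

Definition ext_inv (x : exterior) : exterior :=
  if pselect (exists y : exterior, y * x = 1 /\ x * y = 1) is left ex
  then projT1 (cid ex) else x.

Lemma ext_mulVr : {in ext_unit, left_inverse 1 ext_inv *%R}.
Proof.
move=> x /asboolP ex; rewrite /ext_inv; case: pselect => // ex'.
by case: (cid _) => y [].
Qed.

Lemma ext_mulrV : {in ext_unit, right_inverse 1 ext_inv *%R}.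
Proof.
move=> x /asboolP ex; rewrite /ext_inv; case: pselect => // ex'.
by case: (cid _) => y [].
Qed.

Lemma ext_unitP x y : y * x = 1 /\ x * y = 1 -> x \in ext_unit.
Proof. by move=> xy; apply/asboolP; exists y. Qed.

Lemma ext_inv_out : {in [predC ext_unit], ext_inv =1 id}.
Proof.
move=> x; rewrite inE => /asboolP nex; rewrite /ext_inv.
by case: pselect.
Qed.

HB.instance Definition _ := GRing.NzRing_hasMulInverse.Build exterior
  ext_mulVr ext_mulrV ext_unitP ext_inv_out.

End Exterior.

Section CoordinateRing.

Variables (K : fieldType) (m n : nat).

Definition even_index := ('I_m * 'I_m + 'I_n * 'I_n)%type.
Definition odd_index := ('I_m * 'I_n + 'I_n * 'I_m)%type.

(* The polynomial ring on the even c_ij; the free supercommutative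
   superalgebra A(m|n) is [exterior even_poly #|{: odd_index}|]. *)
Definition even_poly := {mpoly K[#|{: even_index}|]}.

Definition even_var (e : even_index) : even_poly := 'X_(enum_rank e).

Definition even_det : even_poly :=
  \det (\matrix_(i < m, j < m) even_var (inl (i, j)))
  * \det (\matrix_(i < n, j < n) even_var (inr (i, j))).

Lemma even_det_neq0 : even_det != 0.
Proof.
pose idv (i : 'I_#|{: even_index}|) : K :=
  match enum_val i with inl p => (p.1 == p.2)%:R | inr p => (p.1 == p.2)%:R end.
suff: even_det.@[idv] != 0 by apply: contra_neq => ->; rewrite meval0.
have ev k (h : 'I_k * 'I_k -> even_index) :
  (forall p, idv (enum_rank (h p)) = (p.1 == p.2)%:R) ->
  (\det (\matrix_(i < k, j < k) even_var (h (i, j)))).@[idv] = 1.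
  move=> hh; rewrite -[LHS]/(meval _ _) -det_map_mx -[RHS](det1 K k); congr (\det _).
  by apply/matrixP => i j; rewrite !mxE; apply: etrans (mevalXU _ _) _; rewrite hh.
by rewrite /even_det mevalM !ev ?mulr1 ?oner_eq0 // => p; rewrite /idv enum_rankK.
Qed.

(* Since [even_poly] is a domain, its localization at [even_det] is realized
   as a subring of its field of fractions. *)
Definition in_even_loc : {pred {fraction even_poly}} :=
  fun x => `[< exists pk : even_poly * nat,
               x = tofrac pk.1 / tofrac even_det ^+ pk.2 >].

Lemma tofrac_det_neq0 k : tofrac even_det ^+ k != 0.
Proof. by rewrite expf_neq0 // tofrac_eq0 even_det_neq0. Qed.

Lemma in_even_loc_poly (p : even_poly) : tofrac p \in in_even_loc.
Proof. by apply/asboolP; exists (p, 0%N); rewrite /= expr0 divr1. Qed.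

Lemma in_even_loc_subring : subring_closed in_even_loc.
Proof.
split=> [|x y|x y].
- by rewrite -[1](rmorph1 (@tofrac _)) in_even_loc_poly.
- move=> /asboolP[[p k] /= ->] /asboolP[[q l] /= ->]; apply/asboolP.
  exists (p * even_det ^+ l - q * even_det ^+ k, (k + l)%N) => /=.
  have [dk dl] := (tofrac_det_neq0 k, tofrac_det_neq0 l).
  rewrite -mulNr addf_div // -exprD; congr (_ / _).
  by rewrite mulNr -!rmorphXn -!rmorphM -rmorphB.
- move=> /asboolP[[p k] /= ->] /asboolP[[q l] /= ->]; apply/asboolP.
  by exists (p * q, (k + l)%N) => /=; rewrite mulf_div -exprD -rmorphM.
Qed.

HB.instance Definition _ :=
  GRing.isSubringClosed.Build _ in_even_loc in_even_loc_subring.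

Record even_loc : Type := EvenLoc {
  even_loc_val : {fraction even_poly};
  even_loc_valP : even_loc_val \in in_even_loc }.

HB.instance Definition _ := [isSub for even_loc_val].
HB.instance Definition _ := [Choice of even_loc by <:].
HB.instance Definition _ := [SubChoice_isSubComNzRing of even_loc by <:].

Definition even_loc_poly (p : even_poly) : even_loc :=
  EvenLoc (in_even_loc_poly p).

Lemma even_loc_poly_is_zmod_morphism : zmod_morphism even_loc_poly.
Proof. by move=> p q; apply: val_inj; rewrite /= rmorphB. Qed.

Lemma even_loc_poly_is_monoid_morphism : monoid_morphism even_loc_poly.
Proof.
by split=> [|p q]; apply: val_inj; rewrite /= ?rmorph1 ?rmorphM.
Qed.

HB.instance Definition _ := GRing.isZmodMorphism.Build even_poly even_loc
  even_loc_poly even_loc_poly_is_zmod_morphism.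
HB.instance Definition _ := GRing.isMonoidMorphism.Build even_poly even_loc
  even_loc_poly even_loc_poly_is_monoid_morphism.

(* Some (p, k) with x = p / even_det ^ k. *)
Definition even_loc_repr (x : even_loc) : even_poly * nat :=
  projT1 (cid (asboolW (even_loc_valP x))).

(* K[G]: localizing A(m|n) amounts to localizing its even coefficients. *)
Definition KGL := exterior even_loc #|{: odd_index}|.

HB.instance Definition _ :=
  GRing.UnitRing.copy KGL (exterior even_loc #|{: odd_index}|).

Definition KGL_even (p : even_poly) : KGL := ext_const _ (even_loc_poly p).

Definition KGL_const (a : K) : KGL := KGL_even a%:MP.

Lemma KGL_const_is_zmod_morphism : zmod_morphism KGL_const.
Proof. by move=> a b; rewrite /KGL_const /KGL_even !rmorphB. Qed.

Lemma KGL_const_is_monoid_morphism : monoid_morphism KGL_const.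
Proof. by split=> [|a b]; rewrite /KGL_const /KGL_even ?rmorph1 ?rmorphM. Qed.

HB.instance Definition _ := GRing.isZmodMorphism.Build K KGL
  KGL_const KGL_const_is_zmod_morphism.
HB.instance Definition _ := GRing.isMonoidMorphism.Build K KGL
  KGL_const KGL_const_is_monoid_morphism.

Definition KGL_scale (a : K) (x : KGL) : KGL := KGL_const a * x.

Fact KGL_scaleA a b x : KGL_scale a (KGL_scale b x) = KGL_scale (a * b) x.
Proof. by rewrite /KGL_scale rmorphM mulrA. Qed.
Fact KGL_scale1 : left_id 1 KGL_scale.
Proof. by move=> x; rewrite /KGL_scale rmorph1 mul1r. Qed.
Fact KGL_scaleDr : right_distributive KGL_scale +%R.
Proof. by move=> a x y; rewrite /KGL_scale mulrDr. Qed.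
Fact KGL_scaleDl x : {morph KGL_scale^~ x : a b / a + b}.
Proof. by move=> a b; rewrite /KGL_scale rmorphD mulrDl. Qed.

HB.instance Definition _ := GRing.Zmodule_isLmodule.Build K KGL
  KGL_scaleA KGL_scale1 KGL_scaleDr KGL_scaleDl.

Fact KGL_scaleAl (a : K) (x y : KGL) : a *: (x * y) = a *: x * y.
Proof. exact: mulrA. Qed.

HB.instance Definition _ := GRing.Lmodule_isLalgebra.Build K KGL KGL_scaleAl.

Fact KGL_scaleAr (a : K) (x y : KGL) : a *: (x * y) = x * (a *: y).
Proof.
rewrite -[LHS]/(KGL_const a * _) -[a *: y]/(KGL_const a * y) !mulrA.
by congr (_ * _); apply: ext_const_comm.
Qed.

HB.instance Definition _ := GRing.Lalgebra_isAlgebra.Build K KGL KGL_scaleAr.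

Definition C11 : 'M[KGL]_m := \matrix_(i, j) KGL_even (even_var (inl (i, j))).
Definition C12 : 'M[KGL]_(m, n) :=
  \matrix_(i, j) ext_gen _ (enum_rank (inl (i, j) : odd_index)).
Definition C21 : 'M[KGL]_(n, m) :=
  \matrix_(i, j) ext_gen _ (enum_rank (inr (i, j) : odd_index)).
Definition C22 : 'M[KGL]_n := \matrix_(i, j) KGL_even (even_var (inr (i, j))).

Definition C : 'M[KGL]_(m + n) := block_mx C11 C12 C21 C22.

Definition even_entry (D : 'M[KGL]_(m + n)) (e : even_index) : KGL :=
  match e with
  | inl p => ulsubmx D p.1 p.2
  | inr p => drsubmx D p.1 p.2
  end.

Definition odd_entry (D : 'M[KGL]_(m + n)) (o : odd_index) : KGL :=
  match o with
  | inl p => ursubmx D p.1 p.2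
  | inr p => dlsubmx D p.1 p.2
  end.

Definition subst_poly (D : 'M[KGL]_(m + n)) (p : even_poly) : KGL :=
  mmap KGL_const (fun i => even_entry D (enum_val i)) p.

(* The substitution C |-> D.  It is the K-superalgebra endomorphism of K[G]
   sending C to D as soon as the diagonal blocks of D are even with invertible
   determinants and its off-diagonal blocks are odd; it does not depend on the
   fractions chosen by [even_loc_repr]. *)
Definition subst (D : 'M[KGL]_(m + n)) (f : KGL) : KGL :=
  \sum_(S : {set 'I_#|{: odd_index}|})
    (let: (p, k) := even_loc_repr (f S) in
     subst_poly D p * subst_poly D even_det ^- k)
    * \prod_(o in S) odd_entry D (enum_val o).

(* K-points suffice below: K is algebraically closed and the algebraic group
   G_ev is reduced, as is its Borel subgroup. *)
Definition Gev : {pred 'M[K]_(m + n)} :=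
  fun g => [&& g \in unitmx, ursubmx g == 0 & dlsubmx g == 0].

Definition Gev_upper_borel : {pred 'M[K]_(m + n)} :=
  fun g => (g \in Gev) && is_trig_mx g^T.

Definition act (g : 'M[K]_(m + n)) : KGL -> KGL :=
  subst (C *m map_mx KGL_const g).

Definition span (X : KGL -> Prop) (w : KGL) : Prop :=
  exists s : seq (K * KGL),
    (forall p, p \in s -> X p.2) /\ w = \sum_(p <- s) p.1 *: p.2.

Definition Gev_submodule (M : KGL -> Prop) : Prop :=
  [/\ M 0, forall (a : K) (x y : KGL), M x -> M y -> M (a *: x + y)
    & forall g x, g \in Gev -> M x -> M (act g x)].

Definition Gev_irreducible (M : KGL -> Prop) : Prop :=
  [/\ Gev_submodule M, exists2 x, M x & x != 0
    & forall L : KGL -> Prop, Gev_submodule L -> (forall x, L x -> M x) ->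
        (forall x, L x -> x = 0) \/ (forall x, M x -> L x)].

Definition Gev_primitive (w : KGL) : Prop :=
  w != 0 /\ forall g, g \in Gev_upper_borel -> exists a : K, act g w = a *: w.

Definition is_direct_sum (I : finType) (P : pred I) (M : I -> KGL -> Prop)
    (F : KGL -> Prop) : Prop :=
  (forall w, F w <-> exists u : I -> KGL,
     (forall i, P i -> M i (u i)) /\ w = \sum_(i | P i) u i) /\
  (forall u : I -> KGL, (forall i, P i -> M i (u i)) ->
     \sum_(i | P i) u i = 0 -> forall i, P i -> u i = 0).

(* y_ij is [Y i j] and phi(c_kl) is [Phi k l], with k, l shifted by m. *)
Definition Y : 'M[KGL]_(m, n) := (\det C11)^-1 *: (\adj C11 *m C12).
Definition Phi : 'M[KGL]_n := C22 - C21 *m Y.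

(* Rows 1, ..., size s of A; columns s, in that order, possibly repeated. *)
Definition top_minor p (A : 'M[KGL]_p) (s : seq 'I_p) : KGL :=
  \det (\matrix_(a < size s, b < size s)
          oapp (fun i => A i (tnth (in_tuple s) b)) 0 (insub (val a))).

Definition Dplus (s : seq 'I_m) : KGL := top_minor C11 s.
Definition Dminus (s : seq 'I_n) : KGL := top_minor Phi s.

(* The sequence 1, ..., k, shifted to 0, ..., k - 1. *)
Definition firsts p (k : nat) : seq 'I_p := take k (enum 'I_p).

(* Number of columns, and length of the q-th column counted from 0, of the
   Young diagram of l - l_p (1, ..., 1), for l = (l_1 >= ... >= l_p). *)
Definition ncols (l : seq int) : nat := `|(l`_0 - last 0 l)%R|%N.
Definition col_length (l : seq int) (q : nat) : nat :=
  count (fun x => q%:Z < x - last 0 l) l.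

Definition tableau p (l : seq int) (T : nat -> seq 'I_p) : Prop :=
  forall q, (q < ncols l)%N -> size (T q) = col_length l q.

Definition dominant (l : seq int) : bool := sorted >=%O l.

Variables (lp : m.-tuple int) (lm : n.-tuple int).

Definition H0 : KGL -> Prop :=
  span (fun w => exists (T : nat -> seq 'I_m) (U : nat -> seq 'I_n),
    [/\ tableau lp T, tableau lm U
      & w = Dplus (firsts m m) ^ (last 0 lp)
            * (\prod_(q < ncols lp) Dplus (T q))
            * Dminus (firsts n n) ^ (last 0 lm)
            * (\prod_(q < ncols lm) Dminus (U q))]).

Definition F1 : KGL -> Prop :=
  span (fun w => exists x i j, H0 x /\ w = x * Y i j).

Definition leading_product (ep : 'I_m -> int) (em : 'I_n -> int) : KGL :=
  (\prod_(a < m) Dplus (firsts m a.+1) ^ (ep a))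
  * (\prod_(b < n) Dminus (firsts n b.+1) ^ (em b)).

(* Here lp`_m = lm`_n = 0, as out-of-range components of a tuple. *)
Definition hw_vector : KGL :=
  leading_product (fun a => lp`_a - lp`_a.+1) (fun b => lm`_b - lm`_b.+1).

(* [hw_vector / (D+(1..i) D-(m+1..m+j-1))], with i and j counted from 1; the
   division is on exponents as D+(1..i) need not be invertible in K[G]. *)
Definition hw_quotient (i : 'I_m) (j : 'I_n) : KGL :=
  leading_product (fun a => lp`_a - lp`_a.+1 - (a == i)%:Z)
                  (fun b => lm`_b - lm`_b.+1 - (b.+1 == j)%:Z).

Definition pi_vector (i : 'I_m) (j : 'I_n) : KGL :=
  hw_quotient i j *
  \sum_(r < m | (i <= r)%N) Dplus (rcons (firsts m i) r) *
    \sum_(s < n | (s <= j)%N)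
      (-1) ^+ (s + j) * Dminus (rem s (firsts n j.+1)) * Y r s.

Definition row_condition (i : 'I_m) : bool :=
  ((i.+1 < m)%N && (lp`_i != lp`_i.+1)) || ((i.+1 == m) && (lp`_i != 0)).

Definition col_condition (j : 'I_n) : bool :=
  (0 < j)%N ==> (lm`_j.-1 != lm`_j).

(* The index set [idx] of the pi_ij is a parameter because the pairs satisfying
   [row_condition] and [col_condition] do not suffice when lp`_m.-1 = 0: the
   vectors pi_ij with i the last row are then primitive as well.  For m = n = 1
   and the zero weight no pair qualifies, while F_1 is the line of y_12. *)
Definition pi_complete (idx : pred ('I_m * 'I_n)) : Prop :=
  forall w, F1 w /\ Gev_primitive w <->
    exists2 p, idx p & exists2 a : K, a != 0 & w = a *: pi_vector p.1 p.2.

Definition F1_decomposition (idx : pred ('I_m * 'I_n)) : Prop :=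
  exists M : 'I_m * 'I_n -> KGL -> Prop,
    (forall p, idx p -> [/\ Gev_irreducible (M p), M p (pi_vector p.1 p.2)
                          & Gev_primitive (pi_vector p.1 p.2)])
    /\ is_direct_sum idx M F1.

End CoordinateRing.

(* Main.v *)
From Pilot Require Import Defs.
From HB Require Import structures.
From mathcomp Require Import all_boot all_order fingroup perm all_algebra fraction.
From mathcomp Require Import ssrcomplements mpoly boolp.
From mathcomp Require Import zify ring.

Set Implicit Arguments.
Unset Strict Implicit.
Unset Printing Implicit Defensive.

Import Order.TTheory GRing.Theory Num.Theory.

Local Open Scope ring_scope.

(** The even subgroup acts on the matrix [y] by [g1^-1 * y * g2] and on
    [phi(C22)] through right multiplication by [g2]. So let [theta] be the
    morphism from the polynomials in the entries of two generic matrices to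
    [K[G]] that sends these matrices to [C11] and [phi(C22)]; it turns the
    determinants D+ and D- into ordinary minors on top rows. The first floor
    consists of the elements
      det(C11)^a * det(phi(C22))^b * sum_(i,j) theta(Q_ij) * y_ij,
    with [a] and [b] the last parts of the weight, where the entries of the
    matrix [Q] lie in the span of the products of minors shaped by the diagrams
    ([F1_floor]). This parametrization is injective ([floor_inj]) and equivariant
    for an explicit action on matrices of polynomials ([act_floor]), which reduces
    the statement to commutative algebra. The characteristic enters here only
    through the fact that odd elements must have square zero.

    The matrix [pi_poly i j] of the vector [pi_ij] has rank one. By Laplace
    expansion its two factors transform under upper triangular matrices so as to
    cancel the constant matrices in the action, up to scalars; hence [pi_ij] is
    primitive ([pi_poly_borel]). It lies in the first floor because a column of
    length [i], respectively [j - 1], of the diagram may be exchanged for another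
    minor of the same size ([hw_minor_prod_replace]).

    Let now the characteristic be zero, so that polynomials vanishing on all
    products of lower and upper triangular matrices are zero
    ([big_cell_vanishing]). Minors on top rows are multiplied by scalars under
    left multiplication by lower triangular matrices, so an invariant [Q] of the
    upper unitriangular matrices is determined by its value at the identity. If
    it is also a torus eigenvector, this value has a single nonzero entry [(i, j)],
    and the conditions on [i] and [j] follow from equivariance under a larger parabolic
    subgroup when two parts of the weight coincide. As [pi_poly i j] takes at the
    identity the value with entry 1 at [(i, j)], the primitive vectors are the
    multiples of the [pi_ij] ([invariant_eigenvector]).

    The decomposition rests on three facts. A torus eigenvector of maximal height
    in a nonzero submodule is invariant, so every nonzero submodule contains some
    [pi_ij] ([submodule_contains_pi]). The apolar form
    [p(d/dx) q] evaluated at the origin is contravariant: the transpose of [g] is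
    adjoint to [g] ([floor_form_act]). For it the [pi_ij] generate mutually
    orthogonal submodules, by a computation on the big cell
    ([pi_poly_orbit_orth]), and they are not isotropic, since they have integer
    coefficients and the form has positive integer weights ([pi_poly_norm]). It
    follows that the generated submodules are irreducible and that the first floor
    is their direct sum ([orbit_span_irreducible],
    [orbit_sum_full], [orbit_sum_direct]). *)

(** * Complete reducibility from a contravariant form *)

Section Subspaces.

Variables (K : fieldType) (V : lmodType K).
Implicit Types L : V -> Prop.

Definition subspace L :=
  L 0 /\ forall (a : K) (x y : V), L x -> L y -> L (a *: x + y).

Lemma subspaceZ L a x : subspace L -> L x -> L (a *: x).
Proof. by move=> [L0 LD] Lx; rewrite -[_ *: _]addr0; apply: LD. Qed.

Lemma subspaceD L x y : subspace L -> L x -> L y -> L (x + y).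
Proof. by move=> [_ LD] Lx Ly; rewrite -[x]scale1r; apply: LD. Qed.

Lemma subspaceB L x y : subspace L -> L x -> L y -> L (x - y).
Proof. by move=> [_ LD] Lx Ly; rewrite addrC -scaleN1r; apply: LD. Qed.

Lemma subspace_sum L (I : Type) (r : seq I) (P : pred I) (f : I -> V) :
  subspace L -> (forall i, P i -> L (f i)) -> L (\sum_(i <- r | P i) f i).
Proof.
move=> sL Lf; elim/big_rec: _ => [|i x Pi Lx]; first by case: sL.
by apply: subspaceD => //; apply: Lf.
Qed.

Lemma subspaceZ_inv L a x : a != 0 -> subspace L -> L (a *: x) -> L x.
Proof.
move=> a0 sL /(subspaceZ a^-1 sL); rewrite scalerA mulVf // scale1r.
by [].
Qed.

(** A matrix of maximal rank among those whose rows lie in the subspace spans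
    it. *)
Lemma subspace_rowspace k (U : 'rV[K]_k -> Prop) :
    U 0 -> (forall a x y, U x -> U y -> U (a *: x + y)) ->
  exists S : 'M[K]_k, forall x, U x <-> (x <= S)%MS.
Proof.
move=> U0 UD.
pose good r := `[< exists S : 'M[K]_k,
  \rank S = r /\ forall x : 'rV_k, (x <= S)%MS -> U x >].
have ex : exists r, good r.
  exists 0%N; apply/asboolP; exists 0; split; first by rewrite mxrank0.
  by move=> x; rewrite submx0 => /eqP ->.
have bnd r : good r -> (r <= k)%N.
  by move=> /asboolP [S [<- _]]; apply: rank_leq_row.
case: (ex_maxnP ex bnd) => r /asboolP[S [rkS SU]] rmax.
exists S => x; split=> [Ux|]; last exact: SU.
have := rmax (\rank (S + x)%MS); rewrite -rkS => le; have/le{}le : good (\rank (S + x)%MS).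
  apply/asboolP; exists (S + x)%MS; split=> // y /sub_addsmxP[[u v] ->] /=.
  rewrite [v](mx11_scalar) mul_scalar_mx addrC; apply: UD => //.
  by apply: SU; apply: submxMl.
have : (S + x <= S)%MS by have := mxrank_leqif_sup (addsmxSl S x) => -[_ <-];
  rewrite eqn_leq le andbT mxrankS ?addsmxSl.
by apply: submx_trans; apply: addsmxSr.
Qed.

End Subspaces.

(** The setting is a module [F] with a symmetric form for which each group
    element has an adjoint in the group (for matrix groups, the transpose), and
    vectors [p_ i] such that every nonzero submodule of [F] contains one of
    them. If the [p_ i] generate mutually orthogonal submodules and are not
    isotropic, these submodules are irreducible and [F] is their direct sum.
    The form may be isotropic on other vectors, so orthogonal complements are
    obtained by linear algebra and not from definiteness. *)
Section ContravariantForm.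

Variables (K : fieldType) (V : lmodType K) (G : Type) (rho : G -> V -> V).
Hypothesis rhoL : forall g (a : K) x y,
  rho g (a *: x + y) = a *: rho g x + rho g y.
Hypothesis rhoM : forall g h, exists k, forall x, rho g (rho h x) = rho k x.
Hypothesis rho1 : exists e, forall x, rho e x = x.

Implicit Types L F : V -> Prop.

Definition submodule L := subspace L /\ forall g x, L x -> L (rho g x).

Definition orbit_span (v : V) : V -> Prop :=
  fun x => exists s : seq (K * G), x = \sum_(c <- s) c.1 *: rho c.2 v.

Lemma rho0 g : rho g 0 = 0.
Proof.
by have := rhoL g 0 0 0; rewrite scale0r addr0 scale0r add0r => e; have := rhoL g 1 0 0;
  rewrite !scale1r addr0 => /esym/eqP; rewrite -subr_eq0 addrK => /eqP.
Qed.

Lemma rhoD g x y : rho g (x + y) = rho g x + rho g y.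
Proof. by have := rhoL g 1 x y; rewrite !scale1r. Qed.

Lemma rhoZ g a x : rho g (a *: x) = a *: rho g x.
Proof. by have := rhoL g a x 0; rewrite rho0 !addr0. Qed.

Lemma orbit_span_submodule v : submodule (orbit_span v).
Proof.
split; first split.
- by exists [::]; rewrite big_nil.
- move=> a _ _ [s ->] [t ->]; exists ([seq (a * c.1, c.2) | c <- s] ++ t).
  rewrite big_cat big_map scaler_sumr; congr (_ + _).
  by apply: eq_bigr => c _; rewrite scalerA.
- move=> g _ [s ->]; elim: s => [|c s [t e]]; rewrite ?big_nil ?big_cons.
    by rewrite rho0; exists [::]; rewrite big_nil.
  have [k ek] := rhoM g c.2; exists ((c.1, k) :: t).
  by rewrite big_cons /= rhoD rhoZ e ek.
Qed.

Lemma orbit_span_refl v : orbit_span v v.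
Proof.
by have [e he] := rho1; exists [:: (1, e)]; rewrite big_seq1 scale1r he.
Qed.

Lemma orbit_span_min L v : submodule L -> L v -> forall x, orbit_span v x -> L x.
Proof.
move=> [sL LG] Lv _ [s ->]; apply: subspace_sum => // c _.
by apply: subspaceZ => //; apply: LG.
Qed.

Variables (B : V -> V -> K) (tr : G -> G).
Hypothesis BL : forall a x y z, B (a *: x + y) z = a * B x z + B y z.
Hypothesis Bsym : forall x y, B x y = B y x.
Hypothesis Btr : forall g x y, B (rho g x) y = B x (rho (tr g) y).

Variables (F : V -> Prop) (k : nat) (e : 'I_k -> V).
Hypothesis Fsub : submodule F.
Hypothesis Fspan : forall x, F x -> exists c : 'I_k -> K, x = \sum_i c i *: e i.

Variables (I : finType) (idx : pred I) (p_ : I -> V).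
Hypothesis Fp : forall i, idx i -> F (p_ i).
Hypothesis submodule_p : forall L, submodule L -> (forall x, L x -> F x) ->
  (exists2 x, L x & x != 0) -> exists2 i, idx i & L (p_ i).
Hypothesis orth_p : forall i j g, idx i -> idx j -> i != j -> B (rho g (p_ i)) (p_ j) = 0.
Hypothesis norm_p : forall i, idx i -> B (p_ i) (p_ i) != 0.

Lemma form0l z : B 0 z = 0.
Proof. by have /eqP := BL 1 0 0 z; rewrite scale1r addr0 mul1r eq_sym -subr_eq0 addrK => /eqP. Qed.

Lemma formDl x y z : B (x + y) z = B x z + B y z.
Proof. by have := BL 1 x y z; rewrite scale1r mul1r. Qed.

Lemma formZl a x z : B (a *: x) z = a * B x z.
Proof. by have := BL a x 0 z; rewrite form0l !addr0. Qed.

Lemma form_suml (J : Type) (r : seq J) (P : pred J) (f : J -> V) z :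
  B (\sum_(i <- r | P i) f i) z = \sum_(i <- r | P i) B (f i) z.
Proof.
elim/big_rec2: _ => [|i x y _ <-]; first exact: form0l.
by rewrite formDl.
Qed.

Lemma form_sumr (J : Type) (r : seq J) (P : pred J) (f : J -> V) z :
  B z (\sum_(i <- r | P i) f i) = \sum_(i <- r | P i) B z (f i).
Proof. by rewrite Bsym form_suml; apply: eq_bigr => i _; rewrite Bsym. Qed.

Definition perp L : V -> Prop := fun x => F x /\ forall y, L y -> B x y = 0.

Lemma perp_submodule L : submodule L -> submodule (perp L).
Proof.
move=> [sL LG]; case: (Fsub) => -[F0 FD] FG; split; first split.
- by split=> // y _; rewrite form0l.
- move=> a x y [Fx hx] [Fy hy]; split; first exact: FD.
  by move=> z Lz; rewrite BL hx // hy // mulr0 addr0.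
- by move=> g x [Fx hx]; split=> [|y Ly]; [exact: FG|rewrite Btr hx //; apply: LG].
Qed.

(** Moving the group element to one side by the adjoint, orthogonality of the
    submodules reduces to [orth_p]. *)
Lemma orbit_span_orth i j : idx i -> idx j -> i != j ->
  forall x y, orbit_span (p_ i) x -> orbit_span (p_ j) y -> B x y = 0.
Proof.
move=> Pi Pj ij _ _ [s ->] [t ->].
rewrite form_suml big1 // => c _; rewrite form_sumr big1 // => d _.
rewrite formZl Bsym formZl Btr Bsym.
by have [h ->] := rhoM (tr d.2) c.2; rewrite orth_p // !mulr0.
Qed.

Lemma orbit_span_sub i : idx i -> forall x, orbit_span (p_ i) x -> F x.
Proof. by move=> Pi; apply: orbit_span_min => //; apply: Fp. Qed.

Lemma p_mem_orbit_span i j : idx i -> idx j -> orbit_span (p_ i) (p_ j) -> i = j.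
Proof.
move=> Pi Pj Lij; apply/eqP; apply: contraT => ij.
have := norm_p Pj.
by rewrite (orbit_span_orth Pi Pj ij Lij (orbit_span_refl _)) eqxx.
Qed.

(** A nonzero submodule contains some [p_ j], and [j = i] because [p_ j] is not
    orthogonal to itself. *)
Lemma orbit_span_irreducible i L : idx i -> submodule L ->
    (forall x, L x -> orbit_span (p_ i) x) ->
  (forall x, L x -> x = 0) \/ (forall x, orbit_span (p_ i) x -> L x).
Proof.
move=> Pi sL LLi; have [[x Lx x0]|L0] := pselect (exists2 x, L x & x != 0); last first.
  by left=> x Lx; apply/eqP; apply: contraT => x0; case: L0; exists x.
right; have LF y : L y -> F y by move=> /LLi/(orbit_span_sub Pi).
have [j Pj Lj] := submodule_p sL LF (ex_intro2 _ _ x Lx x0).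
have := p_mem_orbit_span Pi Pj (LLi _ Lj) => ij; rewrite -ij in Lj.
exact: orbit_span_min.
Qed.

(** The radical of the form on the submodule generated by [p_ i] is a
    submodule; if it were not zero it would contain [p_ i], which is not
    isotropic. *)
Lemma orbit_span_nondegenerate i x : idx i -> orbit_span (p_ i) x ->
  (forall y, orbit_span (p_ i) y -> B x y = 0) -> x = 0.
Proof.
move=> Pi Lx xperp; apply/eqP; apply: contraT => x0.
pose N y := orbit_span (p_ i) y /\ perp (orbit_span (p_ i)) y.
have sN : submodule N.
  have [sL LG] := orbit_span_submodule (p_ i).
  have [sP PG] := perp_submodule (orbit_span_submodule (p_ i)).
  split; first split.
  - by split; [case: sL|case: sP].
  - by move=> a y z [? ?] [? ?]; split; [case: sL => _; apply|case: sP => _; apply].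
  - by move=> g y [? ?]; split; [apply: LG|apply: PG].
have NF y : N y -> F y by case=> /(orbit_span_sub Pi).
have Nx : N x by split=> //; split=> //; apply: orbit_span_sub Lx.
have [j Pj [Lj [_ pj]]] := submodule_p sN NF (ex_intro2 _ _ x Nx x0).
have ij := p_mem_orbit_span Pi Pj Lj; rewrite -ij in pj.
by have := norm_p Pi; rewrite pj ?eqxx //; apply: orbit_span_refl.
Qed.

Definition orbit_sum : V -> Prop := fun x =>
  exists u : I -> V, (forall i, idx i -> orbit_span (p_ i) (u i)) /\ x = \sum_(i | idx i) u i.

Lemma orbit_sum_submodule : submodule orbit_sum.
Proof.
split; first split.
- exists (fun=> 0); split=> [i _|]; last by rewrite big1.
  by case: (orbit_span_submodule (p_ i)) => -[].
- move=> a _ _ [u [Lu ->]] [v [Lv ->]]; exists (fun i => a *: u i + v i); split=> [i Pi|].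
    by case: (orbit_span_submodule (p_ i)) => -[_ LD] _; apply: LD; [apply: Lu|apply: Lv].
  by rewrite big_split scaler_sumr.
- move=> g _ [u [Lu ->]]; exists (fun i => rho g (u i)); split=> [i Pi|].
    by case: (orbit_span_submodule (p_ i)) => _ LG; apply: LG; apply: Lu.
  by elim/big_rec2: _ => [|i x y _ <-]; [rewrite rho0|rewrite rhoD].
Qed.

Lemma orbit_span_sum i x : idx i -> orbit_span (p_ i) x -> orbit_sum x.
Proof.
move=> Pi Lx; exists (fun j => if j == i then x else 0); split=> [j Pj|].
  by case: eqP => [->//|_]; case: (orbit_span_submodule (p_ j)) => -[].
rewrite (bigD1 i) //= eqxx big1 ?addr0 // => j /andP[_ /negPf ->] //.
Qed.

Lemma form_orbit_sum (u : I -> V) i y : (forall i, idx i -> orbit_span (p_ i) (u i)) ->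
  idx i -> orbit_span (p_ i) y -> B (\sum_(j | idx j) u j) y = B (u i) y.
Proof.
move=> Lu Pi Ly; rewrite form_suml (bigD1 i) //= big1 ?addr0 // => j /andP[Pj ji].
by apply: (orbit_span_orth Pj Pi) => //; apply: Lu.
Qed.

Lemma orbit_sum_direct (u : I -> V) : (forall i, idx i -> orbit_span (p_ i) (u i)) ->
  \sum_(i | idx i) u i = 0 -> forall i, idx i -> u i = 0.
Proof.
move=> Lu u0 i Pi; apply: (orbit_span_nondegenerate Pi (Lu _ Pi)) => y Ly.
by rewrite -(form_orbit_sum Lu) // u0 form0l.
Qed.

Lemma orbit_sum_nondegenerate x : orbit_sum x ->
  (forall y, orbit_sum y -> B x y = 0) -> x = 0.
Proof.
move=> [u [Lu ->]] xperp; rewrite big1 // => i Pi.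
apply: (orbit_span_nondegenerate Pi (Lu _ Pi)) => y Ly.
by rewrite -(form_orbit_sum Lu) // xperp //; apply: orbit_span_sum Ly.
Qed.

(** In coordinates on a finite spanning family with Gram matrix [Gr], let the
    rows of [S] span the preimage of the orbit sum. The component of [c] in it
    is a solution [x] of [x S Gr S^T = c Gr S^T], and this is solvable because
    any column killed by [S Gr S^T] represents a vector of the orbit sum in
    the radical, hence the zero vector. *)
Lemma orbit_sum_complement w : F w ->
  exists2 s, orbit_sum s & forall y, orbit_sum y -> B (w - s) y = 0.
Proof.
move=> Fw; pose v (c : 'rV[K]_k) := \sum_i c 0 i *: e i.
have vL a c d : v (a *: c + d) = a *: v c + v d.
  rewrite /v scaler_sumr -big_split; apply: eq_bigr => i _.
  by rewrite !mxE scalerDl scalerA.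
have v0 : v 0 = 0 by rewrite /v big1 // => i _; rewrite mxE scale0r.
have vF x : F x -> exists c, x = v c.
  move=> /Fspan[c ->]; exists (\row_i c i); apply: eq_bigr => i _.
  by rewrite mxE.
have [S HS] : exists S : 'M[K]_k, forall c, orbit_sum (v c) <-> (c <= S)%MS.
  apply: (subspace_rowspace (U := fun c => orbit_sum (v c))).
    by rewrite v0; case: orbit_sum_submodule => -[].
  by move=> a c d Uc Ud; rewrite vL; case: orbit_sum_submodule => -[_ UD] _; apply: UD.
pose Gr : 'M[K]_k := \matrix_(i, j) B (e i) (e j).
have BE c d : B (v c) (v d) = (c *m Gr *m d^T) 0 0.
  rewrite form_suml -mulmxA mxE; apply: eq_bigr => i _.
  rewrite formZl form_sumr mxE; congr (_ * _); apply: eq_bigr => j _.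
  by rewrite Bsym formZl Bsym !mxE mulrC.
have [c wE] := vF w Fw.
have /submxP[x ex] : (c *m Gr *m S^T <= S *m Gr *m S^T)%MS.
  rewrite submxE; apply/eqP/rowP => j.
  pose z := col j (cokermx (S *m Gr *m S^T)).
  have Nz : S *m Gr *m S^T *m z = 0 by rewrite /z colE mulmxA mulmx_coker mul0mx.
  suff vz : v (z^T *m S) = 0.
    rewrite [RHS]mxE; transitivity ((c *m Gr *m S^T *m z) 0 0).
      by rewrite /z colE mulmxA -colE [RHS]mxE.
    by rewrite -(mulmxA _ S^T) -{1}[z]trmxK -trmx_mul -BE vz Bsym form0l.
  apply: orbit_sum_nondegenerate; first by apply/HS; apply: submxMl.
  move=> y [u [Lu ey]].
  have Fy : F y.
    rewrite ey; apply: subspace_sum; first by case: Fsub.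
    by move=> i Pi; apply: (orbit_span_sub Pi); apply: Lu.
  have [d yd] := vF y Fy.
  have : orbit_sum (v d) by rewrite -yd; exists u.
  move=> /HS/submxP[d' ed]; rewrite yd Bsym BE {}ed.
  rewrite trmx_mul trmxK !mulmxA -!(mulmxA d') Nz mulmx0 mxE //.
have Ux : orbit_sum (v (x *m S)) by apply/HS; apply: submxMl.
exists (v (x *m S)) => // y Sy.
have Fy : F y.
  case: Sy => u [Lu ->]; apply: subspace_sum; first by case: Fsub.
  by move=> i Pi; apply: (orbit_span_sub Pi); apply: Lu.
have [d yd] := vF y Fy.
have /HS/submxP[d' ed] : orbit_sum (v d) by rewrite -yd.
rewrite formDl -scaleN1r formZl mulN1r yd wE !BE; apply/eqP; rewrite subr_eq0; apply/eqP.
congr ((_ : 'M_1) 0 0); rewrite ed trmx_mul !mulmxA ex.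
by rewrite !mulmxA.
Qed.

(** If the sum were smaller, its orthogonal complement in [F] would be a nonzero submodule
    and contain some [p_ i], which lies in the sum and is not isotropic. *)
Theorem orbit_sum_full x : F x <-> orbit_sum x.
Proof.
split=> [Fx|[u [Lu ->]]]; last first.
  apply: subspace_sum; first by case: Fsub.
  by move=> i Pi; apply: (orbit_span_sub Pi); apply: Lu.
have [s Ss xs] := orbit_sum_complement Fx.
suff -> : x = s by [].
apply/eqP; rewrite -subr_eq0; apply: contraT => nz.
have Fs : F s.
  case: Ss => u [Lu ->]; apply: subspace_sum; first by case: Fsub.
  by move=> i Pi; apply: (orbit_span_sub Pi); apply: Lu.
have Px : perp orbit_sum (x - s) by split=> //; apply: subspaceB => //; case: Fsub.
have PF y : perp orbit_sum y -> F y by case.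
have [i Pi [_ pi]] := submodule_p (perp_submodule orbit_sum_submodule) PF
  (ex_intro2 _ _ _ Px nz).
have := norm_p Pi; rewrite pi ?eqxx //.
by apply: (orbit_span_sum Pi); apply: orbit_span_refl.
Qed.

End ContravariantForm.

(** * Columns of the diagram of a dominant weight *)

Lemma count_initial (p : pred int) (s : seq int) a :
    (forall b c, (b <= c)%N -> (c < size s)%N -> p s`_c -> p s`_b) ->
  (a < size s)%N -> (a < count p s)%N = p s`_a.
Proof.
elim: s a => // x s IH a mono; have mono' b c : (b <= c)%N -> (c < size s)%N -> p s`_c -> p s`_b.
  by move=> bc cs; apply: (mono b.+1 c.+1).
have c0 : ~~ p x -> count p s = 0%N.
  move=> px; apply/eqP; rewrite eqn0Ngt -has_count; apply/hasP => -[y /(nthP 0)[c cs <-] pc].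
  by case/negP: px; apply: (mono 0%N c.+1).
case: a => [_|a /= al] /=; first by case: (boolP (p x)) => [//|/c0 ->].
case: (boolP (p x)) => [_|px]; first by rewrite add1n ltnS IH.
rewrite c0 // ltn0; apply/esym/negbTE; apply: contra px => pa.
exact: (mono 0%N a.+1).
Qed.

Section Columns.

Variable l : seq int.
Hypothesis dom : dominant l.

Lemma dominant_nth a b : (a <= b)%N -> (b < size l)%N -> l`_b <= l`_a.
Proof.
move=> ab bl; have tr : transitive (>=%O : rel int) by move=> y x z /= xy yz; apply: le_trans yz xy.
have := sorted_leq_nth tr (fun x => lexx x) 0 dom.
by apply; rewrite ?inE //; apply: leq_ltn_trans bl.
Qed.

Lemma last_nth_weight : last 0 l = l`_(size l).-1.
Proof. by rewrite nth_last; case: (l). Qed.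

Lemma dominant_last a : (a < size l)%N -> last 0 l <= l`_a.
Proof. by move=> al; rewrite last_nth_weight; apply: dominant_nth; lia. Qed.

Lemma ltn_col_length a q : (a < size l)%N ->
  (a < col_length l q)%N = (q%:Z < l`_a - last 0 l).
Proof.
move=> al; rewrite /col_length count_initial // => b c bc cl h; apply: (lt_le_trans h).
by rewrite lerD2r dominant_nth.
Qed.

Lemma col_length_le q : (col_length l q <= size l)%N.
Proof. exact: count_size. Qed.

(** The [a]-th row length of the diagram. *)
Definition excess a : nat := `|(l`_a - last 0 l)%R|%N.

Lemma excessE a : (a < size l)%N -> (excess a)%:Z = l`_a - last 0 l.
Proof. by move=> al; rewrite gez0_abs // subr_ge0 dominant_last. Qed.

Lemma excess_le a b : (a <= b)%N -> (b < size l)%N -> (excess b <= excess a)%N.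
Proof.
move=> ab bl; rewrite -lez_nat !excessE ?(leq_ltn_trans ab) // lerD2r.
exact: dominant_nth.
Qed.

(** Conjugation of the diagram. *)
Lemma ltn_excess a q : (a < size l)%N -> (a < col_length l q)%N = (q < excess a)%N.
Proof. by move=> al; rewrite ltn_col_length // -excessE // ltz_nat. Qed.

Lemma excess_last : (0 < size l)%N -> excess (size l).-1 = 0%N.
Proof. by move=> l0; rewrite /excess -last_nth_weight subrr. Qed.

(** The columns of length [a.+1] are those numbered between two consecutive row
    lengths. *)
Lemma prod_columns (R : comNzRingType) (F : nat -> R) : (0 < size l)%N ->
  \prod_(q < ncols l) F (col_length l q) =
  \prod_(a < (size l).-1) F a.+1 ^+ (excess a - excess a.+1).
Proof.
move=> l0; have H k : (k < size l)%N ->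
    \prod_(excess k <= q < excess 0) F (col_length l q) =
    \prod_(a < k) F a.+1 ^+ (excess a - excess a.+1).
  elim: k => [_|k IH kl]; first by rewrite big_geq // big_ord0.
  rewrite big_ord_recr /= -IH ?(ltnW kl) //.
  have le1 := excess_le (leqnSn k) kl; have le2 := excess_le (leq0n k) (ltnW kl).
  rewrite (big_cat_nat le1 le2) mulrC /=; congr (_ * _).
  rewrite -prodr_const_nat; apply: eq_big_nat => q /andP[qk qk'].
  congr F; apply/eqP; rewrite eqn_leq ltn_excess ?(ltnW kl) // qk' andbT.
  by rewrite leqNgt ltn_excess // -leqNgt.
rewrite -(big_mkord xpredT (fun q => F (col_length l q))).
by have := H (size l).-1; rewrite excess_last // => -> //; rewrite ltn_predL.
Qed.

End Columns.

(** * Minors on the top rows *)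

Section TopMinors.

(** [top_minor] over an arbitrary ring. *)
Definition minor_on (R : pzRingType) p (A : 'M[R]_p) (s : seq 'I_p) : R :=
  \det (\matrix_(a < size s, b < size s)
          oapp (fun i => A i (tnth (in_tuple s) b)) 0 (insub (val a))).

Lemma map_minor_on (R S : pzRingType) (f : {rmorphism R -> S}) p (A : 'M[R]_p) s :
  minor_on (map_mx f A) s = f (minor_on A s).
Proof.
rewrite /minor_on -det_map_mx; congr (\det _); apply/matrixP => a b; rewrite !mxE.
by case: insubP => [u _ _|_] /=; rewrite ?mxE ?rmorph0.
Qed.

Lemma minor_onE (R : pzRingType) p (A : 'M[R]_p) s k (lekp : (k <= p)%N) (f : 'I_k -> 'I_p) :
    size s = k -> (forall b : 'I_k, nth (f b) s b = f b) ->
  minor_on A s = \det (mxsub (widen_ord lekp) f A).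
Proof.
move=> sz; case: _ / sz in lekp f * => sf; congr (\det _).
apply/matrixP => a b; rewrite !mxE (tnth_nth (f b)) sf.
case: insubP => [u _ ua|] /=; last by rewrite (leq_trans (ltn_ord a)).
by congr (A _ _); apply: val_inj.
Qed.

Variable p : nat.

Lemma size_firsts k : (k <= p)%N -> size (firsts p k) = k.
Proof. by move=> lek; rewrite size_takel // size_enum_ord. Qed.

Lemma nth_firsts k (x : 'I_p) i (ltip : (i < p)%N) : (i < k)%N ->
  nth x (firsts p k) i = Ordinal ltip.
Proof.
by move=> ltik; rewrite nth_take //; apply: val_inj; rewrite /= nth_enum_ord.
Qed.

Lemma minor_on_firsts (R : pzRingType) (A : 'M[R]_p) k (lekp : (k <= p)%N) :
  minor_on A (firsts p k) = \det (mxsub (widen_ord lekp) (widen_ord lekp) A).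
Proof.
apply: minor_onE; first exact: size_firsts.
move=> b; rewrite (nth_firsts _ (ltn_ord (widen_ord lekp b))) /= ?ltn_ord //.
by apply: val_inj.
Qed.

Lemma minor_on_all (R : pzRingType) (A : 'M[R]_p) : minor_on A (firsts p p) = \det A.
Proof.
rewrite (minor_on_firsts _ (leqnn p)); congr (\det _).
by apply/matrixP => i j; rewrite mxE; congr (A _ _); apply: val_inj.
Qed.

Lemma minor_on_nil (R : comPzRingType) (A : 'M[R]_p) : minor_on A [::] = 1.
Proof. by rewrite /minor_on /= det_mx00. Qed.

Lemma rowsub_narrow (R : pzRingType) k (lekp : (k <= p)%N) q (L : 'M[R]_p) (B : 'M[R]_(p, q)) :
    (forall (a b : 'I_p), (a < k <= b)%N -> L a b = 0) ->
  rowsub (widen_ord lekp) (L *m B) =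
  mxsub (widen_ord lekp) (widen_ord lekp) L *m rowsub (widen_ord lekp) B.
Proof.
move=> L0; apply/matrixP => a c; rewrite !mxE (bigID (fun j : 'I_p => j < k)%N) /=.
rewrite [X in _ + X]big1 ?addr0 => [|j]; last first.
  by rewrite -leqNgt => lekj; rewrite L0 ?mul0r //= ltn_ord.
by rewrite (big_ord_narrow lekp); apply: eq_bigr => j _; rewrite !mxE.
Qed.

Lemma colsub_narrow (R : pzRingType) k (lekp : (k <= p)%N) q (U : 'M[R]_p) (B : 'M[R]_(q, p)) :
    (forall (a b : 'I_p), (b < k <= a)%N -> U a b = 0) ->
  colsub (widen_ord lekp) (B *m U) =
  colsub (widen_ord lekp) B *m mxsub (widen_ord lekp) (widen_ord lekp) U.
Proof.
move=> U0; apply/matrixP => c a; rewrite !mxE (bigID (fun j : 'I_p => j < k)%N) /=.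
rewrite [X in _ + X]big1 ?addr0 => [|j]; last first.
  by rewrite -leqNgt => lekj; rewrite U0 ?mulr0 //= ltn_ord.
by rewrite (big_ord_narrow lekp); apply: eq_bigr => j _; rewrite !mxE.
Qed.

Lemma seq_columns (s : seq 'I_p) k : size s = k ->
  exists f : 'I_k -> 'I_p, forall b, nth (f b) s b = f b.
Proof.
move=> sz; exists (tnth (tcast sz (in_tuple s))) => b.
by rewrite tcastE [RHS](tnth_nth (tnth (tcast sz (in_tuple s)) b)) tcastE.
Qed.

(** The first [k] rows of [L *m A] involve only the first [k] rows of [A]. *)
Lemma minor_on_mulL (R : comPzRingType) (L A : 'M[R]_p) s k (lekp : (k <= p)%N) :
    size s = k -> (forall (a b : 'I_p), (a < k <= b)%N -> L a b = 0) ->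
  minor_on (L *m A) s =
    \det (mxsub (widen_ord lekp) (widen_ord lekp) L) * minor_on A s.
Proof.
move=> sz L0; have [f sf] := seq_columns sz.
rewrite !(minor_onE _ lekp sz sf) -det_mulmx; congr (\det _).
rewrite -[mxsub _ f (L *m A)]/(mxsub (widen_ord lekp) (id \o f) (L *m A)).
rewrite mxsub_mul.
have := rowsub_narrow lekp (colsub f A) L0.
move=> e; transitivity (rowsub (widen_ord lekp) (L *m colsub f A)).
  by apply/matrixP => a b; rewrite !mxE; apply: eq_bigr => j _; rewrite !mxE.
by rewrite e; congr (_ *m _); apply/matrixP => a b; rewrite !mxE.
Qed.

Lemma minor_on_firsts_mulR (R : comPzRingType) (U A : 'M[R]_p) k (lekp : (k <= p)%N) :
    (forall (a b : 'I_p), (b < k <= a)%N -> U a b = 0) ->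
  minor_on (A *m U) (firsts p k) =
    minor_on A (firsts p k) * \det (mxsub (widen_ord lekp) (widen_ord lekp) U).
Proof.
move=> U0; rewrite !(minor_on_firsts _ lekp) -det_mulmx; congr (\det _).
have := colsub_narrow lekp (rowsub (widen_ord lekp) A) U0 => e.
transitivity (colsub (widen_ord lekp) (rowsub (widen_ord lekp) A *m U)).
  by apply/matrixP => a b; rewrite !mxE; apply: eq_bigr => j _; rewrite !mxE.
by rewrite e; congr (_ *m _); apply/matrixP => a b; rewrite !mxE.
Qed.

(** Cauchy-Binet, summed over all maps to the columns and not only over the
    increasing ones: repeated columns contribute zero, and no signs occur. *)
Lemma minor_on_mulR (R : comPzRingType) (A U : 'M[R]_p) s (lesp : (size s <= p)%N) :
  minor_on (A *m U) s =
    \sum_(t : {ffun 'I_(size s) -> 'I_p})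
      (\prod_b U (t b) (tnth (in_tuple s) b)) * minor_on A (codom t).
Proof.
have sf b : nth (tnth (in_tuple s) b) s b = tnth (in_tuple s) b.
  by rewrite [RHS](tnth_nth (tnth (in_tuple s) b)).
rewrite (minor_onE _ lesp (erefl _) sf) /determinant.
transitivity (\sum_(w : 'S_(size s)) \sum_(t : {ffun 'I_(size s) -> 'I_p})
   (-1) ^+ w * \prod_b (A (widen_ord lesp (w^-1%g b)) (t b) * U (t b) (tnth (in_tuple s) b))).
  apply: eq_bigr => w _; rewrite -mulr_sumr; congr (_ * _).
  rewrite (reindex_inj (@perm_inj _ w^-1%g)) /= -(bigA_distr_bigA (fun b j =>
    A (widen_ord lesp (w^-1%g b)) j * U j (tnth (in_tuple s) b))).
  by apply: eq_bigr => b _; rewrite !mxE permKV; apply: eq_bigr => j _.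
rewrite exchange_big; apply: eq_bigr => t _.
have st b : nth (t b) (codom t) b = t b.
  by rewrite codomE (nth_map b) ?size_enum_ord // nth_ord_enum.
have szt : size (codom t) = size s by rewrite size_codom card_ord.
rewrite (minor_onE _ lesp szt st) mulr_sumr; apply: eq_bigr => w _.
rewrite big_split /= [RHS]mulrCA; congr (_ * _); rewrite mulrC; congr (_ * _).
rewrite (reindex_inj (@perm_inj _ w)) /=; apply: eq_bigr => b _.
by rewrite permK mxE.
Qed.

End TopMinors.

(** * Minors with one varying column *)

Lemma matrix_ext (T : Type) k l (A B : 'M[T]_(k, l)) : (forall i j, A i j = B i j) -> A = B.
Proof. by move=> e; apply/matrixP. Qed.

Section MinorVectors.

Variables (p : nat).

Definition row_minor (R : pzRingType) (A : 'M[R]_p) (i r : 'I_p) : R :=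
  minor_on A (rcons (firsts p i) r).

(** Up to sign the cofactors of a row added below the first [j] rows. *)
Definition col_minor (R : pzRingType) (A : 'M[R]_p) (j s : 'I_p) : R :=
  if (s <= j)%N then (-1) ^+ (s + j) * minor_on A (rem s (firsts p j.+1)) else 0.

Lemma size_rcons_firsts (i r : 'I_p) : size (rcons (firsts p i) r) = i.+1.
Proof. by rewrite size_rcons size_firsts // ltnW. Qed.

Lemma rem_firsts_size (j s : 'I_p) : (s <= j)%N -> size (rem s (firsts p j.+1)) = j.
Proof.
move=> sj; rewrite size_rem ?size_firsts //.
apply/(nthP s); exists s; rewrite ?size_firsts ?ltnS //.
by rewrite (nth_firsts _ (ltn_ord s)) ?ltnS //; apply: val_inj.
Qed.

Lemma firsts_uniq k : uniq (firsts p k).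
Proof. by rewrite take_uniq // enum_uniq. Qed.

Lemma index_firsts k (s : 'I_p) : (s < k)%N -> (k <= p)%N -> index s (firsts p k) = s.
Proof.
move=> sk kp; have e : nth s (firsts p k) s = s.
  by rewrite (nth_firsts _ (ltn_ord s)) //; apply: val_inj.
by rewrite -{1}e index_uniq ?firsts_uniq // size_firsts.
Qed.

Lemma nth_rem_firsts (j s : 'I_p) (x : 'I_p) b : (s <= j)%N -> (b < j)%N ->
  val (nth x (rem s (firsts p j.+1)) b) = bump s b.
Proof.
move=> sj bj; rewrite remE index_firsts ?ltnS // nth_cat size_takel; last first.
  by rewrite size_firsts // ltnW // ltnS.
have jp := ltn_ord j; rewrite /bump; case: (ltnP b s) => bs /=.
  by rewrite nth_take // (nth_firsts _ (ltn_trans bj jp)) // ltnW // ltnS.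
rewrite nth_drop add1n addSn subnKC //.
by rewrite (nth_firsts _ (leq_ltn_trans bj jp)).
Qed.

(** Expansion along the last column, in which only [r] varies. *)
Lemma row_minorE (R : comPzRingType) (A : 'M[R]_p) (i r : 'I_p) :
  row_minor A i r =
    \sum_(a < i.+1) A (widen_ord (ltn_ord i) a) r *
      ((-1) ^+ (a + i) * \det (mxsub (fun b => widen_ord (ltn_ord i) (lift a b))
                                (widen_ord (ltnW (ltn_ord i))) A)).
Proof.
pose f (b : 'I_i.+1) := if (b < i)%N then widen_ord (ltn_ord i) b else r.
rewrite /row_minor (minor_onE _ (ltn_ord i) (f := f)) ?size_rcons_firsts //; last first.
  move=> b; rewrite nth_rcons size_firsts ?(ltnW (ltn_ord i)) // /f; case: ltnP => bi.
    rewrite (nth_firsts _ (ltn_ord (widen_ord (ltn_ord i) b))) //.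
    by apply: val_inj.
  by rewrite ifT // eqn_leq bi andbT -ltnS.
rewrite (expand_det_col _ ord_max); apply: eq_bigr => a _.
have fmax : f ord_max = r by rewrite /f ltnn.
rewrite mxE fmax; congr (_ * _); rewrite /cofactor; congr (_ * \det _).
apply/matrixP => x y; rewrite !mxE /f; congr (A _ _).
have -> : (lift ord_max y < i)%N by rewrite lift_max.
by apply: val_inj; apply: (lift_max y).
Qed.

(** The cofactors of the last column involve the first [i] columns only, on which
    a triangular [U] acts by a scalar; hence, as a row vector in [r], the minor is
    multiplied by [U] and that scalar. *)
Lemma row_minor_mulR (R : comPzRingType) (A U : 'M[R]_p) (i r : 'I_p) :
    (forall a b : 'I_p, (b < a)%N -> U a b = 0) ->
  row_minor (A *m U) i r = minor_on U (firsts p i) * \sum_k row_minor A i k * U k r.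
Proof.
move=> U0; pose lei := ltnW (ltn_ord i).
pose c (a : 'I_i.+1) := (-1) ^+ (a + i) * \det (mxsub (fun b => widen_ord (ltn_ord i) (lift a b))
                                (widen_ord lei) A).
transitivity (\sum_(a < i.+1) (A *m U) (widen_ord (ltn_ord i) a) r * (c a * minor_on U (firsts p i))).
  rewrite row_minorE; apply: eq_bigr => a _; congr (_ * _); rewrite -mulrA; congr (_ * _).
  rewrite (minor_on_firsts _ lei) -det_mulmx; congr (\det _).
  have U0' (x y : 'I_p) : (y < i <= x)%N -> U x y = 0.
    by move=> /andP[yi ix]; apply: U0; apply: leq_trans ix.
  have := colsub_narrow lei (rowsub (fun b => widen_ord (ltn_ord i) (lift a b)) A) U0' => e.
  transitivity (colsub (widen_ord lei) (rowsub (fun b => widen_ord (ltn_ord i) (lift a b)) A *m U)).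
    apply/matrixP => x y; rewrite !mxE; apply: eq_bigr => z _. by rewrite !mxE.
  by rewrite e; congr (_ *m _); apply/matrixP => x y; rewrite !mxE.
transitivity (\sum_(a < i.+1) \sum_k A (widen_ord (ltn_ord i) a) k * U k r * (c a * minor_on U (firsts p i))).
  by apply: eq_bigr => a _; rewrite mxE mulr_suml.
rewrite exchange_big mulr_sumr; apply: eq_bigr => k _ /=.
rewrite row_minorE [X in _ = _ * X]mulr_suml mulr_sumr; apply: eq_bigr => a _.
rewrite [RHS]mulrC -![in RHS]mulrA -mulrA; congr (_ * _).
by rewrite mulrCA /c -!mulrA.
Qed.

(** Expansion along the last row. *)
Lemma col_minor_det (R : comPzRingType) (A : 'M[R]_p) (j : 'I_p) (y : 'I_p -> R) :
  \sum_s y s * col_minor A j s =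
  \det (\matrix_(a < j.+1, b < j.+1)
     if (a < j)%N then A (widen_ord (ltn_ord j) a) (widen_ord (ltn_ord j) b)
     else y (widen_ord (ltn_ord j) b)).
Proof.
rewrite (expand_det_row _ ord_max) (bigID (fun s : 'I_p => s < j.+1)%N) /=.
rewrite [X in _ + X]big1 ?addr0 => [|s]; last by rewrite /col_minor ltnS => /negPf ->; rewrite mulr0.
rewrite (big_ord_narrow (ltn_ord j)); apply: eq_bigr => s _.
rewrite mxE ltnn; congr (_ * _).
have sj : (s <= j)%N by rewrite -ltnS.
rewrite /col_minor sj /cofactor addnC; congr (_ * _).
rewrite (minor_onE _ (ltnW (ltn_ord j)) (f := fun b => widen_ord (ltn_ord j) (lift s b))) ?rem_firsts_size //.
  congr (\det _); apply/matrixP => a b; rewrite !mxE lift_max ltn_ord.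
  by congr (A _ _); apply: val_inj; apply/esym/(lift_max a).
by move=> b; apply: val_inj; rewrite nth_rem_firsts.
Qed.

(** Both sides are determinants with the [t]-th row of [U], respectively of the
    identity, as the last row: multiplying the second matrix by the corner of
    [U] gives the first. *)
Lemma col_minor_mulR (R : comPzRingType) (A U : 'M[R]_p) (j t : 'I_p) :
    (forall a b : 'I_p, (b < a)%N -> U a b = 0) ->
  \sum_s U t s * col_minor (A *m U) j s = minor_on U (firsts p j.+1) * col_minor A j t.
Proof.
move=> U0; have [tj|jt] := leqP t j; last first.
  rewrite {2}/col_minor leqNgt jt mulr0 big1 // => s _.
  rewrite /col_minor; case: leqP => [sj|_]; last by rewrite mulr0.
  by rewrite U0 ?mul0r // (leq_ltn_trans sj).
have -> : col_minor A j t = \sum_s (t == s)%:R * col_minor A j s.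
  rewrite (bigD1 t) //= eqxx mul1r big1 ?addr0 // => s /negPf st.
  by rewrite eq_sym st mul0r.
rewrite !col_minor_det (minor_on_firsts _ (ltn_ord j)) mulrC -det_mulmx; congr (\det _).
apply/matrixP => a b; rewrite !mxE.
have narrow (F : 'I_p -> R) : \sum_k F k * U k (widen_ord (ltn_ord j) b) =
    \sum_(k < j.+1) F (widen_ord (ltn_ord j) k) * U (widen_ord (ltn_ord j) k) (widen_ord (ltn_ord j) b).
  rewrite (bigID (fun s : 'I_p => s < j.+1)%N) /= [X in _ + X]big1 ?addr0 => [|k].
    by rewrite (big_ord_narrow (ltn_ord j)).
  by rewrite -leqNgt => jk; rewrite U0 ?mulr0 //= (leq_trans _ jk).
case: ltnP => aj.
  by rewrite narrow; apply: eq_bigr => k _; rewrite !mxE aj.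
transitivity (\sum_k (t == k)%:R * U k (widen_ord (ltn_ord j) b)).
  rewrite (bigD1 t) //= eqxx mul1r big1 ?addr0 // => s /negPf st.
  by rewrite eq_sym st mul0r.
by rewrite narrow; apply: eq_bigr => k _; rewrite !mxE ltnNge aj.
Qed.

Lemma minor_on_firsts1 (R : comPzRingType) k : (k <= p)%N -> minor_on (1%:M : 'M[R]_p) (firsts p k) = 1.
Proof.
move=> lek; rewrite (minor_on_firsts _ lek).
have -> : mxsub (widen_ord lek) (widen_ord lek) 1%:M = 1%:M :> 'M[R]_k.
  by apply: matrix_ext => a b; rewrite !mxE.
exact: det1.
Qed.

Lemma row_minor1 (R : comPzRingType) (i r : 'I_p) : row_minor (1%:M : 'M[R]_p) i r = (r == i)%:R.
Proof.
rewrite row_minorE (bigD1 ord_max) //= big1 ?addr0 => [|a na]; last first.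
  have ai : (a < i)%N by move: na; rewrite -val_eqE /= ltn_neqAle -ltnS ltn_ord andbT.
  rewrite (expand_det_col _ (Ordinal ai)) big1 ?mulr0 // => b _; rewrite mxE mxE.
  rewrite -val_eqE /= [bump _ _ == _]eq_sym (negPf (neq_bump _ _)) mul0r //.
have -> : mxsub (fun b => widen_ord (ltn_ord i) (lift ord_max b))
    (widen_ord (ltnW (ltn_ord i))) 1%:M = 1%:M :> 'M[R]_i.
  apply: matrix_ext => a b; rewrite !mxE -!val_eqE; congr (_ == _)%:R; apply: (lift_max a).
rewrite det1 mxE mulr1 -signr_odd addnn odd_double mulr1 eq_sym.
by rewrite -!val_eqE.
Qed.

Lemma col_minor1 (R : comPzRingType) (j s : 'I_p) : col_minor (1%:M : 'M[R]_p) j s = (s == j)%:R.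
Proof.
transitivity (\sum_t (s == t)%:R * col_minor (1%:M : 'M[R]_p) j t).
  rewrite (bigD1 s) //= eqxx mul1r big1 ?addr0 // => t /negPf ts.
  by rewrite eq_sym ts mul0r.
rewrite col_minor_det; set M := \matrix_(_, _) _.
have [sj|sj] := eqVneq s j.
  have -> : M = 1%:M; last by rewrite det1.
  apply: matrix_ext => a b; rewrite !mxE sj -!val_eqE /=.
  by case: ltnP => // ja; have /eqP -> : (a : nat) == j by rewrite eqn_leq ja -ltnS ltn_ord.
have [js|js] := ltnP j s.
  rewrite (expand_det_row _ ord_max) big1 // => b _; rewrite mxE ltnn -val_eqE /=.
  by rewrite gtn_eqF ?mul0r // (leq_ltn_trans _ js) // -ltnS.
have sj' : (s < j)%N by rewrite ltn_neqAle js andbT (inj_eq val_inj).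
transitivity (0 : R) => //.
apply: (@determinant_alternate _ _ _ (Ordinal (leqW sj')) ord_max).
  by rewrite -val_eqE /= ltn_eqF.
by move=> b; rewrite !mxE sj' ltnn -!val_eqE.
Qed.

End MinorVectors.

(** * Polynomials in the entries of two generic matrices *)

Section GenericMatrices.

Variables (K : fieldType) (m n : nat).

Local Notation P := (Defs.even_poly K m n).

Definition gen1 : 'M[P]_m := \matrix_(i, j) even_var K (inl (i, j)).
Definition gen2 : 'M[P]_n := \matrix_(i, j) even_var K (inr (i, j)).

Definition pair_entry (S : Type) (A : 'M[S]_m) (B : 'M[S]_n) (e : even_index m n) : S :=
  match e with inl p => A p.1 p.2 | inr p => B p.1 p.2 end.

Definition pair_subst (S : nzRingType) (f : K -> S) (A : 'M[S]_m) (B : 'M[S]_n) : P -> S :=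
  mmap f (fun i => pair_entry A B (enum_val i)).

Section Morphism.

Variables (S : nzRingType) (f : {rmorphism K -> S}) (A : 'M[S]_m) (B : 'M[S]_n).

Lemma pair_subst_is_zmod_morphism : zmod_morphism (pair_subst f A B).
Proof. exact: mmap_is_additive. Qed.
HB.instance Definition _ :=
  GRing.isZmodMorphism.Build P S (pair_subst f A B) pair_subst_is_zmod_morphism.

Lemma pair_substC c : pair_subst f A B c%:MP = f c.
Proof. exact: mmapC. Qed.

Lemma pair_substX e : pair_subst f A B (even_var K e) = pair_entry A B e.
Proof. by rewrite /pair_subst /even_var mmapX mmap1U enum_rankK. Qed.

Lemma pair_subst1 : map_mx (pair_subst f A B) gen1 = A.
Proof. by apply/matrixP => i j; rewrite !mxE pair_substX. Qed.

Lemma pair_subst2 : map_mx (pair_subst f A B) gen2 = B.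
Proof. by apply/matrixP => i j; rewrite !mxE pair_substX. Qed.

Lemma pair_subst_central_monoid_morphism :
    (forall c y, f c * y = y * f c) -> (forall e y, pair_entry A B e * y = y * pair_entry A B e) ->
  monoid_morphism (pair_subst f A B).
Proof.
move=> fC eC.
have [mM m1] : GRing.multiplicative (pair_subst f A B).
  by apply: commr_mmap_is_multiplicative => [i x|p u v]; [exact/esym/eC|exact: fC].
by split.
Qed.

Lemma pair_subst_central :
    (forall c y, f c * y = y * f c) -> (forall e y, pair_entry A B e * y = y * pair_entry A B e) ->
  forall p y, pair_subst f A B p * y = y * pair_subst f A B p.
Proof.
move=> fC eC p y; rewrite /pair_subst /mmap mulr_suml mulr_sumr.
apply: eq_bigr => u _; rewrite [RHS]mulrA -fC -!mulrA; congr (_ * _).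
by apply/esym/commr_prod => i _; apply: commrX; apply/esym; apply: eC.
Qed.

End Morphism.

Section CommutativeMorphism.

Variables (S : comNzRingType) (f : {rmorphism K -> S}) (A : 'M[S]_m) (B : 'M[S]_n).

Lemma pair_subst_is_monoid_morphism : monoid_morphism (pair_subst f A B).
Proof. by apply: pair_subst_central_monoid_morphism => *; rewrite mulrC. Qed.

End CommutativeMorphism.

Lemma pair_substE (S : nzRingType) (f : {rmorphism K -> S}) A B (h : {rmorphism P -> S}) :
    (forall c : K, h c%:MP = f c) -> map_mx h gen1 = A -> map_mx h gen2 = B ->
  h =1 pair_subst f A B.
Proof.
move=> eC /matrixP e1 /matrixP e2.
have eX e : h (even_var K e) = pair_entry A B e.
  case: e => -[i j]; first by have := e1 i j; rewrite !mxE.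
  by have := e2 i j; rewrite !mxE.
apply: mpolyind => [|c u p _ _ IH]; first by rewrite !raddf0.
rewrite [LHS]rmorphD IH [RHS]raddfD; congr (_ + _).
rewrite [RHS]mmapZ mmapX /mmap1 -mul_mpolyC rmorphM eC.
congr (_ * _); rewrite mpolyXE_id rmorph_prod; apply: eq_bigr => i _.
by rewrite rmorphXn; congr (_ ^+ _); rewrite -eX /even_var enum_valK.
Qed.

Lemma pair_subst_unique (S : nzRingType) (h k : {rmorphism P -> S}) :
    (forall c : K, h c%:MP = k c%:MP) ->
    map_mx h gen1 = map_mx k gen1 -> map_mx h gen2 = map_mx k gen2 -> h =1 k.
Proof.
move=> eC e1 e2 p; pose f : {rmorphism K -> S} := k \o (@mpolyC _ K).
by rewrite (pair_substE (f := f) eC e1 e2) -(pair_substE (f := f) (h := k)).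
Qed.

End GenericMatrices.

(** Right translation of functions on pairs of matrices. *)
HB.lock Definition translate (K : fieldType) (m n : nat) (g1 : 'M[K]_m) (g2 : 'M[K]_n) :
    Defs.even_poly K m n -> Defs.even_poly K m n :=
  pair_subst (@mpolyC _ K) (gen1 K m n *m map_mx (@mpolyC _ K) g1)
                           (gen2 K m n *m map_mx (@mpolyC _ K) g2).

HB.lock Definition point_eval (K : fieldType) (m n : nat) (x1 : 'M[K]_m) (x2 : 'M[K]_n) :
    Defs.even_poly K m n -> K :=
  pair_subst idfun x1 x2.

Section Translations.

Variables (K : fieldType) (m n : nat).

Local Notation P := (Defs.even_poly K m n).
Local Notation gen1 := (gen1 K m n).
Local Notation gen2 := (gen2 K m n).
Local Notation translate := (@translate K m n).
Local Notation point_eval := (@point_eval K m n).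

Lemma translate_is_zmod_morphism g1 g2 : zmod_morphism (translate g1 g2).
Proof. by rewrite translate.unlock; exact: pair_subst_is_zmod_morphism. Qed.
Lemma translate_is_monoid_morphism g1 g2 : monoid_morphism (translate g1 g2).
Proof. by rewrite translate.unlock; exact: pair_subst_is_monoid_morphism. Qed.
HB.instance Definition _ g1 g2 :=
  GRing.isZmodMorphism.Build P P (translate g1 g2) (translate_is_zmod_morphism g1 g2).
HB.instance Definition _ g1 g2 :=
  GRing.isMonoidMorphism.Build P P (translate g1 g2) (translate_is_monoid_morphism g1 g2).

Lemma point_eval_is_zmod_morphism x1 x2 : zmod_morphism (point_eval x1 x2).
Proof. by rewrite point_eval.unlock; exact: pair_subst_is_zmod_morphism. Qed.
Lemma point_eval_is_monoid_morphism x1 x2 : monoid_morphism (point_eval x1 x2).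
Proof. by rewrite point_eval.unlock; exact: pair_subst_is_monoid_morphism. Qed.
HB.instance Definition _ x1 x2 :=
  GRing.isZmodMorphism.Build P K (point_eval x1 x2) (point_eval_is_zmod_morphism x1 x2).
HB.instance Definition _ x1 x2 :=
  GRing.isMonoidMorphism.Build P K (point_eval x1 x2) (point_eval_is_monoid_morphism x1 x2).

Lemma translateC g1 g2 c : translate g1 g2 c%:MP = c%:MP.
Proof. by rewrite translate.unlock; exact: pair_substC. Qed.

Lemma translate1 g1 g2 : map_mx (translate g1 g2) gen1 = gen1 *m map_mx (@mpolyC _ K) g1.
Proof. by rewrite translate.unlock; exact: pair_subst1. Qed.

Lemma translate2 g1 g2 : map_mx (translate g1 g2) gen2 = gen2 *m map_mx (@mpolyC _ K) g2.
Proof. by rewrite translate.unlock; exact: pair_subst2. Qed.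

Lemma translateZ g1 g2 c p : translate g1 g2 (c *: p) = c *: translate g1 g2 p.
Proof. by rewrite -!mul_mpolyC rmorphM /= translateC. Qed.

Lemma map_translate_const g1 g2 k l (M : 'M[K]_(k, l)) :
  map_mx (translate g1 g2) (map_mx (@mpolyC _ K) M) = map_mx (@mpolyC _ K) M.
Proof. by apply/matrixP => i j; rewrite !mxE translateC. Qed.

Lemma translateM g1 g2 h1 h2 p :
  translate g1 g2 (translate h1 h2 p) = translate (g1 *m h1) (g2 *m h2) p.
Proof.
pose h : {rmorphism P -> P} := translate g1 g2 \o translate h1 h2.
apply: (pair_subst_unique (h := h) (k := translate (g1 *m h1) (g2 *m h2))) => [c||].
- by rewrite /= !translateC.
- transitivity (map_mx (translate g1 g2) (map_mx (translate h1 h2) gen1)).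
    by apply/matrixP => i j; rewrite [LHS]mxE [RHS]mxE [X in _ = _ X]mxE.
  rewrite (translate1 h1 h2) [LHS]map_mxM (translate1 g1 g2) map_translate_const.
  by rewrite [RHS]translate1 map_mxM mulmxA.
- transitivity (map_mx (translate g1 g2) (map_mx (translate h1 h2) gen2)).
    by apply/matrixP => i j; rewrite [LHS]mxE [RHS]mxE [X in _ = _ X]mxE.
  rewrite (translate2 h1 h2) [LHS]map_mxM (translate2 g1 g2) map_translate_const.
  by rewrite [RHS]translate2 map_mxM mulmxA.
Qed.

Lemma translate_id p : translate 1%:M 1%:M p = p.
Proof.
apply: (pair_subst_unique (h := translate 1%:M 1%:M) (k := idfun)) => [c||] /=.
- by rewrite translateC.
- by rewrite translate1 map_mx1 mulmx1; apply/matrixP => i j; rewrite !mxE.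
- by rewrite translate2 map_mx1 mulmx1; apply/matrixP => i j; rewrite !mxE.
Qed.

Lemma point_evalC x1 x2 c : point_eval x1 x2 c%:MP = c.
Proof. by rewrite point_eval.unlock; exact: pair_substC. Qed.

Lemma point_eval1 x1 x2 : map_mx (point_eval x1 x2) gen1 = x1.
Proof. by rewrite point_eval.unlock; exact: pair_subst1. Qed.

Lemma point_eval2 x1 x2 : map_mx (point_eval x1 x2) gen2 = x2.
Proof. by rewrite point_eval.unlock; exact: pair_subst2. Qed.

Lemma point_evalZ x1 x2 c p : point_eval x1 x2 (c *: p) = c * point_eval x1 x2 p.
Proof. by rewrite -!mul_mpolyC rmorphM /= point_evalC. Qed.

Lemma map_point_eval_const x1 x2 k l (M : 'M[K]_(k, l)) :
  map_mx (point_eval x1 x2) (map_mx (@mpolyC _ K) M) = M.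
Proof. by apply/matrixP => i j; rewrite !mxE point_evalC. Qed.

Lemma point_eval_translate x1 x2 g1 g2 p :
  point_eval x1 x2 (translate g1 g2 p) = point_eval (x1 *m g1) (x2 *m g2) p.
Proof.
pose h : {rmorphism P -> K} := point_eval x1 x2 \o translate g1 g2.
apply: (pair_subst_unique (h := h) (k := point_eval (x1 *m g1) (x2 *m g2))) => [c||].
- by rewrite /= translateC !point_evalC.
- transitivity (map_mx (point_eval x1 x2) (map_mx (translate g1 g2) gen1)).
    by apply/matrixP => i j; rewrite [LHS]mxE [RHS]mxE [X in _ = _ X]mxE.
  by rewrite (translate1 g1 g2) map_mxM (point_eval1 x1 x2) map_point_eval_const [RHS]point_eval1.
- transitivity (map_mx (point_eval x1 x2) (map_mx (translate g1 g2) gen2)).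
    by apply/matrixP => i j; rewrite [LHS]mxE [RHS]mxE [X in _ = _ X]mxE.
  by rewrite (translate2 g1 g2) map_mxM (point_eval2 x1 x2) map_point_eval_const [RHS]point_eval2.
Qed.

End Translations.

(** * Polynomials vanishing on the big cell *)

Section LU.

Definition upper_unitri (R : pzSemiRingType) n (U : 'M[R]_n) : Prop :=
  is_trig_mx U^T /\ forall i, U i i = 1.

(** A polynomial whose nonvanishing lets one eliminate below the diagonal
    without exchanging rows: the corner entry times the same polynomial of the
    Schur complement, cleared of its denominator. *)
Fixpoint elimination_poly (R : pzRingType) n : 'M[R]_n -> R :=
  match n return 'M[R]_n -> R with
  | 0%N => fun=> 1
  | k.+1 => fun A : 'M[R]_(1 + k) =>
      let a := A 0 0 in a * elimination_poly (a *: drsubmx A - dlsubmx A *m ursubmx A)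
  end.

Lemma map_elimination_poly (R S : pzRingType) (f : {rmorphism R -> S}) n (A : 'M[R]_n) :
  elimination_poly (map_mx f A) = f (elimination_poly A).
Proof.
elim: n A => [|n IH] A /=; first by rewrite rmorph1.
rewrite mxE rmorphM -IH map_mxB map_mxM map_mxZ.
by rewrite map_drsubmx map_dlsubmx map_ursubmx.
Qed.

Lemma elimination_poly1 (R : pzRingType) n : elimination_poly (1%:M : 'M[R]_n) = 1.
Proof.
elim: n => [|n IH] //=; rewrite mxE eqxx mul1r scale1r -[RHS]IH; congr elimination_poly.
have -> : 1%:M = block_mx 1 0 0 1%:M :> 'M[R]_(1 + n) by rewrite -scalar_mx_block.
by rewrite block_mxKdr block_mxKdl block_mxKur mul0mx subr0.
Qed.

Lemma elimination_LU (K : fieldType) n (A : 'M[K]_n) : elimination_poly A != 0 ->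
  exists L U, [/\ is_trig_mx L, L \in unitmx, upper_unitri U & A = L *m U].
Proof.
elim: n A => [|n IH] A /=.
  move=> _; exists 1%:M, 1%:M; split.
  - by apply/is_trig_mxP => -[].
  - exact: unitmx1.
  - by split=> [|[]//]; apply/is_trig_mxP => -[].
  - by apply/matrixP => -[].
rewrite mulf_eq0 negb_or => /andP[a0 /IH[L [U [tL uL [tU dU] e]]]].
set a := A 0 0 in a0 e.
pose B : 'M[K]_(1 + n) := A.
pose L1 : 'M[K]_(1 + n) := block_mx a%:M 0 (dlsubmx B) (a^-1 *: L).
pose U1 : 'M[K]_(1 + n) := block_mx 1%:M (a^-1 *: ursubmx B) 0 U.
have aE : ulsubmx B = a%:M.
  by rewrite [LHS]mx11_scalar !mxE; congr (A _ _)%:M; apply: val_inj.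
have tL1 : is_trig_mx L1.
  rewrite is_trig_block_mx // eqxx /=; apply/andP; split.
    by apply/is_trig_mxP => i j; rewrite !ord1.
  by apply/is_trig_mxP => i j ij; rewrite mxE (is_trig_mxP tL) ?mulr0.
have uL1 : L1 \in unitmx.
  rewrite unitmxE det_lblock unitrM det_scalar1 unitfE a0 /= detZ unitrM.
  by rewrite unitrX ?unitfE ?invr_neq0 //= -unitfE -unitmxE.
have tU1 : upper_unitri U1.
  split.
    rewrite tr_block_mx trmx0 is_trig_block_mx // eqxx tU andbT /=.
    by apply/is_trig_mxP => i j; rewrite !ord1.
  move=> i; rewrite /U1; case: (split_ordP i) => k ->.
    by rewrite block_mxEul mxE ord1 eqxx.
  by rewrite block_mxEdr.
have e1 : B = L1 *m U1.
  rewrite /L1 /U1 mulmx_block !mulmx0 !mul0mx !addr0 mulmx1 -{1}[B]submxK.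
  congr block_mx.
  - by rewrite aE.
  - by rewrite mul_scalar_mx scalerA divff // scale1r.
  - by rewrite mulmx1.
  - rewrite -scalemxAl -e -scalemxAr scalerBr scalerA mulVf // scale1r.
    by rewrite addrC subrK.
by exists L1, U1.
Qed.

End LU.

Section Vanishing.

Lemma mpoly_var_ind (R : comNzRingType) k (Q : {mpoly R[k]} -> Prop) :
    (forall c, Q c%:MP) -> (forall p q, Q p -> Q q -> Q (p + q)) ->
    (forall i p, Q p -> Q ('X_i * p)) ->
  forall p, Q p.
Proof.
move=> QC QD QX; have QXn i j p : Q p -> Q ('X_i ^+ j * p).
  by move=> Qp; elim: j => [|j IH]; rewrite ?mul1r // exprS -mulrA; apply: QX.
apply: mpolyind => [|c u p _ _ Qp]; first by rewrite -mpolyC0.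
apply: QD => //; rewrite -mul_mpolyC mulrC mpolyXE_id.
elim/big_rec: _ => [|i q _ Qq]; first by rewrite mul1r.
by rewrite -mulrA; apply: QXn.
Qed.

Variables (K : fieldType) (k : nat).
Hypothesis char0 : [pchar K] =i pred0.

Lemma natr_neq0 a : (a.+1%:R : K) != 0.
Proof. by have /pcharf0P -> := char0. Qed.

Lemma natr_inj : injective (fun a : nat => (a%:R : K)).
Proof.
move=> a b; wlog ab : a b / (a <= b)%N => [hw|e].
  by case: (leqP a b) => [/hw //|/ltnW ba /esym /(hw _ _ ba)].
apply/eqP; rewrite eqn_leq ab /= -subn_eq0.
have : ((b - a)%:R : K) = 0 by rewrite natrB // e subrr.
by case: (b - a)%N => // c /eqP; rewrite (negPf (natr_neq0 c)).
Qed.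

(** The field is infinite. *)
Lemma horner_eq0 (q : {poly K}) : (forall t, q.[t] = 0) -> q = 0.
Proof.
move=> q0; apply/eqP; apply: contraT => nz.
have := max_poly_roots nz (rs := [seq (a%:R : K) | a <- iota 0 (size q)]).
rewrite size_map size_iota ltnn; case/(_ _ _)/notF.
  by apply/allP => x _; rewrite /root q0.
by rewrite (map_inj_uniq natr_inj) iota_uniq.
Qed.

(** Restriction to a line parallel to a coordinate axis. *)
Definition line_poly (v : 'I_k -> K) (i : 'I_k) : {mpoly K[k]} -> {poly K} :=
  mmap (@polyC K) (fun j => (v j)%:P + (j == i)%:R *: 'X).

Lemma line_polyE v i p t : (line_poly v i p).[t] = p.@[fun j => v j + (j == i)%:R * t].
Proof.
rewrite /line_poly; elim/mpoly_var_ind: p => [c|p q IHp IHq|j p IH].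
- by rewrite mmapC hornerC mevalC.
- by rewrite !rmorphD hornerD IHp IHq.
- by rewrite mevalM mevalXU rmorphM /= hornerM IH mmapX mmap1U hornerD hornerC hornerZ hornerX.
Qed.

Lemma line_poly_deriv v i p : (line_poly v i p)^`() = line_poly v i (p^`M(i)).
Proof.
rewrite /line_poly; elim/mpoly_var_ind: p => [c|p q IHp IHq|j p IH].
- by rewrite mmapC derivC mderivC rmorph0.
- by rewrite mderivD !rmorphD derivD IHp IHq.
- rewrite mderivM !rmorphD !rmorphM derivM IH /= mmapX mmap1U; congr (_ * _ + _).
  rewrite derivD derivC add0r derivZ derivX mderivX mnm1E.
  case: eqVneq => [->|_]; last by rewrite !scale0r rmorph0.
  by rewrite -{1}[U_(i)%MM]add0m addmK mpolyX0 !scale1r rmorph1.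
Qed.

(** The derivatives of [p] vanish on every line, hence everywhere, so they are
    zero by induction on the degree; in characteristic zero [p] is then a
    constant. *)
Lemma mpoly_vanishing (p : {mpoly K[k]}) : (forall v, p.@[v] = 0) -> p = 0.
Proof.
have [d] : exists d, forall u : 'X_{1..k}, p@_u != 0 -> (mdeg u < d)%N.
  by exists (msize p) => u; rewrite -mcoeff_msupp => /msize_mdeg_lt.
elim: d p => [|d IH] p dp p0.
  by apply/mpolyP => u; rewrite mcoeff0; apply/eqP; apply: contraT => /dp.
have dp0 i : p^`M(i) = 0.
  apply: IH => [u|v].
    rewrite mcoeff_mderiv => nz; have := dp (u + U_(i))%MM.
    rewrite mdegD mdeg1 addn1 ltnS; apply; apply: contraNneq nz => ->.
    by rewrite mul0rn.
  have z : line_poly v i p = 0 by apply: horner_eq0 => t; rewrite line_polyE p0.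
  have := congr1 (fun q : {poly K} => q^`().[0]) z.
  rewrite line_poly_deriv line_polyE linear0 horner0 => <-.
  by apply: meval_eq => j; rewrite mulr0 addr0.
have pC : p = (p@_0)%:MP.
  apply/mpolyP => u; rewrite mcoeffC; have [->|u0] := eqVneq u 0%MM; first by rewrite mulr1.
  rewrite mulr0; have [i ui] : exists i, u i != 0%N.
    apply/existsP; apply: contraNT u0 => /existsPn h; apply/eqP/mnmP => i.
    by have := h i; rewrite negbK mnmE => /eqP.
  have := mcoeff_mderiv i p (u - U_(i))%MM; rewrite dp0 mcoeff0 submK ?lep1mP //.
  by move/esym/eqP; rewrite -mulr_natr mulf_eq0 (negPf (natr_neq0 _)) orbF => /eqP.
by have := p0 (fun=> 0); rewrite {1}pC mevalC => e; rewrite pC e mpolyC0.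
Qed.

End Vanishing.

Section Density.

Variables (K : fieldType) (m n : nat).
Hypothesis char0 : [pchar K] =i pred0.
Local Notation P := (Defs.even_poly K m n).

Lemma point_eval_vanishing (p : P) : (forall x1 x2, point_eval x1 x2 p = 0) -> p = 0.
Proof.
move=> p0; apply: (mpoly_vanishing char0) => v.
pose x1 : 'M[K]_m := \matrix_(i, j) v (enum_rank (inl (i, j) : even_index m n)).
pose x2 : 'M[K]_n := \matrix_(i, j) v (enum_rank (inr (i, j) : even_index m n)).
rewrite -[RHS](p0 x1 x2) point_eval.unlock.
apply: (pair_substE (f := idfun) (h := meval v)) => [c||].
- exact: mevalC.
- by apply/matrixP => i j; rewrite !mxE; apply: mevalXU.
- by apply/matrixP => i j; rewrite !mxE; apply: mevalXU.
Qed.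

(** Multiplied by the elimination polynomials, [p] vanishes everywhere, and these
    polynomials are nonzero since they equal 1 at the identity. *)
Lemma big_cell_vanishing (p : P) :
  (forall L1 U1 L2 U2, is_trig_mx L1 -> L1 \in unitmx -> upper_unitri U1 ->
     is_trig_mx L2 -> L2 \in unitmx -> upper_unitri U2 ->
     point_eval (L1 *m U1) (L2 *m U2) p = 0) -> p = 0.
Proof.
move=> p0; pose e : P := elimination_poly (gen1 K m n) * elimination_poly (gen2 K m n).
have pe0 : p * e = 0.
  apply: point_eval_vanishing => x1 x2; rewrite !rmorphM /= -!map_elimination_poly.
  rewrite point_eval1 point_eval2; apply/eqP; rewrite !mulf_eq0.
  have [//|/elimination_LU[L1 [U1 [? ? ? ->]]]] := eqVneq (elimination_poly x1) 0; first by rewrite orbT.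
  have [//|/elimination_LU[L2 [U2 [? ? ? ->]]]] := eqVneq (elimination_poly x2) 0; first by rewrite !orbT.
  by rewrite p0 ?eqxx.
have e0 : e != 0.
  apply/eqP => /(congr1 (point_eval 1%:M 1%:M)).
  rewrite rmorph0 rmorphM /= -!map_elimination_poly point_eval1 point_eval2.
  by rewrite !elimination_poly1 mulr1 => /eqP; rewrite oner_eq0.
by move/eqP: pe0; rewrite mulf_eq0 (negPf e0) orbF => /eqP.
Qed.

End Density.

(** * The apolar form on polynomials *)

Section Apolar.

Variables (K : fieldType) (N : nat).
Implicit Types (p q : {mpoly K[N]}) (u : 'X_{1..N}).

Definition mfact u : nat := (\prod_i (u i)`!)%N.

Lemma mfact_gt0 u : (0 < mfact u)%N.
Proof. by rewrite prodn_gt0 // => i; rewrite fact_gt0. Qed.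

Lemma mfact_addU u i : mfact (u + U_(i))%MM = (mfact u * (u i).+1)%N.
Proof.
rewrite /mfact (bigD1 i) //= [in RHS](bigD1 i) //= mnmDE mnm1E eqxx addn1 factS.
rewrite [RHS]mulnAC [((u i).+1 * _)%N]mulnC; congr (_ * _)%N; apply: eq_bigr => j ji.
by rewrite mnmDE mnm1E eq_sym (negPf ji) addn0.
Qed.

(** The pairing [p(d/dx) q] evaluated at the origin. *)
Definition apolar p q : K := \sum_(u <- msupp p) (mfact u)%:R * (p@_u * q@_u).

Lemma apolarE k p q : (msize p <= k)%N ->
  apolar p q = \sum_(u : 'X_{1..N < k}) (mfact u)%:R * (p@_u * q@_u).
Proof.
move=> le_pk; rewrite /apolar (big_mksub 'X_{1..N < k}) ?msupp_uniq //=; first last.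
  by move=> u /msize_mdeg_lt /leq_trans; apply.
rewrite big_rmcond //= => u /memN_msupp_eq0 ->.
by rewrite mul0r mulr0.
Qed.

Lemma apolarC p q : apolar p q = apolar q p.
Proof.
rewrite (@apolarE (maxn (msize p) (msize q))) ?leq_maxl //.
rewrite (@apolarE (maxn (msize p) (msize q)) q) ?leq_maxr //.
by apply: eq_bigr => u _; rewrite [p@__ * _]mulrC.
Qed.

Lemma apolar_linear p : linear_for *%R (apolar p).
Proof.
move=> c q q'; rewrite /apolar mulr_sumr -big_split; apply: eq_bigr => u _ /=.
by rewrite mcoeffD mcoeffZ !mulrDr; congr (_ + _); rewrite !mulrA -[_ * c]mulrC !mulrA;
  congr (_ * _); rewrite -!mulrA; congr (_ * _); rewrite mulrC.
Qed.

Lemma apolarDr p q q' : apolar p (q + q') = apolar p q + apolar p q'.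
Proof. by have := apolar_linear p 1 q q'; rewrite scale1r mul1r. Qed.

Lemma apolar0r p : apolar p 0 = 0.
Proof. by rewrite /apolar big1 // => u _; rewrite mcoeff0 !mulr0. Qed.

Lemma apolarZr c p q : apolar p (c *: q) = c * apolar p q.
Proof. by have := apolar_linear p c q 0; rewrite apolar0r !addr0. Qed.

Lemma apolarDl p q q' : apolar (q + q') p = apolar q p + apolar q' p.
Proof. by rewrite !(apolarC _ p) apolarDr. Qed.

Lemma apolarZl c p q : apolar (c *: q) p = c * apolar q p.
Proof. by rewrite !(apolarC _ p) apolarZr. Qed.

Lemma apolar_sumr (I : Type) (r : seq I) (Q : pred I) (f : I -> {mpoly K[N]}) p :
  apolar p (\sum_(i <- r | Q i) f i) = \sum_(i <- r | Q i) apolar p (f i).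
Proof.
by elim/big_rec2: _ => [|i x y _ <-]; rewrite ?apolar0r ?apolarDr.
Qed.

Lemma apolar_suml (I : Type) (r : seq I) (Q : pred I) (f : I -> {mpoly K[N]}) p :
  apolar (\sum_(i <- r | Q i) f i) p = \sum_(i <- r | Q i) apolar (f i) p.
Proof. by rewrite apolarC apolar_sumr; apply: eq_bigr => i _; rewrite apolarC. Qed.

Lemma apolarX u q : apolar 'X_[u] q = (mfact u)%:R * q@_u.
Proof. by rewrite /apolar msuppX big_seq1 mcoeffX eqxx mul1r. Qed.

(** The factorials in the form compensate those produced by differentiation. *)
Lemma apolar_mulX i p q : apolar ('X_i * p) q = apolar p q^`M(i).
Proof.
elim/mpolyind: p => [|c u p _ _ IH]; first by rewrite mulr0 !(apolarC 0) !apolar0r.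
rewrite mulrDr !apolarDl IH -scalerAr !apolarZl -mpolyXD !apolarX mcoeff_mderiv.
by rewrite addmC mfact_addU natrM -mulrA -[q@__ *+ _]mulr_natl.
Qed.

Definition linear_subst (A : 'M[K]_N) : {mpoly K[N]} -> {mpoly K[N]} :=
  mmap (@mpolyC N K) (fun i => \sum_k A i k *: 'X_k).

HB.instance Definition _ A := GRing.RMorphism.on (linear_subst A).

Lemma linear_substC A c : linear_subst A c%:MP = c%:MP.
Proof. exact: mmapC. Qed.

Lemma linear_subst0 A : linear_subst A 0 = 0.
Proof. exact: rmorph0. Qed.

Lemma linear_subst1 A : linear_subst A 1 = 1.
Proof. exact: rmorph1. Qed.

Lemma linear_substX A i : linear_subst A 'X_i = \sum_k A i k *: 'X_k.
Proof. by rewrite /linear_subst mmapX mmap1U. Qed.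

Lemma linear_substD A p q : linear_subst A (p + q) = linear_subst A p + linear_subst A q.
Proof. exact: rmorphD. Qed.

Lemma linear_substM A p q : linear_subst A (p * q) = linear_subst A p * linear_subst A q.
Proof. exact: rmorphM. Qed.

Lemma apolarCl c q : apolar c%:MP q = c * q@_0.
Proof.
rewrite -[c%:MP]mulr1 mul_mpolyC apolarZl -mpolyX0 apolarX.
by rewrite /mfact big1 ?mul1r // => i _; rewrite mnm0E.
Qed.

Lemma mcoeff0_mulX i p : ('X_i * p)@_0 = 0.
Proof.
by rewrite -[LHS]mul1r -apolarCl apolarC apolar_mulX mderivC apolar0r.
Qed.

Lemma linear_subst_coef0 A p : (linear_subst A p)@_0 = p@_0.
Proof.
elim/mpoly_var_ind: p => [c|p q IHp IHq|i p IH].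
- by rewrite linear_substC.
- by rewrite linear_substD !mcoeffD IHp IHq.
- rewrite mcoeff0_mulX linear_substM linear_substX mulr_suml raddf_sum big1 // => k _ /=.
  by rewrite -scalerAl mcoeffZ mcoeff0_mulX mulr0.
Qed.

Lemma mderiv_sum i (I : Type) (r : seq I) (Q : pred I) (f : I -> {mpoly K[N]}) :
  (\sum_(j <- r | Q j) f j)^`M(i) = \sum_(j <- r | Q j) (f j)^`M(i).
Proof. by elim/big_rec2: _ => [|j x y _ <-]; rewrite ?mderiv0 ?mderivD. Qed.

Lemma mderiv_linear_subst A i p :
  (linear_subst A p)^`M(i) = \sum_k A k i *: linear_subst A p^`M(k).
Proof.
elim/mpoly_var_ind: p => [c|p q IHp IHq|j p IH].
- rewrite linear_substC mderivC big1 // => k _.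
  by rewrite mderivC linear_subst0 scaler0.
- rewrite linear_substD mderivD IHp IHq -big_split; apply: eq_bigr => k _ /=.
  by rewrite mderivD linear_substD scalerDr.
- rewrite linear_substM linear_substX mderivM IH.
  have -> : (\sum_k A j k *: 'X_k)^`M(i) = (A j i)%:MP.
    rewrite mderiv_sum (bigD1 i) //= big1 ?addr0 => [|k ki]; rewrite mderivZ mderivX mnm1E.
      by rewrite eqxx scale1r -{1}[U_(i)%MM]add0m addmK mpolyX0 -mul_mpolyC mulr1.
    by rewrite (negPf ki) scale0r scaler0.
  have -> : (A j i)%:MP * linear_subst A p = \sum_k A k i *: (linear_subst A ('X_j)^`M(k) * linear_subst A p).
    rewrite (bigD1 j) //= big1 ?addr0 => [|k kj]; rewrite mderivX mnm1E.
      rewrite eqxx scale1r -{1}[U_(j)%MM]add0m addmK mpolyX0 linear_subst1.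
      by rewrite mul1r mul_mpolyC.
    by rewrite eq_sym (negPf kj) scale0r linear_subst0 mul0r scaler0.
  rewrite [X in _ + X]mulr_sumr -big_split; apply: eq_bigr => k _ /=.
  by rewrite mderivM linear_substD !linear_substM linear_substX scalerDr -scalerAr.
Qed.

(** By induction on [p]: multiplication by a variable is adjoint to a partial
    derivative, and the chain rule for a linear substitution involves the
    transposed matrix. *)
Theorem apolar_linear_subst A p q :
  apolar (linear_subst A p) q = apolar p (linear_subst A^T q).
Proof.
elim/mpoly_var_ind: p q => [c|p p' IHp IHp'|i p IH] q.
- by rewrite linear_substC !apolarCl linear_subst_coef0.
- by rewrite linear_substD !apolarDl IHp IHp'.
- rewrite linear_substM linear_substX mulr_suml apolar_suml apolar_mulX.
  rewrite mderiv_linear_subst apolar_sumr; apply: eq_bigr => k _.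
  by rewrite -scalerAl apolarZl apolar_mulX IH apolarZr mxE.
Qed.

(** ** Positivity on polynomials with integer coefficients *)

Definition int_coef p : Prop := exists p' : {mpoly int[N]}, p = map_mpoly intr p'.

Lemma int_coef_prod (I : Type) (r : seq I) (Q : pred I) (f : I -> {mpoly K[N]}) :
  (forall i, Q i -> int_coef (f i)) -> int_coef (\prod_(i <- r | Q i) f i).
Proof.
move=> fi; elim/big_rec: _ => [|i x /fi[y ->] [z ->]]; first by exists 1; rewrite rmorph1.
by exists (y * z); rewrite rmorphM.
Qed.

Lemma int_coef_sum (I : Type) (r : seq I) (Q : pred I) (f : I -> {mpoly K[N]}) :
  (forall i, Q i -> int_coef (f i)) -> int_coef (\sum_(i <- r | Q i) f i).
Proof.
move=> fi; elim/big_rec: _ => [|i x /fi[y ->] [z ->]]; first by exists 0; rewrite rmorph0.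
by exists (y + z); rewrite rmorphD.
Qed.

Lemma int_coefM p q : int_coef p -> int_coef q -> int_coef (p * q).
Proof. by move=> [x ->] [y ->]; exists (x * y); rewrite rmorphM. Qed.

Lemma int_coefX p k : int_coef p -> int_coef (p ^+ k).
Proof. by move=> [x ->]; exists (x ^+ k); rewrite rmorphXn. Qed.

Lemma int_coef_sign k : int_coef ((-1) ^+ k).
Proof. by exists ((-1) ^+ k); rewrite rmorph_sign. Qed.

Lemma int_coef_var i : int_coef 'X_i.
Proof. by exists 'X_i; rewrite map_mpolyX. Qed.

Lemma int_coef_nat k : int_coef k%:R.
Proof. by exists k%:R; rewrite rmorph_nat. Qed.

Lemma int_coef_det k (A : 'M[{mpoly K[N]}]_k) :
  (forall i j, int_coef (A i j)) -> int_coef (\det A).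
Proof.
move=> Ai; apply: int_coef_sum => s _; apply: int_coefM; first exact: int_coef_sign.
exact: int_coef_prod.
Qed.

(** A sum of squares of integers with positive weights. *)
Lemma apolar_int_coef p : int_coef p ->
  exists2 k : nat, apolar p p = k%:R & [pchar K] =i pred0 -> p != 0 -> (0 < k)%N.
Proof.
move=> [p' ->]; set q := map_mpoly _ p'.
exists (\sum_(u <- msupp q) mfact u * (`|p'@_u| * `|p'@_u|))%N.
  rewrite natr_sum; apply: eq_bigr => u _; rewrite natrM; congr (_ * _).
  have e (x : int) : x * x = (`|x| * `|x|)%N :> int by case: x => a //; rewrite NegzE mulrNN.
  by rewrite mcoeff_map_mpoly /= -intrM e -pmulrn.
move=> char0 q0; have [u uq] : exists u, u \in msupp q.
  move: q0; rewrite -msupp_eq0; case: (msupp q) => // u s _.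
  by exists u; rewrite mem_head.
rewrite (big_rem u) //= addn_gt0 !muln_gt0 mfact_gt0 !absz_gt0 andbb.
apply/orP; left; move: uq; rewrite mcoeff_msupp mcoeff_map_mpoly.
by apply: contraNneq => ->; apply/eqP.
Qed.

End Apolar.

(** * Supercommutativity and substitutions in the exterior algebra *)

Section SuperCommutativity.

Variables (R : comNzRingType) (N : nat).
Implicit Types (f g : exterior R N) (A B S : {set 'I_N}).

Lemma inversionsC A B : [disjoint A & B] ->
  (inversions A B + inversions B A = #|A| * #|B|)%N.
Proof.
move=> dAB; rewrite /inversions [X in (_ + X)%N]exchange_big -big_split /=.
rewrite -sum_nat_const; apply: eq_bigr => a Aa; rewrite -big_split /= -sum1_card.
apply: eq_bigr => b Bb; case: ltngtP => // /val_inj e.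
by have := disjointFr dAB Aa; rewrite -e Bb.
Qed.

(** Exchanging two monomials of degrees [k] and [l] produces the sign of [k * l]
    transpositions. *)
Lemma ext_mul_commute_sign f g (b : bool) :
    (forall A B, f A != 0 -> g B != 0 -> odd (#|A| * #|B|) = b) ->
  f * g = (-1) ^+ b * (g * f).
Proof.
move=> fgb; have signE (h : exterior R N) : (-1) ^+ b * h = [ffun S => (-1) ^+ b * h S].
  case: (b); rewrite ?expr0 ?expr1 ?mulN1r ?mul1r; apply/ffunP => S.
    by rewrite !ffunE mulN1r.
  by rewrite ffunE mul1r.
rewrite signE; apply/ffunP => S; rewrite !ffunE mulr_sumr.
rewrite (reindex_onto (fun A => S :\: A) (fun A => S :\: A)) /=; last first.
  by move=> A; rewrite powersetE => sAS; rewrite setDDr setDv set0U; apply/setIidPr.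
apply: eq_big => [A|A].
  rewrite !powersetE subsetDl; apply/eqP/idP => [<-|sAS]; first exact: subsetDl.
  by rewrite setDDr setDv set0U; apply/setIidPr.
rewrite powersetE subsetDl => /eqP ->; rewrite [g _ * _]mulrC mulrA.
have [->|fA] := eqVneq (f (S :\: A)) 0; first by rewrite !mul0r !mulr0.
have [->|gA] := eqVneq (g A) 0; first by rewrite !mulr0.
congr (_ * _); rewrite -(fgb _ _ fA gA) signr_odd.
rewrite -inversionsC ?exprD; last by rewrite disjoint_sym disjoints_subset setDE setCI setCK subsetUr.
by rewrite -mulrA -exprD addnn -[X in _ * X]signr_odd odd_double mulr1.
Qed.

Definition ext_parity (b : bool) f := forall S, f S != 0 -> odd #|S| = b.

Lemma ext_even_comm f g : ext_parity false f -> f * g = g * f.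
Proof.
by move=> hf; rewrite (@ext_mul_commute_sign _ _ false) ?mul1r // => A B /hf; rewrite oddM => ->.
Qed.

Lemma ext_odd_anticomm f g : ext_parity true f -> ext_parity true g -> f * g = - (g * f).
Proof.
move=> hf hg; rewrite (@ext_mul_commute_sign _ _ true) ?mulN1r // => A B /hf fA /hg gB.
by rewrite oddM fA gB.
Qed.

Lemma ext_parity0 b : ext_parity b 0.
Proof. by move=> S; rewrite ffunE eqxx. Qed.

Lemma ext_parityD b f g : ext_parity b f -> ext_parity b g -> ext_parity b (f + g).
Proof.
move=> hf hg S; rewrite ffunE; have [->|/hf //] := eqVneq (f S) 0.
by rewrite add0r => /hg.
Qed.

Lemma ext_parityN b f : ext_parity b f -> ext_parity b (- f).
Proof. by move=> hf S; rewrite ffunE oppr_eq0 => /hf. Qed.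

Lemma ext_parity_sum b (I : Type) (r : seq I) (P : pred I) (F : I -> exterior R N) :
  (forall i, P i -> ext_parity b (F i)) -> ext_parity b (\sum_(i <- r | P i) F i).
Proof.
move=> hF; elim/big_rec: _ => [|i x Pi hx]; first exact: ext_parity0.
by apply: ext_parityD => //; apply: hF.
Qed.

Lemma ext_parityM b c f g : ext_parity b f -> ext_parity c g ->
  ext_parity (b (+) c) (f * g).
Proof.
move=> hf hg S; rewrite ffunE => nz.
have [A] : exists A, (A \in powerset S) && (f A * g (S :\: A) != 0).
  apply/existsP; apply: contraNT nz => /existsPn h; apply/eqP; apply: big1 => A PA.
  by have := h A; rewrite PA negbK /= => /eqP ->; rewrite mulr0.
rewrite powersetE => /andP[sAS nz'].
have /hf <- : f A != 0 by apply: contraNneq nz' => ->; rewrite mul0r.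
have /hg <- : g (S :\: A) != 0 by apply: contraNneq nz' => ->; rewrite mulr0.
by rewrite -oddD -(cardsID A S) (setIidPr sAS).
Qed.

Lemma ext_parity_const r : ext_parity false (ext_const N r).
Proof. by move=> S; rewrite ext_constE; have [->|_] := eqVneq S set0; rewrite ?cards0 ?eqxx. Qed.

Lemma ext_parity_gen i : ext_parity true (ext_gen R i).
Proof.
by move=> S; rewrite ffunE; have [->|_] := eqVneq S [set i]; rewrite ?cards1 ?eqxx.
Qed.

End SuperCommutativity.

Section ExteriorLift.

(** Ordered monomials in anticommuting elements of square zero multiply as in
    the exterior algebra. The exponents are boolean functions, so that the
    induction on [N] can remove the first element. *)
Lemma anticomm_prodM (S : pzRingType) N (x : 'I_N -> S) :
    (forall i j, x i * x j = - (x j * x i)) -> (forall i, x i * x i = 0) ->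
  forall a b : 'I_N -> bool,
    (\prod_i x i ^+ a i) * (\prod_i x i ^+ b i)
    = if [exists i, a i && b i] then 0
      else (-1) ^+ (\sum_i \sum_j [&& a i, b j & (j < i)%N]) * \prod_i x i ^+ (a i || b i).
Proof.
elim: N x => [|N IH] x xC xx a b.
  by rewrite !big_ord0 !mul1r; case: existsP => [[[]]|].
have exE : [exists i, a i && b i] =
    (a ord0 && b ord0) || [exists i : 'I_N, a (lift ord0 i) && b (lift ord0 i)].
  apply/existsP/orP => [[i]|[ab|/existsP[i ab]]]; last by exists (lift ord0 i).
    by case: (unliftP ord0 i) => [j|] -> ab; [right; apply/existsP; exists j|left].
  by exists ord0.
have sumE : (\sum_(i < N.+1) \sum_(j < N.+1) [&& a i, b j & (j < i)%N] =
    b ord0 * (\sum_(i < N) a (lift ord0 i)) +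
    \sum_(i < N) \sum_(j < N) [&& a (lift ord0 i), b (lift ord0 j) & (j < i)%N])%N.
  rewrite big_ord_recl big1 => [|j _]; last by rewrite ltn0 !andbF.
  rewrite add0n big_distrr -big_split; apply: eq_bigr => i _ /=.
  by rewrite big_ord_recl; case: (a _); case: (b ord0).
rewrite {}exE {}sumE !big_ord_recl.
have := IH (fun i => x (lift ord0 i)) (fun i j => xC _ _) (fun i => xx _)
  (fun i => a (lift ord0 i)) (fun i => b (lift ord0 i)).
set xa := \prod_(i < N) _; set xb := \prod_(i < N) _; set xab := \prod_(i < N) _.
have xaC : xa * x ord0 = (-1) ^+ (\sum_(i < N) a (lift ord0 i)) * (x ord0 * xa).
  rewrite /xa; elim/big_rec2: _ => [|i k y _ e]; first by rewrite mul1r mulr1 mul1r.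
  rewrite -mulrA e exprD; case: (a _); rewrite /= ?expr1 ?expr0 ?mul1r //.
  rewrite [LHS]mulrA [x _ * (-1) ^+ k]commr_sign -mulrA -[RHS]mulrA mulN1r -mulrN; congr (_ * _).
  by rewrite mulrA xC mulNr -mulrA.
have -> : x ord0 ^+ a ord0 * xa * (x ord0 ^+ b ord0 * xb) =
    (-1) ^+ (b ord0 * \sum_(i < N) a (lift ord0 i)) *
      (x ord0 ^+ a ord0 * x ord0 ^+ b ord0 * (xa * xb)).
  case: (b ord0); rewrite /= ?mul1n ?mul0n ?expr1 ?expr0 ?mul1r ?mulr1 -?mulrA //.
  rewrite [xa * _]mulrA xaC -!mulrA [LHS]mulrA [x ord0 ^+ _ * (-1) ^+ _]commr_sign.
  by rewrite -!mulrA.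
move=> ->; case: [exists i : 'I_N, _]; first by rewrite orbT !mulr0.
rewrite orbF; case: (a ord0); case: (b ord0); rewrite /= ?expr1 ?expr0 ?mul1r ?mulr1 //.
- by rewrite xx mul0r mulr0.
- by rewrite mul0n add0n mulrA [x ord0 * _]commr_sign -mulrA.
- rewrite mul1n exprD -!mulrA; congr (_ * _).
  by rewrite mulrA [x ord0 * _]commr_sign -mulrA.
Qed.

Variables (R : comNzRingType) (N : nat) (S : nzRingType).

(** The morphism out of the exterior algebra with prescribed values on scalars
    and on generators. *)
Definition ext_lift (ev : R -> S) (x : 'I_N -> S) (f : exterior R N) : S :=
  \sum_(A : {set 'I_N}) ev (f A) * \prod_(i in A) x i.

Variables (ev : {rmorphism R -> S}) (x : 'I_N -> S).
Hypothesis ev_central : forall r y, ev r * y = y * ev r.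
Hypothesis x_anticomm : forall i j, x i * x j = - (x j * x i).
Hypothesis x_square0 : forall i, x i * x i = 0.

Lemma ext_lift_is_zmod_morphism : zmod_morphism (ext_lift ev x).
Proof.
move=> f g; rewrite /ext_lift -sumrB; apply: eq_bigr => A _.
by rewrite !ffunE rmorphB mulrBl.
Qed.

Lemma prod_ext_lift (A : {set 'I_N}) : \prod_(i in A) x i = \prod_i x i ^+ (i \in A).
Proof. by rewrite big_mkcond; apply: eq_bigr => i _; case: (i \in A). Qed.

Lemma prod_ext_liftM (A B : {set 'I_N}) : (\prod_(i in A) x i) * (\prod_(i in B) x i) =
  if [disjoint A & B] then (-1) ^+ inversions A B * \prod_(i in A :|: B) x i else 0.
Proof.
rewrite !prod_ext_lift (anticomm_prodM x_anticomm x_square0).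
have -> : [exists i, (i \in A) && (i \in B)] = ~~ [disjoint A & B].
  by apply/existsP/pred0Pn => -[i]; exists i.
case: [disjoint A & B] => //=; congr (_ ^+ _ * _).
  rewrite /inversions [RHS]big_mkcond; apply: eq_bigr => i _ /=.
  case: (i \in A) => /=; last by rewrite big1.
  by rewrite [RHS]big_mkcond; apply: eq_bigr => j _; case: (j \in B).
by apply: eq_bigr => i _; rewrite inE.
Qed.

Lemma ext_lift_const r : ext_lift ev x (ext_const N r) = ev r.
Proof.
rewrite /ext_lift (bigD1 set0) //= big_set0 mulr1 big1 ?addr0 => [|A nA].
  by rewrite ext_constE eqxx.
by rewrite ext_constE (negPf nA) rmorph0 mul0r.
Qed.

Lemma ext_lift_gen i : ext_lift ev x (ext_gen R i) = x i.
Proof.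
rewrite /ext_lift (bigD1 [set i]) //= big_set1 big1 ?addr0 => [|A nA].
  by rewrite ffunE eqxx rmorph1 mul1r.
by rewrite ffunE (negPf nA) rmorph0 mul0r.
Qed.

Lemma ext_lift_is_monoid_morphism : monoid_morphism (ext_lift ev x).
Proof.
split=> [|f g]; first by rewrite ext_lift_const rmorph1.
transitivity (\sum_(A : {set 'I_N}) \sum_(B : {set 'I_N} | [disjoint A & B])
   ev (f A) * ev (g B) * ((-1) ^+ inversions A B * \prod_(i in A :|: B) x i)).
  rewrite /ext_lift; under eq_bigr => S0 _.
    rewrite ffunE rmorph_sum mulr_suml.
    over.
  rewrite (exchange_big_dep xpredT) //=; apply: eq_bigr => A _.
  rewrite (reindex_onto (fun B => A :|: B) (fun U => U :\: A)) /=; last first.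
    by move=> U; rewrite powersetE => sAU; rewrite setDE setUIr setUCr setIT; apply/setUidPr.
  apply: eq_big => [B|B].
    rewrite powersetE subsetUl setDUl setDv set0U.
    apply/eqP/idP => [/setDidPl|dAB]; first by rewrite disjoint_sym.
    by apply/setDidPl; rewrite disjoint_sym.
  rewrite powersetE => /andP[_ /eqP ->].
  rewrite rmorphM rmorphM rmorph_sign -!mulrA; rewrite -commr_sign -!mulrA; congr (_ * (_ * _)).
  by rewrite commr_sign.
rewrite /ext_lift mulr_suml; apply: eq_bigr => A _.
rewrite mulr_sumr [RHS](bigID (fun B : {set 'I_N} => [disjoint A & B])) /= [X in _ = _ + X]big1 ?addr0.
  apply: eq_bigr => B dAB; rewrite -!mulrA; congr (_ * _).
  by rewrite ![_ * (ev _ * _)]mulrA -[_ * ev (g B)]ev_central -!mulrA prod_ext_liftM dAB.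
move=> B dAB; rewrite -!mulrA [X in _ * X]mulrA -ev_central -!mulrA prod_ext_liftM (negPf dAB).
by rewrite !mulr0.
Qed.

End ExteriorLift.

(** * The action on the coordinate ring *)

Lemma unitr_mul (S : unitRingType) (a b : S) :
  a \is a GRing.unit -> b \is a GRing.unit -> a * b \is a GRing.unit.
Proof. by move=> ua ub; rewrite unitrMl. Qed.

Section FractionExtension.

Variables (R : idomainType) (S : unitRingType) (phi : {rmorphism R -> S}) (d : R).
Hypothesis phi_central : forall p y, phi p * y = y * phi p.
Hypothesis phi_unit : phi d \is a GRing.unit.

Lemma frac_ext_comm k y : phi d ^- k * y = y * phi d ^- k.
Proof.
have /commrV : GRing.comm y (phi d ^+ k) by rewrite /GRing.comm -rmorphXn phi_central.
by move=> ->.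
Qed.

Hypothesis d0 : d != 0.

Let fd k : tofrac d ^+ k != 0.
Proof. by rewrite expf_neq0 // tofrac_eq0. Qed.

(** Extension of [phi] to fractions with powers of [d] as denominators; the
    target is not commutative, but the image of [phi] is central. *)
Lemma frac_ext_wd p k q l : tofrac p / tofrac d ^+ k = tofrac q / tofrac d ^+ l ->
  phi p * phi d ^- k = phi q * phi d ^- l.
Proof.
move/eqP; rewrite eqr_div ?fd // -!rmorphXn -!rmorphM tofrac_eq => /eqP /(congr1 phi).
rewrite !rmorphM !rmorphXn => e.
have uX j : phi d ^+ j \is a GRing.unit by rewrite unitrX.
apply: (mulIr (uX k)); rewrite mulrVK // -mulrA frac_ext_comm mulrA -e.
by rewrite mulrK.
Qed.

Lemma fracB p k q l : tofrac p / tofrac d ^+ k - tofrac q / tofrac d ^+ l =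
  tofrac (p * d ^+ l - q * d ^+ k) / tofrac d ^+ (k + l).
Proof. by rewrite -mulNr addf_div // -exprD rmorphB !rmorphM !rmorphXn mulNr. Qed.

Lemma fracM p k q l : (tofrac p / tofrac d ^+ k) * (tofrac q / tofrac d ^+ l) =
  tofrac (p * q) / tofrac d ^+ (k + l).
Proof. by rewrite mulf_div -exprD rmorphM. Qed.

Lemma frac_extB p k q l : phi (p * d ^+ l - q * d ^+ k) * phi d ^- (k + l) =
  phi p * phi d ^- k - phi q * phi d ^- l.
Proof.
rewrite rmorphB !rmorphM !rmorphXn mulrBl exprD invrM ?unitrX //.
congr (_ - _); first by rewrite -mulrA mulVKr // ?unitrX.
by rewrite [_ ^- l * _]frac_ext_comm -mulrA mulVKr // unitrX.
Qed.

Lemma frac_extM p k q l : phi (p * q) * phi d ^- (k + l) =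
  (phi p * phi d ^- k) * (phi q * phi d ^- l).
Proof.
rewrite rmorphM exprD invrM ?unitrX // -!mulrA; congr (_ * _).
by rewrite mulrA frac_ext_comm.
Qed.

Lemma frac_ext_central p k y : phi p * phi d ^- k * y = y * (phi p * phi d ^- k).
Proof. by rewrite -mulrA frac_ext_comm mulrA phi_central mulrA. Qed.

End FractionExtension.

Section Localization.

Variables (K : fieldType) (m n : nat).
Local Notation P := (Defs.even_poly K m n).
Local Notation E := (KGL K m n).
Local Notation det0 := (even_det K m n).

Variable phi : {rmorphism P -> E}.
Hypothesis phi_central : forall p y, phi p * y = y * phi p.
Hypothesis phi_det_unit : phi det0 \is a GRing.unit.

Definition loc_ext (x : even_loc K m n) : E :=
  let: (p, k) := even_loc_repr x in phi p * phi det0 ^- k.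

Lemma loc_extE (x : even_loc K m n) p k :
  even_loc_val x = tofrac p / tofrac det0 ^+ k -> loc_ext x = phi p * phi det0 ^- k.
Proof.
move=> xE; rewrite /loc_ext /even_loc_repr.
case: (cid _) => -[q l] /= yE.
by apply: (frac_ext_wd phi_central phi_det_unit (even_det_neq0 K m n)); rewrite -yE -xE.
Qed.

Lemma loc_ext_poly p : loc_ext (even_loc_poly p) = phi p.
Proof.
have /loc_extE -> : even_loc_val (even_loc_poly p) = tofrac p / tofrac det0 ^+ 0.
  by rewrite expr0 divr1.
by rewrite expr0 invr1 mulr1.
Qed.

Lemma loc_ext_repr (x : even_loc K m n) :
  exists p k, even_loc_val x = tofrac p / tofrac det0 ^+ k.
Proof. by have /asboolP[[p k] e] := even_loc_valP x; exists p, k. Qed.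

Lemma loc_ext_is_zmod_morphism : zmod_morphism loc_ext.
Proof.
move=> x y; have [p [k ex]] := loc_ext_repr x; have [q [l ey]] := loc_ext_repr y.
have exy : even_loc_val (x - y) = tofrac (p * det0 ^+ l - q * det0 ^+ k) / tofrac det0 ^+ (k + l).
  by rewrite -(fracB (even_det_neq0 K m n)) -ex -ey.
rewrite (loc_extE ex) (loc_extE ey) (loc_extE exy).
exact: (frac_extB phi_central phi_det_unit).
Qed.

Lemma loc_ext_is_monoid_morphism : monoid_morphism loc_ext.
Proof.
split=> [|x y]; first by rewrite -[1](rmorph1 (@even_loc_poly K m n)) loc_ext_poly rmorph1.
have [p [k ex]] := loc_ext_repr x; have [q [l ey]] := loc_ext_repr y.
have exy : even_loc_val (x * y) = tofrac (p * q) / tofrac det0 ^+ (k + l).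
  by rewrite -fracM -ex -ey.
rewrite (loc_extE ex) (loc_extE ey) (loc_extE exy).
exact: (frac_extM phi_central phi_det_unit).
Qed.

Lemma loc_ext_central x y : loc_ext x * y = y * loc_ext x.
Proof.
have [p [k ex]] := loc_ext_repr x; rewrite (loc_extE ex).
exact: frac_ext_central.
Qed.

End Localization.

Section Action.

Variables (K : fieldType) (m n : nat).
Local Notation P := (Defs.even_poly K m n).
Local Notation E := (KGL K m n).
Local Notation KC := (@KGL_const K m n).
Local Notation mapC := (map_mx KC).
Local Notation X1 := (gen1 K m n).
Local Notation X2 := (gen2 K m n).

Lemma KGL_even_is_zmod_morphism : zmod_morphism (@KGL_even K m n).
Proof. by move=> p q; rewrite /KGL_even !rmorphB. Qed.
Lemma KGL_even_is_monoid_morphism : monoid_morphism (@KGL_even K m n).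
Proof. by split=> [|p q]; rewrite /KGL_even ?rmorph1 ?rmorphM. Qed.
HB.instance Definition _ :=
  GRing.isZmodMorphism.Build P E (@KGL_even K m n) KGL_even_is_zmod_morphism.
HB.instance Definition _ :=
  GRing.isMonoidMorphism.Build P E (@KGL_even K m n) KGL_even_is_monoid_morphism.

Lemma KGL_even_central (p : P) (y : E) : KGL_even p * y = y * KGL_even p.
Proof. exact: ext_const_comm. Qed.

Lemma KGL_const_central (c : K) (y : E) : KC c * y = y * KC c.
Proof. exact: ext_const_comm. Qed.

Lemma KGL_scaleE (c : K) (y : E) : c *: y = KC c * y.
Proof. by []. Qed.

Lemma even_detE : even_det K m n = \det X1 * \det X2.
Proof. by []. Qed.

Lemma C11E : C11 K m n = map_mx (@KGL_even K m n) X1.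
Proof. by apply/matrixP => i j; rewrite !mxE. Qed.

Lemma C22E : C22 K m n = map_mx (@KGL_even K m n) X2.
Proof. by apply/matrixP => i j; rewrite !mxE. Qed.

Lemma det_C11E : \det (C11 K m n) = KGL_even (\det X1).
Proof. by rewrite C11E det_map_mx. Qed.

Lemma even_loc_det_inv : exists x : even_loc K m n, x * even_loc_poly (even_det K m n) = 1.
Proof.
have h : (tofrac (even_det K m n))^-1 \in in_even_loc (K := K) (m := m) (n := n).
  by apply/asboolP; exists (1, 1%N); rewrite /= rmorph1 div1r expr1.
exists (EvenLoc h); apply: val_inj => /=.
by rewrite mulVf // tofrac_eq0 even_det_neq0.
Qed.

Lemma KGL_even_det_unit : KGL_even (even_det K m n) \is a GRing.unit.
Proof.
have [x xd] := even_loc_det_inv; apply/unitrP; exists (ext_const _ x).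
by rewrite ext_const_comm /KGL_even -rmorphM /= mulrC xd rmorph1.
Qed.

Lemma KGL_even_dvd_det_unit (p q : P) : p * q = even_det K m n -> KGL_even p \is a GRing.unit.
Proof.
move=> pq; have [x xd] := even_loc_det_inv.
apply/unitrP; exists (ext_const _ (x * even_loc_poly q)).
rewrite ext_const_comm /KGL_even -rmorphM /=.
by rewrite mulrCA -rmorphM /= pq xd rmorph1.
Qed.

Lemma det_C11_unit : \det (C11 K m n) \is a GRing.unit.
Proof. by rewrite det_C11E; apply: (@KGL_even_dvd_det_unit _ (\det X2)). Qed.

Lemma KGL_const_unit c : c != 0 -> KC c \is a GRing.unit.
Proof.
move=> c0; apply/unitrP; exists (KC c^-1).
by rewrite -!rmorphM /= mulVf // mulfV // rmorph1.
Qed.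

Variables (g1 : 'M[K]_m) (g2 : 'M[K]_n).
Hypotheses (ug1 : g1 \in unitmx) (ug2 : g2 \in unitmx).
Hypothesis hK : 2%N \notin [pchar K].

Local Notation g := (block_mx g1 0 0 g2).

Let phi : {rmorphism P -> E} := @KGL_even K m n \o translate g1 g2.

Lemma phi_central p y : phi p * y = y * phi p.
Proof. exact: KGL_even_central. Qed.

Lemma translate_det1 : translate g1 g2 (\det X1) = (\det g1)%:MP * \det X1.
Proof. by rewrite -det_map_mx translate1 det_mulmx mulrC det_map_mx. Qed.

Lemma translate_det2 : translate g1 g2 (\det X2) = (\det g2)%:MP * \det X2.
Proof. by rewrite -det_map_mx translate2 det_mulmx mulrC det_map_mx. Qed.

Lemma phi_det : phi (even_det K m n) = KC (\det g1 * \det g2) * KGL_even (even_det K m n).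
Proof.
have -> : phi (even_det K m n) = KGL_even (translate g1 g2 (even_det K m n)) by [].
rewrite even_detE rmorphM /= translate_det1 translate_det2 mulrACA -even_detE rmorphM.
by congr (KGL_even _ * _); rewrite mpolyCM.
Qed.

Lemma phi_det_unit : phi (even_det K m n) \is a GRing.unit.
Proof.
move: phi_det; move: (phi (even_det K m n)) => y ->; apply: unitr_mul.
  by apply: KGL_const_unit; rewrite mulf_neq0 // -unitfE -unitmxE.
exact: KGL_even_det_unit.
Qed.

Lemma C_translate : C K m n *m mapC g =
  block_mx (C11 K m n *m mapC g1) (C12 K m n *m mapC g2)
           (C21 K m n *m mapC g1) (C22 K m n *m mapC g2).
Proof.
by rewrite map_block_mx mulmx_block !map_mx0 !mulmx0 !addr0 !add0r.
Qed.

Lemma subst_poly_translate p : subst_poly (C K m n *m mapC g) p = phi p.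
Proof.
symmetry; rewrite (pair_substE (f := KC) (A := C11 K m n *m mapC g1) (B := C22 K m n *m mapC g2)).
- have e : pair_entry (C11 K m n *m mapC g1) (C22 K m n *m mapC g2) =
             even_entry (C K m n *m mapC g).
    apply: funext => -[q|q]; rewrite C_translate /even_entry; first by rewrite block_mxKul.
    by rewrite block_mxKdr.
  exact: (congr1 (fun h => mmap KC (fun i => h (enum_val i)) p) e).
- by move=> c /=; rewrite translateC.
- transitivity (map_mx (@KGL_even K m n) (map_mx (translate g1 g2) X1)).
    by apply/matrixP => i j; rewrite [LHS]mxE [RHS]mxE [X in _ = _ X]mxE.
  by rewrite translate1 map_mxM C11E; congr (_ *m _); apply/matrixP => i j; rewrite !mxE.
- transitivity (map_mx (@KGL_even K m n) (map_mx (translate g1 g2) X2)).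
    by apply/matrixP => i j; rewrite [LHS]mxE [RHS]mxE [X in _ = _ X]mxE.
  by rewrite translate2 map_mxM C22E; congr (_ *m _); apply/matrixP => i j; rewrite !mxE.
Qed.

Let x (o : 'I_#|{: odd_index m n}|) : E := odd_entry (C K m n *m mapC g) (enum_val o).

Lemma ext_parity_mulC (k l : nat) (A : 'M[E]_(k, l)) p (h : 'M[K]_(l, p)) b :
  (forall i j, ext_parity b (A i j)) -> forall i j, ext_parity b ((A *m mapC h) i j).
Proof.
move=> hA i j; rewrite mxE; apply: ext_parity_sum => r _.
by rewrite -[b]addbF; apply: ext_parityM; rewrite ?mxE //; apply: ext_parity_const.
Qed.

Lemma C12_odd i j : ext_parity true (C12 K m n i j).
Proof. by rewrite mxE; apply: ext_parity_gen. Qed.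

Lemma C21_odd i j : ext_parity true (C21 K m n i j).
Proof. by rewrite mxE; apply: ext_parity_gen. Qed.

Lemma x_odd o : ext_parity true (x o).
Proof.
rewrite /x C_translate; case: (enum_val o) => -[i j] /=.
  by rewrite block_mxKur; apply/ext_parity_mulC/C12_odd.
by rewrite block_mxKdl; apply/ext_parity_mulC/C21_odd.
Qed.

Lemma x_anticomm o o' : x o * x o' = - (x o' * x o).
Proof. by apply: ext_odd_anticomm; apply: x_odd. Qed.

(** Odd elements anticommute with themselves, and 2 is invertible. *)
Lemma x_square0 o : x o * x o = 0.
Proof.
have /eqP := x_anticomm o o; rewrite -subr_eq0 opprK -mulr2n -mulr_natr => /eqP e.
have u2 : (2%:R : E) \is a GRing.unit.
  have -> : 2%:R = KC 2%:R by rewrite rmorph_nat.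
  by apply: KGL_const_unit; apply: contra hK => /eqP e2; rewrite inE /= e2 eqxx.
by apply: (mulIr u2); rewrite e mul0r.
Qed.

(** For block diagonal [g] the substitution preserves parity, and is therefore a
    ring morphism by the universal property of the exterior algebra. *)
Lemma act_ext_lift : act g =1 ext_lift (loc_ext phi) x.
Proof.
move=> f; rewrite /act /subst /ext_lift /loc_ext /x.
have -> : subst_poly (C K m n *m mapC g) = phi by apply: funext => p; apply: subst_poly_translate.
by [].
Qed.

Let phiC p y : phi p * y = y * phi p. Proof. exact: phi_central. Qed.

Let ev : {rmorphism even_loc K m n -> E} := HB.pack (loc_ext phi)
  (GRing.isZmodMorphism.Build _ _ _ (loc_ext_is_zmod_morphism phiC phi_det_unit))
  (GRing.isMonoidMorphism.Build _ _ _ (loc_ext_is_monoid_morphism phiC phi_det_unit)).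

Let ev_central r y : ev r * y = y * ev r.
Proof. exact: (loc_ext_central phiC phi_det_unit r y). Qed.

Lemma act_is_zmod_morphism : zmod_morphism (act g).
Proof. by move=> f h; rewrite !act_ext_lift; apply: (ext_lift_is_zmod_morphism ev x). Qed.

Lemma act_is_monoid_morphism : monoid_morphism (act g).
Proof.
have [h1 hM] := ext_lift_is_monoid_morphism ev_central x_anticomm x_square0.
by split=> [|f h]; rewrite !act_ext_lift; [apply: h1|apply: hM].
Qed.

Lemma act_KGL_even p : act g (KGL_even p) = KGL_even (translate g1 g2 p).
Proof.
rewrite act_ext_lift; apply: etrans (ext_lift_const ev x _) _.
exact: (loc_ext_poly phiC phi_det_unit).
Qed.

Lemma act_ext_gen o : act g (ext_gen _ o) = x o.
Proof. by rewrite act_ext_lift; apply: (ext_lift_gen ev x). Qed.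

Lemma act_const c : act g (KC c) = KC c.
Proof. by rewrite act_KGL_even translateC. Qed.

Lemma act_C11 : map_mx (act g) (C11 K m n) = C11 K m n *m mapC g1.
Proof.
transitivity (map_mx (@KGL_even K m n) (map_mx (translate g1 g2) X1)).
  by apply/matrixP => i j; rewrite [LHS]mxE C11E [X in act _ X]mxE [RHS]mxE [X in _ = _ X]mxE act_KGL_even.
by rewrite translate1 map_mxM C11E; congr (_ *m _); apply/matrixP => i j; rewrite !mxE.
Qed.

Lemma act_C22 : map_mx (act g) (C22 K m n) = C22 K m n *m mapC g2.
Proof.
transitivity (map_mx (@KGL_even K m n) (map_mx (translate g1 g2) X2)).
  by apply/matrixP => i j; rewrite [LHS]mxE C22E [X in act _ X]mxE [RHS]mxE [X in _ = _ X]mxE act_KGL_even.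
by rewrite translate2 map_mxM C22E; congr (_ *m _); apply/matrixP => i j; rewrite !mxE.
Qed.

Lemma act_C12 : map_mx (act g) (C12 K m n) = C12 K m n *m mapC g2.
Proof.
apply/matrixP => i j; rewrite [LHS]mxE [X in act _ X]mxE act_ext_gen /x enum_rankK.
by rewrite C_translate /= block_mxKur.
Qed.

Lemma act_C21 : map_mx (act g) (C21 K m n) = C21 K m n *m mapC g1.
Proof.
apply/matrixP => i j; rewrite [LHS]mxE [X in act _ X]mxE act_ext_gen /x enum_rankK.
by rewrite C_translate /= block_mxKdl.
Qed.

End Action.

(** * The first floor in terms of matrices of polynomials *)

(** Here [h] stands for the action of a group element on entries, and [Z] for
    the matrix [Y]. As [Z] is the unique solution of [A *m Z = B], its
    transformation follows from those of [A] and [B]; the Schur complement [Phi]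
    then only sees right multiplication by [G2]. *)
Section BlockTriangular.

Variables (S : nzRingType) (h : {rmorphism S -> S}) (m n : nat).
Variables (A A' : 'M[S]_m) (B : 'M[S]_(m, n)) (C : 'M[S]_(n, m)) (D : 'M[S]_n).
Variables (Z : 'M[S]_(m, n)) (G1 H1 : 'M[S]_m) (G2 : 'M[S]_n).
Hypotheses (A'A : A' *m A = 1%:M) (AZ : A *m Z = B).
Hypotheses (GH : G1 *m H1 = 1%:M) (HG : H1 *m G1 = 1%:M).
Hypotheses (hA : map_mx h A = A *m G1) (hB : map_mx h B = B *m G2).
Hypotheses (hC : map_mx h C = C *m G1) (hD : map_mx h D = D *m G2).

Lemma map_solution : map_mx h Z = H1 *m Z *m G2.
Proof.
have e : A *m (G1 *m map_mx h Z) = A *m (Z *m G2).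
  by rewrite !mulmxA -hA -map_mxM AZ hB.
have {}e : G1 *m map_mx h Z = Z *m G2.
  by rewrite -[LHS]mul1mx -A'A -mulmxA e mulmxA A'A mul1mx.
by rewrite -mulmxA -e mulmxA HG mul1mx.
Qed.

Lemma map_schur : map_mx h (D - C *m Z) = (D - C *m Z) *m G2.
Proof.
rewrite map_mxB map_mxM hC hD map_solution mulmxBl; congr (_ - _).
by rewrite !mulmxA -(mulmxA C) GH mulmx1.
Qed.

End BlockTriangular.

Section CentralScalars.

Variables (S : nzRingType) (c : S).
Hypothesis cC : forall y, c * y = y * c.

Lemma central_scalemxAr m n p (A : 'M[S]_(m, n)) (B : 'M[S]_(n, p)) :
  A *m (c *: B) = c *: (A *m B).
Proof.
apply/matrixP => i j; rewrite !mxE mulr_sumr; apply: eq_bigr => k _.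
by rewrite !mxE !mulrA cC.
Qed.

End CentralScalars.

Section Theta.

Variables (K : fieldType) (m n : nat).
Local Notation KC := (@KGL_const K m n).
Local Notation X2 := (gen2 K m n).
Local Notation C11 := (C11 K m n).
Local Notation C12 := (C12 K m n).
Local Notation Y := (Y K m n).
Local Notation Phi := (Phi K m n).

Lemma det_C11V : exists x : even_loc K m n, (\det C11)^-1 = ext_const _ x.
Proof.
have [x xd] := even_loc_det_inv K m n; exists (x * even_loc_poly (\det X2)).
have u := det_C11_unit K m n; apply: (mulIr u); rewrite mulVr // det_C11E.
rewrite /KGL_even -rmorphM /=; move: xd; rewrite even_detE rmorphM /= => xd.
by rewrite -mulrA [X in _ * X]mulrC xd rmorph1.
Qed.

Lemma det_C11V_central y : (\det C11)^-1 * y = y * (\det C11)^-1.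
Proof. by have [x ->] := det_C11V; apply: ext_const_comm. Qed.

Lemma mulmx_adj_C11 : C11 *m \adj C11 = (\det C11)%:M.
Proof. by rewrite C11E -map_mx_adj -map_mxM mul_mx_adj map_scalar_mx det_map_mx. Qed.

Lemma mul_adj_mx_C11 : \adj C11 *m C11 = (\det C11)%:M.
Proof. by rewrite C11E -map_mx_adj -map_mxM mul_adj_mx map_scalar_mx det_map_mx. Qed.

Lemma C11_linv : ((\det C11)^-1 *: \adj C11) *m C11 = 1%:M.
Proof.
by rewrite -scalemxAl mul_adj_mx_C11 scale_scalar_mx mulVr // det_C11_unit.
Qed.

Lemma C11_Y : C11 *m Y = C12.
Proof.
rewrite /Defs.Y (central_scalemxAr det_C11V_central) mulmxA mulmx_adj_C11.
by rewrite scalemxAl scale_scalar_mx mulVr ?det_C11_unit // mul1mx.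
Qed.

Lemma det_Y : \det C11 *: Y = \adj C11 *m C12.
Proof. by rewrite /Defs.Y scalerA mulrV ?scale1r // det_C11_unit. Qed.

Lemma Y_odd i j : ext_parity true (Y i j).
Proof.
have [x dx] := det_C11V; rewrite mxE dx -[true]addFb; apply: ext_parityM.
  exact: ext_parity_const.
rewrite mxE; apply: ext_parity_sum => k _; rewrite -[true]addFb; apply: ext_parityM.
  by rewrite C11E -map_mx_adj mxE; apply: ext_parity_const.
exact: C12_odd.
Qed.

Lemma Phi_even i j : ext_parity false (Phi i j).
Proof.
rewrite !mxE; apply: ext_parityD; first exact: ext_parity_const.
apply: ext_parityN; apply: ext_parity_sum => k _; rewrite -[false]/(true (+) true).
by apply: ext_parityM; [exact: C21_odd|exact: Y_odd].
Qed.

End Theta.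

(** The generic matrices are sent to [C11] and [Phi], so that [Dplus] and [Dminus]
    become images of ordinary polynomial minors. The entries of [Phi] are even,
    hence central. *)
HB.lock Definition theta (K : fieldType) (m n : nat) : Defs.even_poly K m n -> KGL K m n :=
  pair_subst (@KGL_const K m n) (C11 K m n) (Phi K m n).

Section ThetaMorphism.

Variables (K : fieldType) (m n : nat).
Local Notation P := (Defs.even_poly K m n).
Local Notation E := (KGL K m n).
Local Notation KC := (@KGL_const K m n).
Local Notation mapC := (map_mx KC).
Local Notation X1 := (gen1 K m n).
Local Notation X2 := (gen2 K m n).
Local Notation C11 := (C11 K m n).
Local Notation Y := (Y K m n).
Local Notation Phi := (Phi K m n).
Local Notation theta := (@theta K m n).

Lemma theta_is_zmod_morphism : zmod_morphism theta.
Proof. by rewrite theta.unlock; exact: pair_subst_is_zmod_morphism. Qed.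

Lemma theta_entry_central e y : pair_entry C11 Phi e * y = y * pair_entry C11 Phi e.
Proof.
case: e => -[i j] /=; first by rewrite mxE; apply: KGL_even_central.
by apply: ext_even_comm; apply: Phi_even.
Qed.

Lemma theta_is_monoid_morphism : monoid_morphism theta.
Proof.
rewrite theta.unlock; exact: (pair_subst_central_monoid_morphism (f := KC) (A := C11) (B := Phi)
  (@KGL_const_central K m n) theta_entry_central).
Qed.
HB.instance Definition _ := GRing.isZmodMorphism.Build P E theta theta_is_zmod_morphism.
HB.instance Definition _ := GRing.isMonoidMorphism.Build P E theta theta_is_monoid_morphism.

Lemma thetaC c : theta c%:MP = KC c.
Proof. rewrite theta.unlock; exact: pair_substC. Qed.

Lemma map_theta_const k l (M : 'M[K]_(k, l)) : map_mx theta (map_mx (@mpolyC _ K) M) = mapC M.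
Proof. by apply/matrixP => i j; rewrite [LHS]mxE [X in theta X]mxE [RHS]mxE; apply: thetaC. Qed.

Lemma theta1 : map_mx theta X1 = C11.
Proof. rewrite theta.unlock; exact: pair_subst1. Qed.

Lemma theta2 : map_mx theta X2 = Phi.
Proof. rewrite theta.unlock; exact: pair_subst2. Qed.

Lemma theta_central p y : theta p * y = y * theta p.
Proof.
rewrite theta.unlock; exact: (pair_subst_central (f := KC) (A := C11) (B := Phi)
  (@KGL_const_central K m n) theta_entry_central).
Qed.

Lemma Dplus_theta s : Dplus K n s = theta (minor_on X1 s).
Proof. by rewrite -map_minor_on theta1. Qed.

Lemma Dminus_theta s : Dminus K m s = theta (minor_on X2 s).
Proof. by rewrite -map_minor_on theta2. Qed.

Section Act.

Variables (g1 : 'M[K]_m) (g2 : 'M[K]_n).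
Hypotheses (ug1 : g1 \in unitmx) (ug2 : g2 \in unitmx).
Hypothesis hK : 2%N \notin [pchar K].

Local Notation g := (block_mx g1 0 0 g2).

Let h : {rmorphism E -> E} := HB.pack (act g)
  (GRing.isZmodMorphism.Build _ _ _ (act_is_zmod_morphism ug1 ug2))
  (GRing.isMonoidMorphism.Build _ _ _ (act_is_monoid_morphism ug1 ug2 hK)).

Let GH : mapC g1 *m mapC (invmx g1) = 1%:M.
Proof. by rewrite -map_mxM mulmxV // map_mx1. Qed.
Let HG : mapC (invmx g1) *m mapC g1 = 1%:M.
Proof. by rewrite -map_mxM mulVmx // map_mx1. Qed.

Lemma act_Y : map_mx (act g) Y = mapC (invmx g1) *m Y *m mapC g2.
Proof.
exact: (map_solution (h := h) (C11_linv K m n) (C11_Y K m n) HG (act_C11 ug1 ug2) (act_C12 ug1 ug2)).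
Qed.

Lemma act_Phi : map_mx (act g) Phi = Phi *m mapC g2.
Proof.
exact: (map_schur (h := h) (C11_linv K m n) (C11_Y K m n) GH HG (act_C11 ug1 ug2) (act_C12 ug1 ug2)
         (act_C21 ug1 ug2) (act_C22 ug1 ug2)).
Qed.

Lemma act_theta p : act g (theta p) = theta (translate g1 g2 p).
Proof.
pose u : {rmorphism P -> E} := h \o theta.
pose v : {rmorphism P -> E} := theta \o translate g1 g2.
apply: (pair_subst_unique (h := u) (k := v)) => [c||].
- by rewrite /= translateC thetaC; apply: (act_const ug1 ug2).
- transitivity (map_mx (act g) (map_mx theta X1)).
    by apply/matrixP => i j; rewrite [LHS]mxE [RHS]mxE [X in _ = _ X]mxE.
  rewrite theta1 (act_C11 ug1 ug2).
  transitivity (map_mx theta (map_mx (translate g1 g2) X1)); last first.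
    by apply/matrixP => i j; rewrite [RHS]mxE [LHS]mxE [X in _ X = _]mxE.
  rewrite translate1 map_mxM theta1.
  by rewrite map_theta_const.
- transitivity (map_mx (act g) (map_mx theta X2)).
    by apply/matrixP => i j; rewrite [LHS]mxE [RHS]mxE [X in _ = _ X]mxE.
  rewrite theta2 act_Phi.
  transitivity (map_mx theta (map_mx (translate g1 g2) X2)); last first.
    by apply/matrixP => i j; rewrite [RHS]mxE [LHS]mxE [X in _ X = _]mxE.
  rewrite translate2 map_mxM theta2.
  by rewrite map_theta_const.
Qed.

End Act.

End ThetaMorphism.

(** Elements of the first floor are linear forms in the [y_ij] whose coefficients
    are images of polynomials, times a fixed unit. The lemmas are stated for an
    arbitrary central morphism. *)
Section LinearForms.

Variables (R : comNzRingType) (S : nzRingType) (theta : {rmorphism R -> S}) (m n : nat).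
Hypothesis theta_central : forall p y, theta p * y = y * theta p.

Definition linear_form (Z : 'M[S]_(m, n)) (Q : 'M[R]_(m, n)) : S :=
  \sum_i \sum_j theta (Q i j) * Z i j.

Lemma linear_formD Z Q Q' : linear_form Z (Q + Q') = linear_form Z Q + linear_form Z Q'.
Proof.
rewrite -big_split; apply: eq_bigr => i _; rewrite -big_split; apply: eq_bigr => j _.
by rewrite mxE rmorphD mulrDl.
Qed.

Lemma linear_formZ Z c Q : linear_form Z (c *: Q) = theta c * linear_form Z Q.
Proof.
rewrite mulr_sumr; apply: eq_bigr => i _; rewrite mulr_sumr; apply: eq_bigr => j _.
by rewrite mxE rmorphM mulrA.
Qed.

Lemma linear_form_scale Z c Q : linear_form (theta c *: Z) Q = theta c * linear_form Z Q.
Proof.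
rewrite mulr_sumr; apply: eq_bigr => i _; rewrite mulr_sumr; apply: eq_bigr => j _.
by rewrite mxE mulrA -theta_central mulrA.
Qed.

Lemma linear_form_mulmx Z Q (L : 'M[R]_m) (M : 'M[R]_n) :
  linear_form (map_mx theta L *m Z *m map_mx theta M) Q = linear_form Z (L^T *m Q *m M^T).
Proof.
pose t i j k l := theta (L i k) * theta (Q i j) * theta (M l j) * Z k l.
transitivity (\sum_i \sum_j \sum_k \sum_l t i j k l).
  apply: eq_bigr => i _; apply: eq_bigr => j _; rewrite mxE mulr_sumr.
  rewrite exchange_big; apply: eq_bigr => l _ /=; rewrite !mxE mulr_suml mulr_sumr.
  apply: eq_bigr => k _; rewrite !mxE /t.
  rewrite !mulrA -theta_central -(theta_central (L i k)) !mulrA.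
  by rewrite -[X in X * _ = _]mulrA theta_central -!mulrA.
transitivity (\sum_k \sum_l \sum_i \sum_j t i j k l).
  rewrite [RHS]exchange_big /=.
  under [RHS]eq_bigr => l _ do rewrite exchange_big /=.
  rewrite [RHS]exchange_big /=; apply: eq_bigr => i _.
  under [RHS]eq_bigr => l _ do rewrite exchange_big /=.
  rewrite [RHS]exchange_big /=; apply: eq_bigr => j _.
  by rewrite exchange_big.
apply: eq_bigr => k _; apply: eq_bigr => l _.
rewrite mxE rmorph_sum mulr_suml exchange_big; apply: eq_bigr => j _ /=.
rewrite !mxE rmorphM rmorph_sum mulr_suml mulr_suml; apply: eq_bigr => i _.
by rewrite /t !mxE rmorphM.
Qed.

End LinearForms.

Lemma central_mulACA (S : nzRingType) (c d x y z : S) : (forall w, d * w = w * d) ->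
  c * x * (d * y) * z = c * d * (x * y * z).
Proof. by move=> dC; rewrite -!mulrA; congr (_ * _); rewrite !mulrA dC. Qed.

Lemma unit_expz (S : unitRingType) (x : S) (z : int) :
  x \is a GRing.unit -> x ^ z \is a GRing.unit.
Proof. by move=> ux; case: z => k; rewrite ?unitrV unitrX. Qed.

Section TwistedPowers.

Variables (S : unitRingType) (h : {rmorphism S -> S}) (c u : S).
Hypotheses (cC : forall y, c * y = y * c) (uc : c \is a GRing.unit) (uu : u \is a GRing.unit).

Lemma rmorph_expz_twist z : h u = c * u -> h (u ^ z) = c ^ z * u ^ z.
Proof. by move=> hu; rewrite rmorphXz // hu exprMz_comm. Qed.

End TwistedPowers.

Section Coefficients.

Variables (R : comNzRingType) (N : nat).
Implicit Types f g : exterior R N.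

Lemma ext_body_mul f g : (f * g) set0 = f set0 * g set0.
Proof. by rewrite ffunE powerset0 big_set1 setD0 inversions0s expr0 mul1r. Qed.

Lemma ext_coef1_mul f g o : (f * g) [set o] = f set0 * g [set o] + f [set o] * g set0.
Proof.
rewrite ffunE powerset1 big_setU1 ?big_set1 /=; last first.
  by rewrite inE eq_sym -card_gt0 cards1.
by rewrite setD0 setDv inversions0s inversionss0 expr0 !mul1r.
Qed.

Definition ext_body f : R := f set0.

Lemma ext_body_is_zmod_morphism : zmod_morphism ext_body.
Proof. by move=> f g; rewrite /ext_body !ffunE. Qed.
Lemma ext_body_is_monoid_morphism : monoid_morphism ext_body.
Proof. by split=> [|f g]; rewrite /ext_body ?ext_body_mul // ext_constE eqxx. Qed.
HB.instance Definition _ :=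
  GRing.isZmodMorphism.Build (exterior R N) R ext_body ext_body_is_zmod_morphism.
HB.instance Definition _ :=
  GRing.isMonoidMorphism.Build (exterior R N) R ext_body ext_body_is_monoid_morphism.

Lemma ext_odd_body f : ext_parity true f -> ext_body f = 0.
Proof. by move=> hf; apply/eqP; apply: contraT => /hf; rewrite cards0. Qed.

(** Monomials of the powers of an element without constant term get longer
    and longer, so such an element is nilpotent. *)
Lemma ext_nilpotent f : ext_body f = 0 -> f ^+ N.+1 = 0.
Proof.
move=> f0; have deg k (S : {set 'I_N}) : (#|S| < k)%N -> (f ^+ k) S = 0.
  elim: k S => // k IH S ltS; rewrite exprS ffunE big1 // => A; rewrite powersetE => sAS.
  have [->|A0] := eqVneq A set0; first by rewrite [f set0]f0 mul0r mulr0.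
  rewrite IH ?mulr0 //; move: ltS; rewrite -(cardsID A S) (setIidPr sAS) -card_gt0 in A0 *.
  by case: #|A| A0 => // a _; rewrite addSn ltnS; apply/leq_trans; rewrite ltnS leq_addl.
apply/ffunP => S; rewrite deg ?ffunE // ltnS.
by rewrite -[X in (_ <= X)%N](card_ord N) max_card.
Qed.

(** Geometric series for a nilpotent perturbation of a scalar. *)
Lemma ext_unit_body f r : ext_body f * r = 1 -> f \is a GRing.unit.
Proof.
move=> fr; pose c := ext_const N r.
have cC y : c * y = y * c by apply: ext_const_comm.
have : (1 - f * c) ^+ N.+1 = 0.
  by apply: ext_nilpotent; rewrite rmorphB rmorphM rmorph1 /= [ext_body c]ext_constE eqxx fr subrr.
set x := 1 - f * c => xN.
have fcE : f * c = 1 - x by rewrite /x opprB addrC subrK.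
pose s := \sum_(i < N.+1) x ^+ i.
have xs : (1 - x) * s = 1.
  by have /eqP := subrX1 x N.+1; rewrite xN sub0r -opprB mulNr eqr_opp => /eqP <-.
have sC : GRing.comm (1 - x) s.
  apply: commr_sum => i _; apply: commrX; apply: commr_sym.
  by apply: commrB; [apply: commr1|].
have sx : s * (1 - x) = 1 by rewrite -sC xs.
apply/unitrP; exists (c * s); split.
  by rewrite cC -mulrA cC fcE.
by rewrite mulrA fcE.
Qed.

End Coefficients.

Section FirstFloor.

Variables (K : fieldType) (m n : nat).
Local Notation P := (Defs.even_poly K m n).
Local Notation E := (KGL K m n).
Local Notation KC := (@KGL_const K m n).
Local Notation mapP := (map_mx (@mpolyC _ K)).
Local Notation X1 := (gen1 K m n).
Local Notation X2 := (gen2 K m n).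
Local Notation Y := (Y K m n).
Local Notation theta := (@theta K m n).

Lemma ext_body_theta p : ext_body (theta p) = even_loc_poly p.
Proof.
pose u : {rmorphism P -> even_loc K m n} :=
  (@ext_body (even_loc K m n) #|{: odd_index m n}| : {rmorphism E -> even_loc K m n}) \o theta.
apply: (pair_subst_unique (h := u) (k := @even_loc_poly K m n)) => [c||].
- by rewrite /= thetaC [LHS]ext_constE eqxx.
- apply/matrixP => i j; have := congr1 (fun M : 'M[E]_m => ext_body (M i j)) (theta1 K m n).
  by rewrite [in LHS]mxE => e; rewrite [LHS]mxE [LHS]e mxE [LHS]ext_constE eqxx [RHS]mxE mxE.
- apply/matrixP => i j; have := congr1 (fun M : 'M[E]_n => ext_body (M i j)) (theta2 K m n).
  rewrite [in LHS]mxE => e; rewrite [LHS]mxE [LHS]e /Defs.Phi.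
  rewrite [X in ext_body X]mxE [X in ext_body (_ + X)]mxE rmorphB /=.
  rewrite [X in _ - ext_body X]mxE rmorph_sum /= [X in ext_body X - _]mxE.
  rewrite big1 ?subr0 => [|k _]; last by rewrite rmorphM /= ext_odd_body ?mul0r //; apply: C21_odd.
  by rewrite [LHS]ext_constE eqxx [RHS]mxE mxE.
Qed.

Lemma theta_det1_unit : theta (\det X1) \is a GRing.unit.
Proof. by rewrite -det_map_mx theta1; apply: det_C11_unit. Qed.

Lemma theta_det2_unit : theta (\det X2) \is a GRing.unit.
Proof.
have [x xd] := even_loc_det_inv K m n.
apply: (@ext_unit_body _ _ _ (even_loc_poly (\det X1) * x)).
rewrite [ext_body _]ext_body_theta mulrA -rmorphM /= mulrC [_ * \det X1]mulrC.
by rewrite -xd even_detE.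
Qed.

Definition floor_twist (a b : int) : E := theta (\det X1) ^ a * theta (\det X2) ^ b.

(** The parametrization of the first floor by matrices of polynomials. *)
Definition floor (a b : int) (Q : 'M[P]_(m, n)) : E := floor_twist a b * linear_form theta Y Q.

(** The action transported to matrices of polynomials: [y] transforms by
    [g1^-1 y g2] and the coefficients by translation. *)
Definition floor_act (a b : int) (g1 : 'M[K]_m) (g2 : 'M[K]_n) (Q : 'M[P]_(m, n)) : 'M[P]_(m, n) :=
  (\det g1 ^ a * \det g2 ^ b)%:MP *:
    (mapP (invmx g1)^T *m map_mx (translate g1 g2) Q *m mapP g2^T).

Lemma floorD a b Q Q' : floor a b (Q + Q') = floor a b Q + floor a b Q'.
Proof. by rewrite /floor linear_formD mulrDr. Qed.

Lemma floorZ a b (c : K) Q : floor a b (c%:MP *: Q) = c *: floor a b Q.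
Proof.
have e : linear_form theta Y (c%:MP *: Q) = KC c * linear_form theta Y Q.
  by rewrite linear_formZ; congr (_ * _); apply: thetaC.
by rewrite /floor e KGL_scaleE mulrA [RHS]mulrA KGL_const_central.
Qed.

Section FloorAct.

Variables (g1 : 'M[K]_m) (g2 : 'M[K]_n).
Hypotheses (ug1 : g1 \in unitmx) (ug2 : g2 \in unitmx).
Hypothesis hK : 2%N \notin [pchar K].

Local Notation g := (block_mx g1 0 0 g2).

Let h : {rmorphism E -> E} := HB.pack (act g)
  (GRing.isZmodMorphism.Build _ _ _ (act_is_zmod_morphism ug1 ug2))
  (GRing.isMonoidMorphism.Build _ _ _ (act_is_monoid_morphism ug1 ug2 hK)).

Let theta_expz (z : int) (p : P) (d : K) : d != 0 -> theta p \is a GRing.unit ->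
  translate g1 g2 p = d%:MP * p -> act g (theta p ^ z) = KC (d ^ z) * theta p ^ z.
Proof.
move=> d0 up e.
have hp : h (theta p) = KC d * theta p.
  by rewrite -thetaC -rmorphM -e; apply: act_theta.
have := rmorph_expz_twist (@KGL_const_central K m n d) (KGL_const_unit m n d0) up z hp.
have -> : KC (d ^ z) = KC d ^ z by apply: rmorphXz; rewrite unitfE.
exact.
Qed.

Lemma act_floor a b Q : act g (floor a b Q) = floor a b (floor_act a b g1 g2 Q).
Proof.
have d1 : \det g1 != 0 by rewrite -unitfE -unitmxE.
have d2 : \det g2 != 0 by rewrite -unitfE -unitmxE.
have hM x y : act g (x * y) = act g x * act g y by apply: (rmorphM h).
rewrite /floor_act floorZ /floor KGL_scaleE /floor_twist !hM.
rewrite (theta_expz a d1 theta_det1_unit (translate_det1 _ _)).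
rewrite (theta_expz b d2 theta_det2_unit (translate_det2 _ _)).
have -> : act g (linear_form theta Y Q) =
    linear_form theta Y (mapP (invmx g1)^T *m map_mx (translate g1 g2) Q *m mapP g2^T).
  have := linear_form_mulmx (@theta_central K m n) Y (map_mx (translate g1 g2) Q)
            (mapP (invmx g1)) (mapP g2).
  rewrite (map_theta_const m n (invmx g1)) (map_theta_const m n g2) -(act_Y ug1 ug2 hK).
  rewrite -(map_trmx (@mpolyC _ K) (invmx g1)) -(map_trmx (@mpolyC _ K) g2) => e.
  apply: etrans e.
  rewrite [LHS](rmorph_sum h); apply: eq_bigr => i _.
  rewrite [LHS](rmorph_sum h); apply: eq_bigr => j _.
  rewrite [LHS](rmorphM h); congr (_ * _); last by rewrite [RHS]mxE.
  have -> : map_mx (translate g1 g2) Q i j = translate g1 g2 (Q i j) by rewrite mxE.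
  exact: (act_theta ug1 ug2 hK).
have -> : KC (\det g1 ^ a * \det g2 ^ b) = KC (\det g1 ^ a) * KC (\det g2 ^ b) by apply: rmorphM.
by apply: central_mulACA; apply: KGL_const_central.
Qed.

End FloorAct.

Lemma even_loc_poly_inj : injective (@even_loc_poly K m n).
Proof. by move=> p q /(congr1 (@even_loc_val K m n)) /= /eqP; rewrite tofrac_eq => /eqP. Qed.

Lemma adj_C12_odd i j : ext_parity true ((map_mx theta (\adj X1) *m C12 K m n) i j).
Proof.
rewrite map_mx_adj theta1 mxE; apply: ext_parity_sum => k _; rewrite -[true]addFb.
apply: ext_parityM; last exact: C12_odd.
by rewrite C11E -map_mx_adj mxE; apply: ext_parity_const.
Qed.

Lemma adj_C12_coef i l k j : (map_mx theta (\adj X1) *m C12 K m n) i l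
    [set enum_rank (inl (k, j) : odd_index m n)] =
  if l == j then even_loc_poly ((\adj X1) i k) else 0.
Proof.
have term q : (map_mx theta (\adj X1) i q * C12 K m n q l)
    [set enum_rank (inl (k, j) : odd_index m n)] =
    if (q == k) && (l == j) then even_loc_poly ((\adj X1) i k) else 0.
  rewrite ext_coef1_mul [X in _ + _ * X]ext_odd_body ?mulr0 ?addr0; last exact: C12_odd.
  have -> : map_mx theta (\adj X1) i q set0 = even_loc_poly ((\adj X1) i q).
    by rewrite mxE; apply: ext_body_theta.
  have -> : C12 K m n q l = ext_gen _ (enum_rank (inl (q, l) : odd_index m n)) by rewrite mxE.
  rewrite ffunE (inj_eq set1_inj) (inj_eq enum_rank_inj).
  rewrite -[(inl (k, j) == inl (q, l))]/((k == q) && (j == l)) ![_ == k]eq_sym ![l == j]eq_sym.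
  by case: eqP => [->|_] /=; [case: eqP => _; rewrite ?mulr1 ?mulr0|rewrite mulr0].
rewrite mxE sum_ffunE (bigD1 k) //= big1 => [|q /negPf qk]; first by rewrite addr0 term eqxx.
by rewrite term qk.
Qed.

(** After multiplication by [\det C11] the [y_ij] become linear in the odd
    generators of [C12], with the adjugate as matrix of coefficients. The
    coefficients of the linear odd monomials only see the constant terms, where
    the image of a polynomial [p] is [p] itself. Hence the adjugate annihilates
    [Q], and it is invertible over the fractions. *)
Lemma linear_form_eq0 Q : linear_form theta Y Q = 0 -> Q = 0.
Proof.
move=> Q0.
have {}Q0 : linear_form theta (map_mx theta (\adj X1) *m C12 K m n) Q = 0.
  rewrite map_mx_adj theta1 -det_Y det_C11E.
  have <- : theta (\det X1) = KGL_even (\det X1) by rewrite -det_map_mx theta1 det_C11E.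
  by rewrite (linear_form_scale (@theta_central K m n)) Q0 mulr0.
have QA : Q^T *m \adj X1 = 0.
  apply/matrixP => j k; apply: even_loc_poly_inj.
  rewrite [X in _ = even_loc_poly X]mxE rmorph0 [X in even_loc_poly X]mxE rmorph_sum /=.
  have := congr1 (fun f : E => f [set enum_rank (inl (k, j) : odd_index m n)]) Q0.
  rewrite [RHS]ffunE => {}Q0; rewrite -[RHS]Q0 /linear_form [RHS]sum_ffunE.
  have term i l : (theta (Q i l) * (map_mx theta (\adj X1) *m C12 K m n) i l)
      [set enum_rank (inl (k, j) : odd_index m n)] =
      if l == j then even_loc_poly (Q i l) * even_loc_poly ((\adj X1) i k) else 0.
    rewrite ext_coef1_mul adj_C12_coef [X in _ + _ * X]ext_odd_body ?mulr0 ?addr0; last first.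
      exact: adj_C12_odd.
    by rewrite [theta _ set0]ext_body_theta; case: eqP => _; rewrite ?mulr0.
  apply: eq_bigr => i _; rewrite sum_ffunE (bigD1 j) //= big1 => [|l /negPf lj].
    by rewrite addr0 term eqxx -rmorphM [X in X * _]mxE.
  by rewrite term lj.
have : Q^T *m (\adj X1 *m X1) = 0 by rewrite mulmxA QA mul0mx.
rewrite mul_adj_mx => /matrixP Q1; apply/matrixP => i j.
have := Q1 j i; rewrite mul_mx_scalar !mxE => /eqP; rewrite mulf_eq0 => /orP[|/eqP //].
have := even_det_neq0 K m n; rewrite even_detE mulf_eq0 negb_or => /andP[/negPf -> _].
by [].
Qed.

Lemma floor_inj a b : injective (floor a b).
Proof.
move=> Q Q' e; apply/eqP; rewrite -subr_eq0; apply/eqP/linear_form_eq0.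
have u : floor_twist a b \is a GRing.unit.
  by apply: unitr_mul; apply: unit_expz; [apply: theta_det1_unit|apply: theta_det2_unit].
have e0 : floor a b (Q - Q') = 0.
  by rewrite -scaleN1r -[-1]/(- 1%:MP) -rmorphN floorD floorZ e scaleN1r subrr.
by apply: (mulrI u); rewrite mulr0.
Qed.

End FirstFloor.

(** * Linear spans *)

Section LinearSpan.

Variables (K : fieldType) (V : lmodType K).
Implicit Types X : V -> Prop.

Definition lin_span X (w : V) : Prop :=
  exists s : seq (K * V), (forall p, p \in s -> X p.2) /\ w = \sum_(p <- s) p.1 *: p.2.

Lemma lin_span_subspace X : subspace (lin_span X).
Proof.
split=> [|a x y [s [Xs ->]] [t [Xt ->]]]; first by exists [::]; rewrite big_nil.
exists ([seq (a * c.1, c.2) | c <- s] ++ t); split.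
  by move=> p; rewrite mem_cat => /orP[/mapP[c cs ->]|/Xt //]; apply: (Xs c).
rewrite big_cat big_map scaler_sumr; congr (_ + _).
by apply: eq_bigr => c _; rewrite scalerA.
Qed.

Lemma lin_span_gen X x : X x -> lin_span X x.
Proof.
by move=> Xx; exists [:: (1, x)]; split; [move=> p; rewrite inE => /eqP ->|rewrite big_seq1 scale1r].
Qed.

Lemma lin_span_min X L : subspace L -> (forall x, X x -> L x) -> forall x, lin_span X x -> L x.
Proof.
move=> sL XL _ [s [Xs ->]]; elim: s Xs => [|c s IH] Xs; first by rewrite big_nil; case: sL.
rewrite big_cons; apply: subspaceD => //.
  by apply: subspaceZ => //; apply: XL; apply: Xs; rewrite mem_head.
by apply: IH => p ps; apply: Xs; rewrite inE ps orbT.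
Qed.

End LinearSpan.

Lemma lin_spanM (K : fieldType) (A : algType K) (X Y Z : A -> Prop) :
    (forall x y, X x -> Y y -> Z (x * y)) ->
  forall x y, lin_span X x -> lin_span Y y -> lin_span Z (x * y).
Proof.
move=> XYZ x y sx sy; have sZ := lin_span_subspace Z.
apply: (@lin_span_min _ _ X (fun x => lin_span Z (x * y)) _ _ x sx) => [|{sx}x Xx].
  split=> [|a u v Lu Lv]; first by rewrite mul0r; case: sZ.
  by rewrite mulrDl -scalerAl; case: sZ => _; apply.
apply: (@lin_span_min _ _ Y (fun y => lin_span Z (x * y)) _ _ y sy) => [|{sy}y Yy].
  split=> [|a u v Lu Lv]; first by rewrite mulr0; case: sZ.
  by rewrite mulrDr -scalerAr; case: sZ => _; apply.
by apply: lin_span_gen; apply: XYZ.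
Qed.

(** * Products of minors *)

Section MinorProducts.

Variables (K : fieldType) (A : comAlgType K) (p : nat) (M : 'M[A]_p).

Definition minor_prod (N : nat) (sz : nat -> nat) (w : A) : Prop :=
  exists2 T : nat -> seq 'I_p, (forall q, (q < N)%N -> size (T q) = sz q)
    & w = \prod_(q < N) minor_on M (T q).

Lemma minor_prod_span N sz (x : nat -> A) :
    (forall q, (q < N)%N -> lin_span (fun w => exists2 s, size s = sz q & w = minor_on M s) (x q)) ->
  lin_span (minor_prod N sz) (\prod_(q < N) x q).
Proof.
elim: N => [_|N IH xN].
  rewrite big_ord0; apply: lin_span_gen; exists (fun=> [::]) => //.
  by rewrite big_ord0.
rewrite big_ord_recr /=; apply: lin_spanM (IH _) (xN N (ltnSn N)); last first.
  by move=> q qN; apply: xN; apply: ltnW.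
move=> _ _ [T szT ->] [s szs ->]; exists (fun q => if q == N then s else T q).
  move=> q; rewrite ltnS leq_eqVlt; case: eqVneq => [-> //|_] /=; exact: szT.
rewrite big_ord_recr /= eqxx; congr (_ * _); apply: eq_bigr => q _.
by rewrite ltn_eqF.
Qed.

End MinorProducts.

Section WeightSpace.

Variables (K : fieldType) (m n : nat) (lp : m.-tuple int) (lm : n.-tuple int).
Local Notation P := (Defs.even_poly K m n).
Local Notation X1 := (gen1 K m n).
Local Notation X2 := (gen2 K m n).

(** The polynomial counterpart of the induced module: products of minors shaped
    by the two diagrams, without the powers of the determinants. *)
Definition weight_gen (w : P) : Prop :=
  exists u v, [/\ minor_prod X1 (ncols lp) (col_length lp) u,
                  minor_prod X2 (ncols lm) (col_length lm) v & w = u * v].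

Definition weight_space : P -> Prop := lin_span weight_gen.

Lemma weight_space_subspace : subspace weight_space.
Proof. exact: lin_span_subspace. Qed.

Lemma weight_spaceM u v :
    lin_span (minor_prod X1 (ncols lp) (col_length lp)) u ->
    lin_span (minor_prod X2 (ncols lm) (col_length lm)) v ->
  weight_space (u * v).
Proof. by apply: lin_spanM => x y Xx Yy; exists x, y. Qed.

Lemma minor_span_mulR p (M : 'M[P]_p) (g : 'M[K]_p) s : (size s <= p)%N ->
  lin_span (fun w => exists2 t, size t = size s & w = minor_on M t)
           (minor_on (M *m map_mx (@mpolyC _ K) g) s).
Proof.
move=> sp; rewrite minor_on_mulR //; apply: subspace_sum; first exact: lin_span_subspace.
move=> t _.
under eq_bigr do rewrite mxE.
rewrite -(rmorph_prod (@mpolyC _ K)) mul_mpolyC; apply: subspaceZ; first exact: lin_span_subspace.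
apply: lin_span_gen; exists (codom t) => //.
by rewrite size_codom card_ord.
Qed.

Lemma translate_weight_space g1 g2 w : weight_space w -> weight_space (translate g1 g2 w).
Proof.
apply: (lin_span_min (L := fun w => weight_space (translate g1 g2 w))).
  have [w0 wD] := weight_space_subspace.
  split=> [|a x y Lx Ly]; first by rewrite rmorph0.
  by rewrite rmorphD /= translateZ; apply: wD.
move=> _ [_ [_ [[T szT ->] [U szU ->] ->]]]; rewrite rmorphM !rmorph_prod /=.
apply: weight_spaceM.
  apply: (minor_prod_span (x := fun q => translate g1 g2 (minor_on X1 (T q)))) => q qN.
  rewrite -map_minor_on translate1 -(szT q qN).
  by apply: minor_span_mulR; rewrite szT // (leq_trans (col_length_le _ _)) // size_tuple.
apply: (minor_prod_span (x := fun q => translate g1 g2 (minor_on X2 (U q)))) => q qN.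
rewrite -map_minor_on translate2 -(szU q qN).
by apply: minor_span_mulR; rewrite szU // (leq_trans (col_length_le _ _)) // size_tuple.
Qed.

(** The rows of [b] respect the flag of initial row segments whose lengths are
    column lengths of the diagram. *)
Definition keeps_rows p (l : seq int) (b : 'M[K]_p) : Prop :=
  forall q, (q < ncols l)%N -> forall i j : 'I_p, (i < col_length l q <= j)%N -> b i j = 0.

Definition left_char p (l : seq int) (b : 'M[K]_p) : K :=
  \prod_(q < ncols l) minor_on b (firsts p (col_length l q)).

Lemma minor_on_left_char p (l : p.-tuple int) (b x : 'M[K]_p) (T : nat -> seq 'I_p) :
    keeps_rows l b -> (forall q, (q < ncols l)%N -> size (T q) = col_length l q) ->
  \prod_(q < ncols l) minor_on (b *m x) (T q) =
  left_char l b * \prod_(q < ncols l) minor_on x (T q).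
Proof.
move=> kb szT; rewrite -big_split; apply: eq_bigr => q _ /=.
have lek : (col_length l q <= p)%N by rewrite (leq_trans (col_length_le _ _)) // size_tuple.
by rewrite (minor_on_mulL _ lek) ?szT // ?minor_on_firsts //; apply: kb.
Qed.

(** Left equivariance of the induced module. If two parts of the weight coincide,
    no column has the intermediate length, and the equivariance extends from the
    lower triangular Borel to a parabolic subgroup. *)
Lemma weight_space_left b1 b2 w x1 x2 :
    keeps_rows lp b1 -> keeps_rows lm b2 -> weight_space w ->
  point_eval (b1 *m x1) (b2 *m x2) w =
  left_char lp b1 * left_char lm b2 * point_eval x1 x2 w.
Proof.
move=> k1 k2; apply: (lin_span_min (L := fun w => point_eval (b1 *m x1) (b2 *m x2) w =
  left_char lp b1 * left_char lm b2 * point_eval x1 x2 w)).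
  split=> [|a u v Lu Lv]; first by rewrite !rmorph0 mulr0.
  by rewrite !rmorphD /= !point_evalZ Lu Lv mulrDr mulrCA.
move=> _ [_ [_ [[T szT ->] [U szU ->] ->]]]; rewrite !rmorphM !rmorph_prod /=.
under eq_bigr do rewrite -map_minor_on point_eval1.
under [X in _ * X = _]eq_bigr do rewrite -map_minor_on point_eval2.
rewrite !minor_on_left_char // mulrACA; congr (_ * (_ * _)); apply: eq_bigr => q _.
  by rewrite -map_minor_on point_eval1.
by rewrite -map_minor_on point_eval2.
Qed.

End WeightSpace.

Lemma invmx_mulmx (R : comUnitRingType) k (A B : 'M[R]_k) :
  A \in unitmx -> B \in unitmx -> invmx (A *m B) = invmx B *m invmx A.
Proof.
move=> uA uB; have uAB : A *m B \in unitmx by rewrite unitmx_mul uA.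
by apply: (can_inj (mulKmx uAB)); rewrite mulmxV // mulmxA mulmxK // mulmxV.
Qed.

(** * The floor as a space of matrices of polynomials *)

Section FloorSpace.

Variables (K : fieldType) (m n : nat).
Local Notation P := (Defs.even_poly K m n).

(** An alias, because matrices of polynomials already carry a module structure
    over the polynomials and this one is over the base field. *)
Definition floor_space := 'M[P]_(m, n).

HB.instance Definition _ := GRing.Zmodule.copy floor_space 'M[P]_(m, n).

Definition floor_scale (c : K) (Q : floor_space) : floor_space := \matrix_(i, j) (c *: Q i j).

Fact floor_scaleA a b Q : floor_scale a (floor_scale b Q) = floor_scale (a * b) Q.
Proof. by apply/matrixP => i j; rewrite !mxE scalerA. Qed.
Fact floor_scale1 : left_id 1 floor_scale.
Proof. by move=> Q; apply/matrixP => i j; rewrite !mxE scale1r. Qed.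
Fact floor_scaleDr : right_distributive floor_scale +%R.
Proof. by move=> a Q Q'; apply/matrixP => i j; rewrite !mxE scalerDr. Qed.
Fact floor_scaleDl Q : {morph floor_scale^~ Q : a b / a + b}.
Proof. by move=> a b; apply/matrixP => i j; rewrite !mxE scalerDl. Qed.
HB.instance Definition _ := GRing.Zmodule_isLmodule.Build K floor_space
  floor_scaleA floor_scale1 floor_scaleDr floor_scaleDl.

Implicit Types Q : floor_space.

Lemma floor_scale_entry (c : K) Q i j : (c *: Q) i j = c *: Q i j.
Proof. by rewrite [LHS]mxE. Qed.

Lemma floor_add_entry Q Q' i j : (Q + Q') i j = Q i j + Q' i j.
Proof. by rewrite [LHS]mxE. Qed.

Lemma floor_opp_entry Q i j : (- Q) i j = - Q i j.
Proof. by rewrite [LHS]mxE. Qed.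

Lemma floor_zero_entry i j : (0 : floor_space) i j = 0.
Proof. by rewrite [LHS]mxE. Qed.

Lemma floor_sum_entry (I : Type) (r : seq I) (S : pred I) (F : I -> floor_space) i j :
  (\sum_(k <- r | S k) F k) i j = \sum_(k <- r | S k) F k i j.
Proof.
by elim/big_rec2: _ => [|k x y _ <-]; rewrite ?floor_zero_entry ?floor_add_entry.
Qed.

Lemma floor_spaceP Q Q' : (forall i j, Q i j = Q' i j) -> Q = Q'.
Proof. by move=> e; apply/matrixP. Qed.

End FloorSpace.

HB.lock Definition floor_rep (K : fieldType) (m n : nat) (a b : int)
  (g1 : 'M[K]_m) (g2 : 'M[K]_n) (Q : floor_space K m n) : floor_space K m n :=
  floor_act a b g1 g2 Q.

Section FloorRepresentation.

Variables (K : fieldType) (m n : nat) (a b : int).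
Local Notation P := (Defs.even_poly K m n).
Local Notation mapP := (map_mx (@mpolyC #|{: even_index m n}| K)).
Local Notation floor_space := (floor_space K m n).
Local Notation fact_ := (@floor_rep K m n a b).
Implicit Types Q : floor_space.

Definition det_char (g1 : 'M[K]_m) (g2 : 'M[K]_n) : K := \det g1 ^ a * \det g2 ^ b.

Lemma floor_act_entry g1 g2 Q i j : fact_ g1 g2 Q i j =
  \sum_k \sum_l (det_char g1 g2 * (invmx g1 k i * g2 j l)) *: translate g1 g2 (Q k l).
Proof.
rewrite floor_rep.unlock mxE mxE mulr_sumr exchange_big; apply: eq_bigr => l _ /=.
rewrite !mxE mulr_suml mulr_sumr; apply: eq_bigr => k _.
rewrite !mxE -!mul_mpolyC /det_char !mpolyCM -!mulrA.
by congr (_ * (_ * (_ * _))); rewrite mulrC.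
Qed.

Lemma floor_act_linear g1 g2 c Q Q' :
  fact_ g1 g2 (c *: Q + Q') = c *: fact_ g1 g2 Q + fact_ g1 g2 Q'.
Proof.
apply: floor_spaceP => i j; rewrite floor_add_entry floor_scale_entry !floor_act_entry.
rewrite scaler_sumr -big_split; apply: eq_bigr => k _ /=.
rewrite scaler_sumr -big_split; apply: eq_bigr => l _ /=.
rewrite floor_add_entry floor_scale_entry rmorphD /= translateZ scalerDr !scalerA.
by congr (_ *: _ + _); rewrite mulrC.
Qed.

Lemma floor_act_comp g1 g2 h1 h2 Q : g1 \in unitmx -> h1 \in unitmx ->
  g2 \in unitmx -> h2 \in unitmx ->
  fact_ g1 g2 (fact_ h1 h2 Q) = fact_ (g1 *m h1) (g2 *m h2) Q.
Proof.
move=> ug1 uh1 ug2 uh2; rewrite floor_rep.unlock /floor_act map_mxZ /= translateC !map_mxM !map_translate_const.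
rewrite -!scalemxAr -!scalemxAl scalerA -mpolyCM; congr (_%:MP *: _).
  rewrite !det_mulmx !expfzMl; rewrite mulrACA; congr (_ * _).
have -> : map_mx (translate g1 g2) (map_mx (translate h1 h2) Q) =
          map_mx (translate (g1 *m h1) (g2 *m h2)) Q.
  by apply/matrixP => i j; rewrite mxE [X in translate _ _ X]mxE [RHS]mxE translateM.
have -> : mapP (g2 *m h2)^T = mapP h2^T *m mapP g2^T by rewrite trmx_mul (map_mxM (@mpolyC #|{: even_index m n}| K)).
have -> : mapP (invmx (g1 *m h1))^T = mapP (invmx g1)^T *m mapP (invmx h1)^T.
  by rewrite invmx_mulmx // trmx_mul (map_mxM (@mpolyC #|{: even_index m n}| K)).
by rewrite !mulmxA.
Qed.

Lemma floor_act1 Q : fact_ 1%:M 1%:M Q = Q.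
Proof.
rewrite floor_rep.unlock /floor_act !det1 !exp1rz mulr1 mpolyC1 scale1r invmx1 !trmx1 !map_mx1 mul1mx mulmx1.
by apply/matrixP => i j; rewrite mxE translate_id.
Qed.

(** ** Evaluation *)

Definition floor_eval (x1 : 'M[K]_m) (x2 : 'M[K]_n) (Q : floor_space) : 'M[K]_(m, n) :=
  map_mx (point_eval x1 x2) Q.

Lemma floor_eval_act x1 x2 g1 g2 Q : floor_eval x1 x2 (fact_ g1 g2 Q) =
  det_char g1 g2 *: ((invmx g1)^T *m floor_eval (x1 *m g1) (x2 *m g2) Q *m g2^T).
Proof.
rewrite /floor_eval floor_rep.unlock /floor_act map_mxZ /= point_evalC !map_mxM !map_point_eval_const.
congr (_ *: (_ *m _ *m _)).
by apply/matrixP => i j; rewrite !mxE /= point_eval_translate.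
Qed.

Lemma floor_eval_linear x1 x2 c Q Q' :
  floor_eval x1 x2 (c *: Q + Q') = c *: floor_eval x1 x2 Q + floor_eval x1 x2 Q'.
Proof.
have e R i j : floor_eval x1 x2 R i j = point_eval x1 x2 (R i j) by rewrite mxE.
apply/matrixP => i j; rewrite [RHS]mxE [X in _ = X + _]mxE !e.
by rewrite floor_add_entry floor_scale_entry rmorphD /= point_evalZ.
Qed.

(** ** The contravariant form *)

(** Contravariance comes from the apolar form on the entries: translations by
    transposed matrices are adjoint, and so are the constant matrices that
    multiply [Q] on both sides. *)
Definition floor_form Q Q' : K := \sum_i \sum_j apolar (Q i j) (Q' i j).

Lemma floor_formC Q Q' : floor_form Q Q' = floor_form Q' Q.
Proof. by apply: eq_bigr => i _; apply: eq_bigr => j _; rewrite apolarC. Qed.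

Lemma floor_form_linear c Q1 Q2 Q : floor_form (c *: Q1 + Q2) Q = c * floor_form Q1 Q + floor_form Q2 Q.
Proof.
rewrite mulr_sumr -big_split; apply: eq_bigr => i _ /=.
rewrite mulr_sumr -big_split; apply: eq_bigr => j _ /=.
by rewrite floor_add_entry floor_scale_entry apolarDl apolarZl.
Qed.

(** The matrix by which a translation acts on the span of the variables. *)
Definition translate_mx (g1 : 'M[K]_m) (g2 : 'M[K]_n) : 'M[K]_#|{: even_index m n}| :=
  \matrix_(e, f) match enum_val e, enum_val f with
                 | inl p, inl q => (p.1 == q.1)%:R * g1 q.2 p.2
                 | inr p, inr q => (p.1 == q.1)%:R * g2 q.2 p.2
                 | _, _ => 0
                 end.

Lemma translate_mx_tr g1 g2 : (translate_mx g1 g2)^T = translate_mx g1^T g2^T.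
Proof.
apply/matrixP => e f; rewrite !mxE.
by case: (enum_val e) => p; case: (enum_val f) => q //; rewrite eq_sym !mxE.
Qed.

Lemma translate_linear_subst g1 g2 : translate g1 g2 =1 linear_subst (translate_mx g1 g2).
Proof.
apply: (pair_subst_unique (h := translate g1 g2) (k := linear_subst (translate_mx g1 g2))).
- by move=> c /=; rewrite translateC linear_substC.
- rewrite translate1; apply/matrixP => i j; rewrite mxE [RHS]mxE [X in _ = _ X]mxE.
  rewrite [RHS]linear_substX (reindex _ (onW_bij _ (enum_rank_bij (even_index m n)))) /=.
  rewrite big_sumType /= [X in _ = _ + X]big1 ?addr0; last first.
    by move=> q _; rewrite mxE !enum_rankK scale0r.
  transitivity (\sum_a' \sum_b' translate_mx g1 g2 (enum_rank (inl (i, j) : even_index m n))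
      (enum_rank (inl (a', b') : even_index m n)) *:
      ('X_(enum_rank (inl (a', b') : even_index m n)) : P)); last first.
    by rewrite pair_bigA /=; apply: eq_bigr => -[].
  rewrite [RHS](bigD1 i) //= [X in _ = _ + X]big1 ?addr0 => [|a' ai]; last first.
    by rewrite big1 // => b' _; rewrite mxE !enum_rankK /= eq_sym (negPf ai) mul0r scale0r.
  apply: eq_bigr => k _; rewrite !mxE !enum_rankK /= eqxx mul1r mulrC mul_mpolyC.
  by [].
- rewrite translate2; apply/matrixP => i j; rewrite mxE [RHS]mxE [X in _ = _ X]mxE.
  rewrite [RHS]linear_substX (reindex _ (onW_bij _ (enum_rank_bij (even_index m n)))) /=.
  rewrite big_sumType /= [X in _ = X + _]big1 ?add0r; last first.
    by move=> q _; rewrite mxE !enum_rankK scale0r.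
  transitivity (\sum_a' \sum_b' translate_mx g1 g2 (enum_rank (inr (i, j) : even_index m n))
      (enum_rank (inr (a', b') : even_index m n)) *:
      ('X_(enum_rank (inr (a', b') : even_index m n)) : P)); last first.
    by rewrite pair_bigA /=; apply: eq_bigr => -[].
  rewrite [RHS](bigD1 i) //= [X in _ = _ + X]big1 ?addr0 => [|a' ai]; last first.
    by rewrite big1 // => b' _; rewrite mxE !enum_rankK /= eq_sym (negPf ai) mul0r scale0r.
  apply: eq_bigr => k _; rewrite !mxE !enum_rankK /= eqxx mul1r mulrC mul_mpolyC.
  by [].
Qed.

Lemma apolar_translate g1 g2 (p q : P) :
  apolar (translate g1 g2 p) q = apolar p (translate g1^T g2^T q).
Proof. by rewrite !translate_linear_subst apolar_linear_subst translate_mx_tr. Qed.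

Lemma floor_form_act g1 g2 Q Q' :
  floor_form (fact_ g1 g2 Q) Q' = floor_form Q (fact_ g1^T g2^T Q').
Proof.
transitivity (\sum_i \sum_j \sum_k \sum_l
   det_char g1 g2 * (invmx g1 k i * g2 j l) * apolar (Q k l) (translate g1^T g2^T (Q' i j))).
  apply: eq_bigr => i _; apply: eq_bigr => j _; rewrite floor_act_entry apolar_suml.
  apply: eq_bigr => k _; rewrite apolar_suml; apply: eq_bigr => l _.
  by rewrite apolarZl apolar_translate.
transitivity (\sum_k \sum_l \sum_i \sum_j
   det_char g1 g2 * (invmx g1 k i * g2 j l) * apolar (Q k l) (translate g1^T g2^T (Q' i j))).
  under eq_bigr => i _ do rewrite exchange_big /=.
  rewrite exchange_big; apply: eq_bigr => k _ /=.
  under eq_bigr => i _ do rewrite exchange_big /=.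
  by rewrite exchange_big.
apply: eq_bigr => k _; apply: eq_bigr => l _; rewrite floor_act_entry apolar_sumr.
apply: eq_bigr => i _; rewrite apolar_sumr; apply: eq_bigr => j _.
by rewrite apolarZr /det_char !det_tr -trmx_inv !mxE.
Qed.

End FloorRepresentation.

Lemma upper_trig (R : pzSemiRingType) p (g : 'M[R]_p) : is_trig_mx g^T ->
  forall a b : 'I_p, (b < a)%N -> g a b = 0.
Proof. by move=> /is_trig_mxP t a b ba; have := t b a ba; rewrite mxE. Qed.

Lemma upper_trig_minor (R : comPzRingType) p (g : 'M[R]_p) k (lekp : (k <= p)%N) : is_trig_mx g^T ->
  minor_on g (firsts p k) = \prod_(i < k) g (widen_ord lekp i) (widen_ord lekp i).
Proof.
move=> tg; rewrite (minor_on_firsts _ lekp) -det_tr det_trig; last first.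
  by apply/is_trig_mxP => a b ab; rewrite !mxE (upper_trig tg).
by apply: eq_bigr => i _; rewrite !mxE.
Qed.

Lemma unitri_minor (R : comPzRingType) p (u : 'M[R]_p) k : (k <= p)%N -> upper_unitri u ->
  minor_on u (firsts p k) = 1.
Proof. by move=> lekp [tu du]; rewrite (upper_trig_minor lekp) // big1. Qed.

Lemma unitri_unit (K : fieldType) p (u : 'M[K]_p) : upper_unitri u -> u \in unitmx.
Proof.
by move=> uu; rewrite unitmxE -minor_on_all (unitri_minor (leqnn p)) // unitr1.
Qed.

Lemma unitri_det (R : comPzRingType) p (u : 'M[R]_p) : upper_unitri u -> \det u = 1.
Proof. by move=> uu; rewrite -minor_on_all (unitri_minor (leqnn p)). Qed.

(** * The primitive vectors *)

Section PrimitiveVectors.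

Variables (K : fieldType) (m n : nat) (lp : m.-tuple int) (lm : n.-tuple int).
Hypotheses (dlp : dominant lp) (dlm : dominant lm).
Local Notation P := (Defs.even_poly K m n).
Local Notation X1 := (gen1 K m n).
Local Notation X2 := (gen2 K m n).
Local Notation mapP := (map_mx (@mpolyC #|{: even_index m n}| K)).

(** With [good_col], the condition for [pi_ij] to lie in the first floor: the
    diagram has a column of length [i.+1], or [i] is the last row, where the
    invertible determinant takes the place of such a column. *)
Definition good_row (i : 'I_m) : bool := (i.+1 == m) || (lp`_i != lp`_i.+1).
Definition good_col (j : 'I_n) : bool := (0 < j)%N ==> (lm`_j.-1 != lm`_j).

(** The highest weight vector without the power of the determinant and without
    one column of length [i.+1]. *)
Definition lead1 (R : pzRingType) (A : 'M[R]_m) (i : 'I_m) : R :=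
  \prod_(a < m.-1) minor_on A (firsts m a.+1) ^+ (excess lp a - excess lp a.+1 - (val a == i)).

(** The highest weight vector without the power of the determinant and without
    one column of length [j]. *)
Definition lead2 (R : pzRingType) (A : 'M[R]_n) (j : 'I_n) : R :=
  \prod_(b < n.-1) minor_on A (firsts n b.+1) ^+ (excess lm b - excess lm b.+1 - (b.+1 == j)).

(** For the last row the minors are multiples of the determinant, which is
    divided out. *)
Definition row_part (R : pzRingType) (A : 'M[R]_m) (i r : 'I_m) : R :=
  if i.+1 == m then (r == i)%:R else row_minor A i r.

(** The coefficients of [pi_ij]: a matrix of rank one. For upper triangular [g1]
    and [g2], and up to scalars, [row_part] transforms by the transpose of [g1]
    and [col_minor] by the inverse of [g2]. *)
Definition pi_poly (i : 'I_m) (j : 'I_n) : floor_space K m n :=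
  \matrix_(r, s) (lead1 X1 i * lead2 X2 j * row_part X1 i r * col_minor X2 j s).

Lemma prod_firsts_mulR (R : comPzRingType) p N (e : nat -> nat) (A U : 'M[R]_p) : (N <= p)%N ->
    is_trig_mx U^T ->
  \prod_(a < N) minor_on (A *m U) (firsts p a.+1) ^+ e a =
  (\prod_(a < N) minor_on A (firsts p a.+1) ^+ e a) * \prod_(a < N) minor_on U (firsts p a.+1) ^+ e a.
Proof.
move=> Np tU; rewrite -big_split; apply: eq_bigr => a _ /=.
have ap : (a.+1 <= p)%N by apply: leq_trans Np.
rewrite (minor_on_firsts_mulR _ ap) -?(minor_on_firsts _ ap) ?exprMn //.
by move=> x y /andP[yx xa]; apply: (upper_trig tU); apply: leq_trans xa.
Qed.

Lemma lead1_mulR (R : comPzRingType) (A U : 'M[R]_m) i : is_trig_mx U^T ->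
  lead1 (A *m U) i = lead1 A i * lead1 U i.
Proof.
by apply: (prod_firsts_mulR (fun a => excess lp a - excess lp a.+1 - (a == i))%N); apply: leq_pred.
Qed.

Lemma lead2_mulR (R : comPzRingType) (A U : 'M[R]_n) j : is_trig_mx U^T ->
  lead2 (A *m U) j = lead2 A j * lead2 U j.
Proof.
by apply: (prod_firsts_mulR (fun b => excess lm b - excess lm b.+1 - (b.+1 == j))%N); apply: leq_pred.
Qed.

Lemma map_lead1 (R S : pzRingType) (f : {rmorphism R -> S}) A i : f (lead1 A i) = lead1 (map_mx f A) i.
Proof.
by rewrite rmorph_prod; apply: eq_bigr => a _; rewrite rmorphXn /= -map_minor_on.
Qed.

Lemma map_lead2 (R S : pzRingType) (f : {rmorphism R -> S}) A j : f (lead2 A j) = lead2 (map_mx f A) j.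
Proof.
by rewrite rmorph_prod; apply: eq_bigr => b _; rewrite rmorphXn /= -map_minor_on.
Qed.

Lemma map_row_part (R S : pzRingType) (f : {rmorphism R -> S}) A i r :
  f (row_part A i r) = row_part (map_mx f A) i r.
Proof. by rewrite /row_part; case: ifP => _; rewrite ?rmorph_nat // -map_minor_on. Qed.

Lemma map_col_minor (R S : pzRingType) (f : {rmorphism R -> S}) (A : 'M[R]_n) j s :
  f (col_minor A j s) = col_minor (map_mx f A) j s :> S.
Proof.
rewrite /col_minor; case: ifP => _; last exact: rmorph0.
by rewrite rmorphM rmorph_sign map_minor_on.
Qed.

Definition row_char (g : 'M[K]_m) (i : 'I_m) : K :=
  if i.+1 == m then (g i i)^-1 else minor_on g (firsts m i).

Lemma row_part_mulR (g : 'M[K]_m) i r : g \in unitmx -> is_trig_mx g^T ->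
  row_part (X1 *m mapP g) i r = (row_char g i)%:MP * \sum_k row_part X1 i k * (g k r)%:MP.
Proof.
move=> ug tg; rewrite /row_part /row_char; case: ifP => [/eqP im|_]; last first.
  rewrite row_minor_mulR => [|x y yx]; last by rewrite mxE (upper_trig tg) // mpolyC0.
  rewrite map_minor_on; congr (_ * _); apply: eq_bigr => k _.
  by rewrite mxE.
rewrite (bigD1 i) //= eqxx mul1r big1 ?addr0 => [|k /negPf ki]; last by rewrite ki mul0r.
have [->|ri] := eqVneq r i.
  have gii : g i i != 0.
    move: ug; rewrite unitmxE -det_tr det_trig // unitfE => /prodf_neq0/(_ i isT).
    by rewrite mxE.
  by rewrite -mpolyCM mulVf // mpolyC1.
rewrite (@upper_trig _ _ _ tg i r) ?mpolyC0 ?mulr0 //.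
by move: ri; rewrite -val_eqE /= neq_ltn => /orP[//|ir]; move: (ltn_ord r); lia.
Qed.

Lemma floor_sum_factor (N : nat) (c : K) (x : 'I_m -> K) (y : 'I_n -> K) (L : {mpoly K[N]}) a b :
  \sum_k \sum_l (c * (x k * y l)) *: (L * a k * b l) =
  c *: (L * (\sum_k x k *: a k) * (\sum_l y l *: b l)).
Proof.
rewrite [L * _]mulr_sumr mulr_suml scaler_sumr; apply: eq_bigr => k _.
rewrite mulr_sumr scaler_sumr; apply: eq_bigr => l _.
rewrite -!scalerAr -!scalerAl !scalerA; congr (_ *: _).
by rewrite -!mulrA; congr (_ * _); rewrite mulrC.
Qed.

Definition pi_char a b (g1 : 'M[K]_m) (g2 : 'M[K]_n) i j : K :=
  det_char a b g1 g2 * (lead1 g1 i * lead2 g2 j * row_char g1 i * minor_on g2 (firsts n j.+1)).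

(** The constant matrices in the action cancel the transformations of the two
    vectors whose product is [pi_poly]. *)
Lemma pi_poly_borel a b g1 g2 i j : g1 \in unitmx -> is_trig_mx g1^T -> is_trig_mx g2^T ->
  floor_rep a b g1 g2 (pi_poly i j) = pi_char a b g1 g2 i j *: pi_poly i j.
Proof.
move=> ug1 tg1 tg2; apply: floor_spaceP => r s.
rewrite floor_act_entry floor_scale_entry [pi_poly i j r s]mxE.
have tmapP k (g : 'M[K]_k) : is_trig_mx g^T -> is_trig_mx (mapP g)^T.
  by move=> tg; apply/is_trig_mxP => x y xy; rewrite !mxE (upper_trig tg) // mpolyC0.
pose L := lead1 X1 i * lead2 X2 j.
pose c0 := lead1 g1 i * lead2 g2 j * row_char g1 i.
have trE k l : translate g1 g2 (pi_poly i j k l) =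
    (c0 *: L) * (\sum_q g1 q k *: row_part X1 i q) * col_minor (X2 *m mapP g2) j l.
  rewrite mxE !rmorphM /= map_lead1 map_lead2 map_row_part map_col_minor translate1 translate2.
  rewrite lead1_mulR ?lead2_mulR ?tmapP // row_part_mulR //; congr (_ * _).
  have -> : lead1 (mapP g1) i = (lead1 g1 i)%:MP by rewrite -map_lead1.
  have -> : lead2 (mapP g2) j = (lead2 g2 j)%:MP by rewrite -map_lead2.
  have -> : \sum_q row_part X1 i q * (g1 q k)%:MP = \sum_q g1 q k *: row_part X1 i q.
    by apply: eq_bigr => q _; rewrite mulrC mul_mpolyC.
  rewrite mulrA; congr (_ * _); rewrite /L /c0 -mul_mpolyC !mpolyCM.
  ring.
under eq_bigr => k _ do under eq_bigr => l _ do rewrite trE.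
rewrite floor_sum_factor.
have -> : \sum_k invmx g1 k r *: \sum_q g1 q k *: row_part X1 i q = row_part X1 i r.
  transitivity (\sum_q (\sum_k g1 q k * invmx g1 k r) *: row_part X1 i q).
    under eq_bigr => k _ do rewrite scaler_sumr.
    rewrite exchange_big; apply: eq_bigr => q _; rewrite scaler_suml /=.
    by apply: eq_bigr => k _; rewrite scalerA mulrC.
  rewrite (bigD1 r) //= [X in _ + X]big1 ?addr0 => [|q qr].
    by have /matrixP/(_ r r) := mulmxV ug1; rewrite !mxE eqxx => ->; rewrite scale1r.
  by have /matrixP/(_ q r) := mulmxV ug1; rewrite !mxE (negPf qr) => ->; rewrite scale0r.
have -> : \sum_l g2 s l *: col_minor (X2 *m mapP g2) j l =
    minor_on g2 (firsts n j.+1) *: col_minor X2 j s.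
  rewrite -[RHS]mul_mpolyC -map_minor_on -col_minor_mulR.
    by apply: eq_bigr => l _; rewrite mxE mul_mpolyC.
  by move=> x y yx; rewrite mxE (upper_trig tg2) // mpolyC0.
rewrite /pi_char -/c0 -scalerA; congr (_ *: _).
by rewrite -!scalerAl -scalerAr scalerA mulrC.
Qed.

Lemma pi_poly_unitri a b u1 u2 i j : upper_unitri u1 -> upper_unitri u2 ->
  floor_rep a b u1 u2 (pi_poly i j) = pi_poly i j.
Proof.
move=> uu1 uu2; rewrite pi_poly_borel ?unitri_unit //; try by [case: uu1|case: uu2].
suff -> : pi_char a b u1 u2 i j = 1 by rewrite scale1r.
rewrite /pi_char /det_char !unitri_det // !exp1rz /lead1 /lead2 /row_char !big1.
- rewrite !mul1r [minor_on u2 _]unitri_minor // mulr1; case: ifP => _; last by rewrite unitri_minor // ltnW.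
  by case: uu1 => _ ->; rewrite invr1.
- by move=> b' _; rewrite unitri_minor ?expr1n // (leq_trans (ltn_ord _)) ?leq_pred.
- by move=> b' _; rewrite unitri_minor ?expr1n // (leq_trans (ltn_ord _)) ?leq_pred.
Qed.

(** Minors of the identity matrix on initial columns are 1, and those with one
    varying column are its entries. *)
Lemma pi_poly_eval1 i j : floor_eval 1%:M 1%:M (pi_poly i j) = delta_mx i j.
Proof.
apply/matrixP => r s; rewrite mxE [pi_poly i j r s]mxE !rmorphM /=.
rewrite map_lead1 map_lead2 map_row_part map_col_minor point_eval1 point_eval2.
have -> : lead1 (1%:M : 'M[K]_m) i = 1.
  rewrite /lead1 big1 // => c _.
  by rewrite minor_on_firsts1 ?expr1n // (leq_trans (ltn_ord _)) ?leq_pred.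
have -> : lead2 (1%:M : 'M[K]_n) j = 1.
  rewrite /lead2 big1 // => c _.
  by rewrite minor_on_firsts1 ?expr1n // (leq_trans (ltn_ord _)) ?leq_pred.
rewrite !mul1r col_minor1 mxE /row_part; case: ifP => _.
  by rewrite -natrM mulnb.
by rewrite row_minor1 -natrM mulnb.
Qed.

Lemma pi_poly_int_coef i j r s : int_coef (pi_poly i j r s).
Proof.
have gen1i x y : int_coef (X1 x y) by rewrite mxE; apply: int_coef_var.
have gen2i x y : int_coef (X2 x y) by rewrite mxE; apply: int_coef_var.
have minor_i p (A : 'M[P]_p) t : (forall x y, int_coef (A x y)) -> int_coef (minor_on A t).
  move=> Ai; apply: int_coef_det => x y; rewrite mxE; case: insub => [z|] /=; first exact: Ai.
  exact: (int_coef_nat K _ 0).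
rewrite mxE; apply: int_coefM; first apply: int_coefM; first apply: int_coefM.
- by apply: int_coef_prod => a _; apply: int_coefX; apply: minor_i.
- by apply: int_coef_prod => a _; apply: int_coefX; apply: minor_i.
- by rewrite /row_part; case: ifP => _; [apply: int_coef_nat|apply: minor_i].
- rewrite /col_minor; case: ifP => _; last exact: (int_coef_nat K _ 0).
  by apply: int_coefM; [apply: int_coef_sign|apply: minor_i].
Qed.

End PrimitiveVectors.

Section ColumnReplacement.

Variables (K : fieldType) (N p : nat) (l : p.-tuple int).
Hypothesis dl : dominant l.
Hypothesis p_gt0 : (0 < p)%N.
Local Notation P := {mpoly K[N]}.
Variable A : 'M[P]_p.

Let szl : size l = p. Proof. exact: size_tuple. Qed.

(** The multiplicity of the minor of size [a.+1] in the highest weight vector,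
    without one column of length [c]. *)
Definition hw_exp (c a : nat) : nat := (excess l a - excess l a.+1 - (a.+1 == c))%N.

Lemma hw_exp_out c a : (a.+1 != c)%N -> hw_exp c a = (excess l a - excess l a.+1)%N.
Proof. by rewrite /hw_exp => /negPf ->; rewrite subn0. Qed.

Lemma hw_minor_prod c : (c == 0%N) || (c == p) ->
  minor_prod A (ncols l) (col_length l)
    (\prod_(a < p.-1) minor_on A (firsts p a.+1) ^+ hw_exp c a).
Proof.
move=> hc; exists (fun q => firsts p (col_length l q)) => [q _|].
  by rewrite size_firsts // -[X in (_ <= X)%N]szl col_length_le.
have := prod_columns dl (fun k => minor_on A (firsts p k)).
rewrite szl => -> //; apply: eq_bigr => a _; rewrite hw_exp_out //.
by case/orP: hc => /eqP -> //; rewrite ltn_eqF // -ltn_predRL.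
Qed.

(** A column whose length occurs in the diagram may be exchanged for any other
    minor of the same size. *)
Lemma hw_minor_prod_replace c s : (0 < c < p)%N -> l`_c.-1 != l`_c -> size s = c ->
    minor_on A (firsts p c) != 0 ->
  minor_prod A (ncols l) (col_length l)
    (minor_on A s * \prod_(a < p.-1) minor_on A (firsts p a.+1) ^+ hw_exp c a).
Proof.
move=> /andP[c0 cp] lc szs Fc0.
have c1p : (c.-1 < size l)%N by rewrite szl; lia.
have cl : (c < size l)%N by rewrite szl.
have lt : (excess l c < excess l c.-1)%N.
  rewrite ltn_neqAle excess_le ?leq_pred // andbT -eqz_nat !excessE //.
  by apply: contra lc => /eqP/addIr ->.
pose q0 := (excess l c.-1).-1.
have q0E : q0.+1 = excess l c.-1 by rewrite prednK //; lia.
have q0N : (q0 < ncols l)%N.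
  by rewrite q0E -[ncols l]/(excess l 0); apply: excess_le.
have colq0 : col_length l q0 = c.
  apply/eqP; rewrite eqn_leq; apply/andP; split.
    by rewrite leqNgt (ltn_excess dl q0 cl); lia.
  by rewrite -(prednK c0) (ltn_excess dl q0 c1p); lia.
pose F k := minor_on A (firsts p k).
exists (fun q => if q == q0 then s else firsts p (col_length l q)) => [q _|].
  case: eqP => [->|_]; first by rewrite colq0.
  by rewrite size_firsts // -[X in (_ <= X)%N]szl col_length_le.
rewrite [RHS](bigD1 (Ordinal q0N)) //= eqxx; congr (_ * _).
have cp1 : (c.-1 < p.-1)%N by lia.
apply: (mulfI Fc0).
transitivity (\prod_(q < ncols l) F (col_length l q)); last first.
  rewrite (bigD1 (Ordinal q0N)) //= colq0; congr (_ * _); apply: eq_bigr => q.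
  by rewrite -val_eqE /= => /negPf ->.
have := prod_columns dl F; rewrite szl => -> //.
rewrite (bigD1 (Ordinal cp1)) //= [RHS](bigD1 (Ordinal cp1)) //= mulrA prednK //.
congr (_ * _); last first.
  apply: eq_bigr => a; rewrite -val_eqE /= => ac; rewrite hw_exp_out //.
  by apply: contra ac => /eqP <-.
by rewrite /hw_exp prednK // eqxx -exprS; congr (_ ^+ _); lia.
Qed.

End ColumnReplacement.

Section PiMembership.

Variables (K : fieldType) (m n : nat) (lp : m.-tuple int) (lm : n.-tuple int).
Hypotheses (dlp : dominant lp) (dlm : dominant lm).
Local Notation P := (Defs.even_poly K m n).
Local Notation X1 := (gen1 K m n).
Local Notation X2 := (gen2 K m n).

Lemma gen1_minor_neq0 k : (k <= m)%N -> minor_on X1 (firsts m k) != 0.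
Proof.
move=> km; apply: contraNneq (oner_neq0 K) => /(congr1 (point_eval 1%:M 1%:M)).
by rewrite rmorph0 -map_minor_on point_eval1 minor_on_firsts1 // => ->.
Qed.

Lemma gen2_minor_neq0 k : (k <= n)%N -> minor_on X2 (firsts n k) != 0.
Proof.
move=> kn; apply: contraNneq (oner_neq0 K) => /(congr1 (point_eval 1%:M 1%:M)).
by rewrite rmorph0 -map_minor_on point_eval2 minor_on_firsts1 // => ->.
Qed.

Lemma lead_row_span i r : good_row lp i ->
  lin_span (minor_prod X1 (ncols lp) (col_length lp)) (lead1 lp X1 i * row_part X1 i r).
Proof.
move=> gi; have m0 : (0 < m)%N by apply: leq_ltn_trans (ltn_ord i).
have leadE : lead1 lp X1 i = \prod_(a < m.-1) minor_on X1 (firsts m a.+1) ^+ hw_exp lp i.+1 a by [].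
rewrite leadE /row_part; case: ifP => im.
  rewrite -scaler_nat -scalerAr mulr1; apply: subspaceZ; first exact: lin_span_subspace.
  by apply: lin_span_gen; apply: hw_minor_prod.
rewrite mulrC; apply: lin_span_gen; apply: hw_minor_prod_replace => //.
- by rewrite /= ltn_neqAle im ltn_ord.
- by move: gi; rewrite /good_row im.
- exact: size_rcons_firsts.
- exact: gen1_minor_neq0.
Qed.

Lemma lead_col_span j s : good_col lm j ->
  lin_span (minor_prod X2 (ncols lm) (col_length lm)) (lead2 lm X2 j * col_minor X2 j s).
Proof.
move=> gj; have n0 : (0 < n)%N by apply: leq_ltn_trans (ltn_ord j).
have sZ := lin_span_subspace (minor_prod X2 (ncols lm) (col_length lm)).
have leadE : lead2 lm X2 j = \prod_(a < n.-1) minor_on X2 (firsts n a.+1) ^+ hw_exp lm j a by [].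
rewrite leadE /col_minor; case: ifP => sj; last by rewrite mulr0; case: sZ.
have -> (x y : P) k : x * ((-1) ^+ k * y) = (-1) ^+ k *: (y * x).
  rewrite -mul_mpolyC rmorphXn rmorphN1; ring.
apply: subspaceZ => //; apply: lin_span_gen.
have [j0|j0] := posnP j.
  have e : rem s (firsts n j.+1) = [::] by apply/size0nil; rewrite rem_firsts_size.
  by rewrite e minor_on_nil mul1r; apply: hw_minor_prod; rewrite // j0.
apply: hw_minor_prod_replace => //.
- by rewrite j0 ltn_ord.
- by move: gj; rewrite /good_col j0.
- exact: rem_firsts_size.
- by apply: gen2_minor_neq0; apply: ltnW.
Qed.

Definition floor_weight (Q : floor_space K m n) : Prop := forall r s, weight_space lp lm (Q r s).

Lemma pi_poly_floor i j : good_row lp i -> good_col lm j -> floor_weight (pi_poly K lp lm i j).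
Proof.
move=> gi gj r s; rewrite [pi_poly _ _ _ _ _ _ _]mxE.
have -> (x y z w : P) : x * y * z * w = (x * z) * (y * w) by ring.
by apply: weight_spaceM; [apply: lead_row_span|apply: lead_col_span].
Qed.

End PiMembership.

(** * Heights *)

Lemma unitri_inv (K : fieldType) p (u : 'M[K]_p) : upper_unitri u -> upper_unitri (invmx u).
Proof.
move=> uu; have uV := unitri_unit uu; case: uu => tu du.
have e a b : \sum_k invmx u a k * u k b = (a == b)%:R.
  by have /matrixP/(_ a b) := mulVmx uV; rewrite !mxE.
have low k : forall a b : 'I_p, (b <= k)%N -> (b < a)%N -> invmx u a b = 0.
  elim: k => [|k IH] a b bk ba.
  - have := e a b; rewrite (bigD1 b) //= big1 ?addr0 => [|c cb].
      by rewrite du mulr1 => ->; rewrite -val_eqE /= gtn_eqF.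
    rewrite (upper_trig tu) ?mulr0 //; move: cb; rewrite -val_eqE /=; lia.
  - have := e a b; rewrite (bigD1 b) //= big1 ?addr0 => [|c cb].
      by rewrite du mulr1 => ->; rewrite -val_eqE /= gtn_eqF.
    have [bc|cb'] := ltnP b c; first by rewrite (upper_trig tu) ?mulr0.
    have cb2 : (c < b)%N by rewrite ltn_neqAle cb' andbT.
    by rewrite IH ?mul0r //; lia.
split; first by apply/is_trig_mxP => b a ba; rewrite mxE (low b).
move=> a; have := e a a; rewrite eqxx (bigD1 a) //= big1 ?addr0 => [|c ca].
  by rewrite du mulr1.
have [ac|ca'] := ltnP a c; first by rewrite (upper_trig tu) ?mulr0.
by rewrite (low c) ?mul0r // ltn_neqAle ca' andbT.
Qed.

Section Heights.

Variables (K : fieldType) (m n : nat).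
Hypotheses (char0 : [pchar K] =i pred0) (n_gt0 : (0 < n)%N).
Local Notation P := (Defs.even_poly K m n).
Local Notation floor_space := (floor_space K m n).
Local Notation N := #|{: even_index m n}|.

(** Weights of a one-parameter torus, chosen to decrease with the column, so that
    upper triangular matrices raise the height, and to give pairwise distinct
    heights to the [y_ij]. *)
Definition var_height (e : 'I_N) : nat :=
  match enum_val e with inl p => n * (m - p.2) | inr p => n - p.2 end.

Definition mon_height (u : 'X_{1..N}) : nat := \sum_e var_height e * u e.

Definition pair_height (i : 'I_m) (j : 'I_n) : nat := n * i + (n - j).

Lemma pair_height_inj i j k l : pair_height i j = pair_height k l -> i = k /\ j = l.
Proof.
rewrite /pair_height => e; have [jn ln] := (ltn_ord j, ltn_ord l).
have ik : i = k :> nat by nia.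
by split; apply: val_inj => //=; rewrite ik in e; lia.
Qed.

Lemma pair_height_lt (i k : 'I_m) (j l : 'I_n) : (k <= i)%N -> (j <= l)%N -> (k, l) != (i, j) ->
  (pair_height k l < pair_height i j)%N.
Proof.
rewrite /pair_height xpair_eqE -!val_eqE /= => ki jl; have [jn ln] := (ltn_ord j, ltn_ord l).
rewrite negb_and => ne; nia.
Qed.

Lemma mon_heightD u v : mon_height (u + v)%MM = (mon_height u + mon_height v)%N.
Proof. by rewrite -big_split; apply: eq_bigr => e _; rewrite mnmDE mulnDr. Qed.

Definition poly_ge (h : nat) (p : P) : Prop := forall u, p@_u != 0 -> (h <= mon_height u)%N.

Lemma poly_ge0 h : poly_ge h 0.
Proof. by move=> u; rewrite mcoeff0 eqxx. Qed.

Lemma poly_geD h p q : poly_ge h p -> poly_ge h q -> poly_ge h (p + q).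
Proof.
move=> hp hq u; rewrite mcoeffD; have [->|/hp //] := eqVneq p@_u 0.
by rewrite add0r => /hq.
Qed.

Lemma poly_geZ h c p : poly_ge h p -> poly_ge h (c *: p).
Proof. by move=> hp u; rewrite mcoeffZ mulf_eq0 negb_or => /andP[_ /hp]. Qed.

Lemma poly_ge_sum h (I : Type) (r : seq I) (S : pred I) (F : I -> P) :
  (forall i, S i -> poly_ge h (F i)) -> poly_ge h (\sum_(i <- r | S i) F i).
Proof.
by move=> hF; elim/big_rec: _ => [|i x Si hx]; [apply: poly_ge0|apply: poly_geD => //; apply: hF].
Qed.

Lemma poly_ge_sum_seq h (I : eqType) (r : seq I) (F : I -> P) :
  (forall i, i \in r -> poly_ge h (F i)) -> poly_ge h (\sum_(i <- r) F i).
Proof. by rewrite big_seq; apply: poly_ge_sum. Qed.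

Lemma poly_ge_le h k p : (h <= k)%N -> poly_ge k p -> poly_ge h p.
Proof. by move=> hk kp u /kp; apply: leq_trans. Qed.

Lemma poly_geM h k p q : poly_ge h p -> poly_ge k q -> poly_ge (h + k) (p * q).
Proof.
move=> hp kq u; rewrite -mcoeff_msupp => /msuppM_le /allpairsP[[v w] /= [vp wq ->]].
by rewrite mon_heightD leq_add // ?hp ?kq // -mcoeff_msupp.
Qed.

Lemma poly_ge_mon u : poly_ge (mon_height u) 'X_[u].
Proof. by move=> v; rewrite mcoeffX; have [->|_] := eqVneq u v; rewrite ?eqxx. Qed.

Lemma mon_height1 e : mon_height U_(e)%MM = var_height e.
Proof.
rewrite /mon_height (bigD1 e) //= mnm1E eqxx muln1 big1 ?addn0 // => f fe.
by rewrite mnm1E eq_sym (negPf fe) muln0.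
Qed.

Definition raises h (q q' : P) : Prop := poly_ge h q /\ poly_ge h.+1 (q' - q).

Lemma raisesM h k q q' r r' : raises h q q' -> raises k r r' -> raises (h + k) (q * r) (q' * r').
Proof.
move=> [hq hq'] [kr kr']; split; first exact: poly_geM.
have -> : q' * r' - q * r = (q' - q) * (r' - r) + (q' - q) * r + q * (r' - r) by ring.
apply: poly_geD; first apply: poly_geD.
- by apply: poly_ge_le (poly_geM hq' kr'); lia.
- by apply: poly_ge_le (poly_geM hq' kr); lia.
- by apply: poly_ge_le (poly_geM hq kr'); lia.
Qed.

Lemma translate_var1 (g1 : 'M[K]_m) (g2 : 'M[K]_n) i j :
  translate g1 g2 'X_(enum_rank (inl (i, j) : even_index m n)) =
  \sum_k g1 k j *: 'X_(enum_rank (inl (i, k) : even_index m n)).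
Proof.
have /matrixP/(_ i j) := translate1 (m := m) (n := n) g1 g2.
rewrite !mxE => ->; apply: eq_bigr => k _.
by rewrite !mxE mulrC mul_mpolyC.
Qed.

Lemma translate_var2 (g1 : 'M[K]_m) (g2 : 'M[K]_n) i j :
  translate g1 g2 'X_(enum_rank (inr (i, j) : even_index m n)) =
  \sum_k g2 k j *: 'X_(enum_rank (inr (i, k) : even_index m n)).
Proof.
have /matrixP/(_ i j) := translate2 (m := m) (n := n) g1 g2.
rewrite !mxE => ->; apply: eq_bigr => k _.
by rewrite !mxE mulrC mul_mpolyC.
Qed.

Section Unitriangular.

Variables (u1 : 'M[K]_m) (u2 : 'M[K]_n).
Hypotheses (uu1 : upper_unitri u1) (uu2 : upper_unitri u2).

Lemma translate_var_raises (e : 'I_N) : raises (var_height e) 'X_e (translate u1 u2 'X_e).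
Proof.
have varge (f : 'I_N) h : (h <= var_height f)%N -> poly_ge h 'X_f.
  by move=> hf; apply: (poly_ge_le (k := mon_height U_(f)%MM)); [rewrite mon_height1|apply: poly_ge_mon].
split; first exact: varge.
have [x xe] : exists x : even_index m n, e = enum_rank x by exists (enum_val e); rewrite enum_valK.
rewrite xe /var_height enum_rankK; case: x {xe} => -[i j] /=.
  rewrite translate_var1.
  rewrite (bigD1 j) //= (proj2 uu1) scale1r [_ + \sum_(_ < _ | _) _]addrC addrK.
  apply: poly_ge_sum => k kj; have [jk|kj'] := ltnP j k.
    by rewrite (upper_trig (proj1 uu1)) // scale0r; apply: poly_ge0.
  apply: poly_geZ; apply: varge; rewrite /var_height enum_rankK /=.
  have kltj : (k < j)%N by move: kj; rewrite -val_eqE /=; lia.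
  by have := ltn_ord j; nia.
rewrite translate_var2.
rewrite (bigD1 j) //= (proj2 uu2) scale1r [_ + \sum_(_ < _ | _) _]addrC addrK.
apply: poly_ge_sum => k kj; have [jk|kj'] := ltnP j k.
  by rewrite (upper_trig (proj1 uu2)) // scale0r; apply: poly_ge0.
apply: poly_geZ; apply: varge; rewrite /var_height enum_rankK /=.
have kltj : (k < j)%N by move: kj; rewrite -val_eqE /=; lia.
by have := ltn_ord j; lia.
Qed.

Lemma translate_mon_raises u : raises (mon_height u) 'X_[u] (translate u1 u2 'X_[u]).
Proof.
rewrite mpolyXE_id rmorph_prod /mon_height.
apply: (big_rec3 (fun h q q' => raises h q q')) => [|e q' q h _ r].
  split; first by rewrite -mpolyX0; apply: (poly_ge_le (leq0n _) (@poly_ge_mon _)).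
  by rewrite subrr; apply: poly_ge0.
apply: raisesM => //; rewrite rmorphXn /=; elim: (u e) => [|k IH].
  rewrite muln0 !expr0; split; last by rewrite subrr; apply: poly_ge0.
  by rewrite -mpolyX0; apply: (poly_ge_le (leq0n _) (@poly_ge_mon _)).
by rewrite mulnS !exprS; apply: raisesM => //; apply: translate_var_raises.
Qed.

Lemma translate_raises h p : poly_ge h p -> poly_ge h.+1 (translate u1 u2 p - p).
Proof.
move=> hp; have -> : translate u1 u2 p - p = \sum_(u <- msupp p) p@_u *: (translate u1 u2 'X_[u] - 'X_[u]).
  rewrite [in LHS](mpolyE p) rmorph_sum -sumrB; apply: eq_bigr => u _ /=.
  by rewrite translateZ scalerBr.
apply: poly_ge_sum_seq => u; rewrite mcoeff_msupp => /hp hu; apply: poly_geZ.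
by apply: poly_ge_le (proj2 (translate_mon_raises u)); rewrite ltnS.
Qed.

Lemma translate_ge h p : poly_ge h p -> poly_ge h (translate u1 u2 p).
Proof.
move=> hp; rewrite -[translate _ _ _](subrK p); apply: poly_geD => //.
by apply: (poly_ge_le (leqnSn h)); apply: translate_raises.
Qed.

Variables a b : int.

Definition floor_ge (h : nat) (Q : floor_space) : Prop :=
  forall i j u, (Q i j)@_u != 0 -> (h <= pair_height i j + mon_height u)%N.

(** Unitriangular matrices move terms to earlier columns of the variables, and
    from entries [(k, l)] to entries [(i, j)] with [k <= i] and [j <= l]; both
    increase the height. *)
Lemma floor_rep_raises h (Q : floor_space) : floor_ge h Q -> floor_ge h.+1 (floor_rep a b u1 u2 Q - Q).
Proof.
move=> hQ i j.
have geQ k l : poly_ge (h - pair_height k l) (Q k l).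
  by move=> u Qu; rewrite leq_subLR; apply: hQ.
suff gei : poly_ge (h.+1 - pair_height i j) ((floor_rep a b u1 u2 Q - Q) i j).
  by move=> u /gei; rewrite leq_subLR.
have uV := unitri_inv uu1.
have dc : det_char a b u1 u2 = 1 by rewrite /det_char !unitri_det // !exp1rz mulr1.
rewrite floor_add_entry floor_opp_entry floor_act_entry dc.
under eq_bigr => k _ do under eq_bigr => l _ do rewrite mul1r.
rewrite (bigD1 i) //= (bigD1 j) //= (proj2 uV) (proj2 uu2) mulr1 scale1r -!addrA addrC -!addrA.
apply: poly_geD; first apply: poly_ge_sum => l lj.
  have [lj'|jl] := ltnP l j; first by rewrite (upper_trig (proj1 uu2)) // mulr0 scale0r; apply: poly_ge0.
  apply: poly_geZ; apply: translate_ge; apply: poly_ge_le (geQ i l).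
  have := @pair_height_lt i i j l (leqnn i) jl; rewrite xpair_eqE eqxx /= => /(_ lj); lia.
apply: poly_geD; first apply: poly_ge_sum => k ki.
  apply: poly_ge_sum => l _.
  have [ik|ki'] := ltnP i k; first by rewrite (upper_trig (proj1 uV)) // mul0r scale0r; apply: poly_ge0.
  have [lj'|jl] := ltnP l j; first by rewrite (upper_trig (proj1 uu2)) // mulr0 scale0r; apply: poly_ge0.
  apply: poly_geZ; apply: translate_ge; apply: poly_ge_le (geQ k l).
  have := @pair_height_lt i k j l ki' jl; rewrite xpair_eqE (negPf ki) /= => /(_ isT); lia.
rewrite addrC; apply: poly_ge_le (translate_raises (geQ i j)); lia.
Qed.

End Unitriangular.
End Heights.

(** * The action of a torus element *)

(** The torus element with entries powers of 2 of exponents the weights above acts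
    on coefficients of height [h] by [2 ^ h], up to a common factor. In
    characteristic zero its eigenspaces are thus the homogeneous components. *)
Section Torus.

Variables (K : fieldType) (m n : nat) (a b : int).
Hypothesis char0 : [pchar K] =i pred0.
Local Notation P := (Defs.even_poly K m n).
Local Notation floor_space := (floor_space K m n).
Local Notation N := #|{: even_index m n}|.

Definition torus1 : 'M[K]_m := diag_mx (\row_i 2%:R ^+ (n * (m - i))).
Definition torus2 : 'M[K]_n := diag_mx (\row_j 2%:R ^+ (n - j)).

Lemma two_neq0 : 2%:R != 0 :> K.
Proof. exact: natr_neq0. Qed.

Lemma two_unit k : (2%:R : K) ^+ k \is a GRing.unit.
Proof. by rewrite unitfE expf_neq0 // two_neq0. Qed.

Lemma two_expI : injective (fun h => (2%:R : K) ^+ h).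
Proof. by move=> h k; rewrite -!natrX => /(natr_inj char0) /eqP; rewrite eqn_exp2l // => /eqP. Qed.

Lemma torus1_trig : is_trig_mx torus1. Proof. exact: diag_mx_is_trig. Qed.
Lemma torus2_trig : is_trig_mx torus2. Proof. exact: diag_mx_is_trig. Qed.
Lemma torus1_tr : torus1^T = torus1. Proof. exact: tr_diag_mx. Qed.
Lemma torus2_tr : torus2^T = torus2. Proof. exact: tr_diag_mx. Qed.

Lemma torus1_unit : torus1 \in unitmx.
Proof.
rewrite unitmxE det_diag; apply: rpred_prod => i _.
by rewrite mxE two_unit.
Qed.

Lemma torus2_unit : torus2 \in unitmx.
Proof.
rewrite unitmxE det_diag; apply: rpred_prod => i _.
by rewrite mxE two_unit.
Qed.

Lemma torus1E i j : torus1 i j = (i == j)%:R * 2%:R ^+ (n * (m - i)).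
Proof. by rewrite !mxE; case: eqVneq => [->|_]; rewrite ?mul1r ?mulr1n ?mul0r ?mulr0n. Qed.

Lemma torus2E i j : torus2 i j = (i == j)%:R * 2%:R ^+ (n - i).
Proof. by rewrite !mxE; case: eqVneq => [->|_]; rewrite ?mul1r ?mulr1n ?mul0r ?mulr0n. Qed.

Lemma torus1_inv i j : invmx torus1 i j = (i == j)%:R * 2%:R ^- (n * (m - i)).
Proof.
pose T : 'M[K]_m := \matrix_(i, j) ((i == j)%:R * 2%:R ^- (n * (m - i))).
suff -> : invmx torus1 = T by rewrite mxE.
apply: (can_inj (mulKmx torus1_unit)); rewrite mulmxV ?torus1_unit //.
apply: matrix_ext => k l; rewrite !mxE (bigD1 k) //= big1 ?addr0 => [|q /negPf qk].
  rewrite torus1E mxE eqxx mul1r; case: eqVneq => _; rewrite ?mul0r ?mulr0 // mul1r.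
  by rewrite divrr // two_unit.
by rewrite torus1E eq_sym qk !mul0r.
Qed.

Lemma translate_torus_var (e : 'I_N) : translate torus1 torus2 'X_e = 2%:R ^+ var_height e *: 'X_e.
Proof.
have [x xe] : exists x : even_index m n, e = enum_rank x by exists (enum_val e); rewrite enum_valK.
rewrite xe /var_height enum_rankK; case: x {xe} => -[i j] /=.
  rewrite translate_var1 (bigD1 j) //= torus1E eqxx mul1r big1 ?addr0 // => k /negPf kj.
  by rewrite torus1E kj mul0r scale0r.
rewrite translate_var2 (bigD1 j) //= torus2E eqxx mul1r big1 ?addr0 // => k /negPf kj.
by rewrite torus2E kj mul0r scale0r.
Qed.

Lemma translate_torus_mon (u : 'X_{1..N}) :
  translate torus1 torus2 'X_[u] = 2%:R ^+ mon_height u *: 'X_[u] :> P.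
Proof.
rewrite mpolyXE_id rmorph_prod /mon_height.
elim/big_rec3: _ => [|e h q q' _ ->]; first by rewrite scale1r.
rewrite rmorphXn /= translate_torus_var exprZn -exprM exprD.
by rewrite -scalerAl -scalerAr scalerA.
Qed.

Lemma translate_torus_coef (p : P) u :
  (translate torus1 torus2 p)@_u = 2%:R ^+ mon_height u * p@_u.
Proof.
rewrite [in LHS](mpolyE p) rmorph_sum /= raddf_sum /=.
under eq_bigr => v _ do rewrite translateZ translate_torus_mon !mcoeffZ mcoeffX.
rewrite [in RHS](mpolyE p) raddf_sum mulr_sumr; apply: eq_bigr => v _ /=.
rewrite mcoeffZ mcoeffX; case: eqVneq => [->|_]; last by rewrite !mulr0.
by rewrite !mulr1 mulrC.
Qed.

Definition torus_char : K := det_char a b torus1 torus2 * 2%:R ^- (n * m).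

Lemma torus_char_neq0 : torus_char != 0.
Proof.
rewrite mulf_neq0 ?invr_neq0 ?expf_neq0 ?two_neq0 // mulf_neq0 // expfz_neq0 //.
  by rewrite -unitfE -unitmxE torus1_unit.
by rewrite -unitfE -unitmxE torus2_unit.
Qed.

Lemma torus_pair_height (i : 'I_m) (j : 'I_n) :
  det_char a b torus1 torus2 * (2%:R ^- (n * (m - i)) * 2%:R ^+ (n - j)) =
  torus_char * 2%:R ^+ pair_height i j.
Proof.
rewrite /torus_char -mulrA; congr (_ * _); rewrite /pair_height exprD mulrA; congr (_ * _).
have -> : (n * m = n * (m - i) + n * i)%N by rewrite -mulnDr subnK // ltnW.
by rewrite exprD invfM -mulrA mulVr ?mulr1 // two_unit.
Qed.

Local Notation D := (floor_rep a b torus1 torus2).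

Lemma torus_coef (Q : floor_space) i j u :
  (D Q i j)@_u = torus_char * 2%:R ^+ (pair_height i j + mon_height u) * (Q i j)@_u.
Proof.
rewrite floor_act_entry (bigD1 i) //= [X in _ + X]big1 ?addr0 => [|k /negPf ki]; last first.
  by rewrite big1 // => l _; rewrite torus1_inv ki !mul0r mulr0 scale0r.
rewrite (bigD1 j) //= [X in _ + X]big1 ?addr0 => [|l /negPf lj]; last first.
  by rewrite torus2E eq_sym lj !mul0r !mulr0 scale0r.
rewrite mcoeffZ translate_torus_coef torus1_inv torus2E !eqxx !mul1r torus_pair_height.
by rewrite exprD !mulrA.
Qed.

Lemma torus_eigen_height (Q : floor_space) h i j u :
  D Q = (torus_char * 2%:R ^+ h) *: Q -> (Q i j)@_u != 0 -> (pair_height i j + mon_height u)%N = h.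
Proof.
move=> e nz; have := torus_coef Q i j u; rewrite e floor_scale_entry mcoeffZ.
by move/(mulIf nz)/(mulfI torus_char_neq0)/two_expI.
Qed.

Lemma floor_coef_neq0 (Q : floor_space) : Q != 0 -> exists i j u, (Q i j)@_u != 0.
Proof.
move=> Q0; apply: contrapT => h; case/eqP: Q0.
apply: floor_spaceP => i j; rewrite floor_zero_entry; apply/mpolyP => u; rewrite mcoeff0.
by apply/eqP; apply: contraT => nz; case: h; exists i, j, u.
Qed.

(** Subtracting from [D v] the multiple of [v] that kills the lowest height leaves
    a vector with fewer heights, unless [v] was an eigenvector. *)
Lemma torus_eigenvector (L : floor_space -> Prop) lo hi (v : floor_space) :
    subspace L -> (forall w, L w -> L (D w)) -> L v -> v != 0 ->
    (forall i j u, (v i j)@_u != 0 -> (lo <= pair_height i j + mon_height u < hi)%N) ->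
  exists2 h, (lo <= h < hi)%N & exists2 w, L w & w != 0 /\ D w = (torus_char * 2%:R ^+ h) *: w.
Proof.
move=> sL LD; move: {2}(hi - lo)%N (leqnn (hi - lo)) => d.
elim: d lo v => [|d IH] lo v hd Lv v0 hv.
  have [i [j [u /hv]]] := floor_coef_neq0 v0; move: hd; lia.
pose v' := D v - (torus_char * 2%:R ^+ lo) *: v.
have [v'0|v'0] := eqVneq v' 0.
  exists lo; last by exists v => //; split=> //; apply/eqP; rewrite -subr_eq0 -/v' v'0.
  by have [i [j [u /hv]]] := floor_coef_neq0 v0; lia.
have Lv' : L v' by apply: subspaceB => //; [exact: LD|exact: subspaceZ].
have hd' : (hi - lo.+1 <= d)%N by lia.
have [i j u|h hh hw] := IH lo.+1 v' hd' Lv' v'0; last by exists h => //; lia.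
rewrite floor_add_entry floor_opp_entry floor_scale_entry mcoeffB torus_coef mcoeffZ -mulrBl -mulrBr.
rewrite !mulf_eq0 !negb_or => /andP[/andP[_ ne] /hv].
have : (pair_height i j + mon_height u)%N != lo by apply: contraNneq ne => ->; rewrite subrr.
lia.
Qed.

(** ** Values at the identity *)

Variables (lp : m.-tuple int) (lm : n.-tuple int).
Hypotheses (dlp : dominant lp) (dlm : dominant lm).

Definition torus_char1 : K := torus_char * (left_char lp torus1 * left_char lm torus2).

Lemma trig_keeps_rows p (l : seq int) (L : 'M[K]_p) : is_trig_mx L -> keeps_rows l L.
Proof. by move=> tL q _ i j /andP[iq qj]; rewrite (is_trig_mxP tL) // (leq_trans iq qj). Qed.

Lemma left_char_trig_neq0 p (l : p.-tuple int) (L : 'M[K]_p) : is_trig_mx L^T -> L \in unitmx ->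
  left_char l L != 0.
Proof.
move=> tL uL; apply/prodf_neq0 => q _.
have lek : (col_length l q <= p)%N by rewrite (leq_trans (col_length_le _ _)) // size_tuple.
rewrite (upper_trig_minor lek) //; apply/prodf_neq0 => i _.
move: uL; rewrite unitmxE -det_tr det_trig // unitfE => /prodf_neq0/(_ (widen_ord lek i) isT).
by rewrite mxE.
Qed.

Lemma torus_char1_neq0 : torus_char1 != 0.
Proof.
rewrite mulf_neq0 ?torus_char_neq0 // mulf_neq0 // left_char_trig_neq0 //.
- by rewrite torus1_tr torus1_trig.
- exact: torus1_unit.
- by rewrite torus2_tr torus2_trig.
- exact: torus2_unit.
Qed.

Local Notation ev x1 x2 Q := (floor_eval x1 x2 Q).

Lemma floor_eval_left (Q : floor_space) b1 b2 x1 x2 : floor_weight lp lm Q ->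
  keeps_rows lp b1 -> keeps_rows lm b2 ->
  ev (b1 *m x1) (b2 *m x2) Q = (left_char lp b1 * left_char lm b2) *: ev x1 x2 Q.
Proof.
move=> FQ k1 k2; apply: matrix_ext => i j; rewrite [RHS]mxE ![ev _ _ _ _ _]mxE.
exact: weight_space_left.
Qed.

(** The identity is moved to [t], which acts on values from the left by a scalar;
    only the constant matrices of the action distinguish the entries. *)
Lemma torus_eval (Q : floor_space) i j : floor_weight lp lm Q ->
  ev 1%:M 1%:M (D Q) i j = torus_char1 * 2%:R ^+ pair_height i j * ev 1%:M 1%:M Q i j.
Proof.
move=> FQ; rewrite floor_eval_act !mul1mx -[torus1 in floor_eval torus1]mulmx1 -[torus2 in floor_eval _ torus2]mulmx1.
rewrite floor_eval_left //; try by apply: trig_keeps_rows; rewrite ?torus1_trig ?torus2_trig.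
rewrite torus2_tr mxE mxE (bigD1 j) //= big1 ?addr0 => [|l /negPf lj]; last first.
  by rewrite torus2E lj mul0r mulr0.
rewrite mxE (bigD1 i) //= big1 ?addr0 => [|k /negPf ki]; last first.
  by rewrite mxE torus1_inv ki mul0r mul0r.
rewrite mxE torus1_inv mxE torus2E !eqxx !mul1r /torus_char1.
have := torus_pair_height i j.
set c := det_char _ _ _ _; set x := 2%:R ^- _; set y := 2%:R ^+ _; set z := left_char _ _ * _.
set t := 2%:R ^+ _; set w := ev _ _ _ _ _ => h.
transitivity ((c * (x * y)) * z * w); first by ring.
by rewrite h; ring.
Qed.

(** ** Invariants of the unipotent radical *)

Definition unipotent_invariant (Q : floor_space) : Prop :=
  forall u1 u2, upper_unitri u1 -> upper_unitri u2 -> floor_rep a b u1 u2 Q = Q.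

Lemma invariant_eval (Q : floor_space) x1 x2 u1 u2 : unipotent_invariant Q ->
  upper_unitri u1 -> upper_unitri u2 ->
  ev (x1 *m u1) (x2 *m u2) Q *m u2^T = u1^T *m ev x1 x2 Q.
Proof.
move=> iQ uu1 uu2; have := floor_eval_act a b x1 x2 u1 u2 Q; rewrite iQ // => ->.
have -> : det_char a b u1 u2 = 1 by rewrite /det_char !unitri_det // !exp1rz mulr1.
by rewrite scale1r !mulmxA -trmx_mul mulVmx ?unitri_unit // trmx1 mul1mx.
Qed.

(** Left equivariance under lower triangular matrices and invariance under upper
    unitriangular ones extend the vanishing from the identity to the big cell. *)
Lemma invariant_eq0 (Q : floor_space) : floor_weight lp lm Q -> unipotent_invariant Q ->
  ev 1%:M 1%:M Q = 0 -> Q = 0.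
Proof.
move=> FQ iQ Q1; apply: floor_spaceP => i j; rewrite floor_zero_entry.
apply: big_cell_vanishing => // L1 U1 L2 U2 tL1 uL1 uU1 tL2 uL2 uU2.
have : ev (L1 *m U1) (L2 *m U2) Q = 0.
  have uU2' : U2^T \in unitmx by rewrite unitmx_tr unitri_unit.
  apply: (can_inj (mulmxK uU2')); rewrite invariant_eval // mul0mx.
  rewrite -[L1]mulmx1 -[L2]mulmx1 floor_eval_left ?Q1 ?scaler0 ?mulmx0 //; exact: trig_keeps_rows.
by move/matrixP/(_ i j); rewrite !mxE.
Qed.

End Torus.

(** * Classification of the primitive vectors *)

Section Degrees.

Variables (K : fieldType) (N : nat).
Implicit Types p q : {mpoly K[N]}.

Definition deg_le (d : nat) p : Prop := forall u, p@_u != 0 -> (mdeg u <= d)%N.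

Lemma deg_le0 d : deg_le d 0.
Proof. by move=> u; rewrite mcoeff0 eqxx. Qed.

Lemma deg_le1 : deg_le 0 1.
Proof. by move=> u; rewrite mcoeff1; have [->|u0] := eqVneq u 0%MM; rewrite ?mdeg0 // eqxx. Qed.

Lemma deg_leD d p q : deg_le d p -> deg_le d q -> deg_le d (p + q).
Proof.
move=> hp hq u; rewrite mcoeffD; have [->|/hp //] := eqVneq p@_u 0.
by rewrite add0r => /hq.
Qed.

Lemma deg_leZ d c p : deg_le d p -> deg_le d (c *: p).
Proof. by move=> hp u; rewrite mcoeffZ mulf_eq0 negb_or => /andP[_ /hp]. Qed.

Lemma deg_leM d e p q : deg_le d p -> deg_le e q -> deg_le (d + e) (p * q).
Proof.
move=> hp hq u; rewrite -mcoeff_msupp => /msuppM_le /allpairsP[[v w] /= [vp wq ->]].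
by rewrite mdegD leq_add // ?hp ?hq // -mcoeff_msupp.
Qed.

Lemma deg_le_prod (I : Type) (r : seq I) (d : I -> nat) (f : I -> {mpoly K[N]}) :
  (forall i, deg_le (d i) (f i)) -> deg_le (\sum_(i <- r) d i) (\prod_(i <- r) f i).
Proof.
by move=> df; elim/big_rec2: _ => [|i p e _ pe]; [exact: deg_le1|exact: deg_leM].
Qed.

Lemma deg_le_minor (r : nat) (A : 'M[{mpoly K[N]}]_r) (s : seq 'I_r) : (forall i j, deg_le 1 (A i j)) ->
  deg_le (size s) (minor_on A s).
Proof.
move=> dA; rewrite /minor_on /determinant.
elim/big_rec: _ => [|w x _ dx]; first exact: deg_le0.
apply: deg_leD => //; rewrite -signr_odd; case: (odd _); rewrite ?expr1 ?mulN1r -?scaleN1r ?mul1r.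
  apply: deg_leZ.
  rewrite -[X in deg_le X]muln1 -[X in (X * _)%N]card_ord -sum_nat_const.
  apply: deg_le_prod => i; rewrite mxE; case: insubP => [y _ _|_] //=; exact: deg_le0.
rewrite -[X in deg_le X]muln1 -[X in (X * _)%N]card_ord -sum_nat_const.
apply: deg_le_prod => i; rewrite mxE; case: insubP => [y _ _|_] //=; exact: deg_le0.
Qed.

Lemma deg_le_var i : deg_le 1 ('X_i : {mpoly K[N]}).
Proof. by move=> u; rewrite mcoeffX; have [<-|_] := eqVneq U_(i)%MM u; rewrite ?mdeg1 // eqxx. Qed.

End Degrees.

Section Classification.

Variables (K : fieldType) (m n : nat) (a b : int).
Hypotheses (char0 : [pchar K] =i pred0) (n_gt0 : (0 < n)%N).
Variables (lp : m.-tuple int) (lm : n.-tuple int).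
Hypotheses (dlp : dominant lp) (dlm : dominant lm).
Local Notation P := (Defs.even_poly K m n).
Local Notation floor_space := (floor_space K m n).
Local Notation ev x1 x2 Q := (floor_eval x1 x2 Q).
Local Notation t1 := (torus1 K m n).
Local Notation t2 := (torus2 K n).
Local Notation F := (@floor_weight K m n lp lm).
Local Notation pi_poly := (pi_poly K lp lm).

Lemma weight_space_deg : exists d, forall p : P, weight_space lp lm p -> deg_le d p.
Proof.
exists (\sum_(q < ncols lp) col_length lp q + \sum_(q < ncols lm) col_length lm q)%N => p.
apply: lin_span_min.
  split=> [|c x y hx hy]; first exact: deg_le0.
  by apply: deg_leD => //; apply: deg_leZ.
move=> _ [_ [_ [[T szT ->] [U szU ->] ->]]]; apply: deg_leM; apply: deg_le_prod => q.
  rewrite -szT //; apply: deg_le_minor => i j; rewrite mxE; exact: deg_le_var.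
rewrite -szU //; apply: deg_le_minor => i j; rewrite mxE; exact: deg_le_var.
Qed.

Lemma floor_height_bound : exists B, forall Q : floor_space, F Q ->
  forall i j u, (Q i j)@_u != 0 -> (pair_height i j + mon_height u < B)%N.
Proof.
have [d hd] := weight_space_deg.
exists ((n * m + n) + (n * m + n) * d).+1 => Q FQ i j u nz; rewrite ltnS leq_add //.
  by rewrite /pair_height; have := ltn_ord i; nia.
apply: (@leq_trans ((n * m + n) * mdeg u)); last by rewrite leq_mul2l (hd _ (FQ i j)) ?orbT.
rewrite mdegE big_distrr /=; apply: leq_sum => e _; rewrite leq_mul2r; apply/orP; right.
by rewrite /var_height; case: (enum_val e) => q; nia.
Qed.

Lemma floor_weight_finite : exists k (e : 'I_k -> floor_space),
  forall Q, F Q -> exists c : 'I_k -> K, Q = \sum_i c i *: e i.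
Proof.
have [d hd] := weight_space_deg.
pose T : finType := ('I_m * 'I_n * 'X_{1..#|{: even_index m n}| < d.+1})%type.
pose f (x : T) : floor_space := \matrix_(i, j) (((i, j) == x.1)%:R *: 'X_[x.2]).
exists #|{: T}|, (fun k => f (enum_val k)) => Q FQ.
pose coef (x : T) := (Q x.1.1 x.1.2)@_x.2.
exists (fun k => coef (enum_val k)).
rewrite (reindex _ (onW_bij _ (enum_rank_bij T))) /=.
under eq_bigr => x _ do rewrite enum_rankK.
apply: floor_spaceP => i j; rewrite floor_sum_entry.
transitivity (\sum_(u : 'X_{1..#|{: even_index m n}| < d.+1}) (Q i j)@_u *: 'X_[u]).
  rewrite [LHS](mpolyE (Q i j)) (big_mksub 'X_{1..#|{: even_index m n}| < d.+1}) ?msupp_uniq //=.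
    rewrite big_rmcond //= => u /memN_msupp_eq0 ->; exact: scale0r.
  by move=> u; rewrite mcoeff_msupp ltnS => /(hd _ (FQ i j)).
transitivity (\sum_(x : 'I_m * 'I_n) \sum_(u : 'X_{1..#|{: even_index m n}| < d.+1})
   (coef (x, u) *: f (x, u)) i j); last first.
  by rewrite pair_bigA /=; apply: eq_bigr => -[].
rewrite (bigD1 (i, j)) //= [X in _ = _ + X]big1 ?addr0 => [|x /negPf xij].
  by apply: eq_bigr => u _; rewrite floor_scale_entry mxE eqxx scale1r.
by rewrite big1 // => u _; rewrite floor_scale_entry mxE eq_sym xij scale0r scaler0.
Qed.

Lemma floor_weight_subspace : subspace F.
Proof.
have [w0 wD] := @weight_space_subspace K m n lp lm.
split=> [i j|c x y Fx Fy i j]; first by rewrite floor_zero_entry.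
by rewrite floor_add_entry floor_scale_entry; apply: wD.
Qed.

Lemma floor_weight_rep g1 g2 Q : F Q -> F (floor_rep a b g1 g2 Q).
Proof.
move=> FQ i j; rewrite floor_act_entry; have sW := @weight_space_subspace K m n lp lm.
apply: subspace_sum => // k _; apply: subspace_sum => // l _; apply: subspaceZ => //.
exact: translate_weight_space.
Qed.

Definition elementary p (i j : 'I_p) : 'M[K]_p := 1%:M + delta_mx i j.

Lemma elementary_unitri p (i j : 'I_p) : (i < j)%N -> upper_unitri (elementary i j).
Proof.
move=> ij; split=> [|k]; last first.
  rewrite !mxE eqxx; case: (eqVneq k i) => [->|_]; last by rewrite addr0.
  by rewrite -val_eqE ltn_eqF // addr0.
apply/is_trig_mxP => k l kl; rewrite !mxE -val_eqE gtn_eqF // add0r.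
case: (eqVneq l i) => [li|] //=; case: (eqVneq k j) => [kj|] //=.
by move: kl; rewrite li kj ltnNge (ltnW ij).
Qed.

Lemma elementary_keeps_rows p (l : p.-tuple int) (i j : 'I_p) : dominant l -> j = i.+1 :> nat ->
  l`_i = l`_j -> keeps_rows l (elementary i j).
Proof.
move=> dl ji lij q _ k k' /andP[kq qk']; rewrite !mxE.
have kk' : (k == k') = false by rewrite -val_eqE ltn_eqF // (leq_trans kq).
rewrite kk' add0r; case: (eqVneq k i) => [ki|] //=; case: (eqVneq k' j) => [kj|] //=.
have := ltn_excess dl q (a := i); have := ltn_excess dl q (a := j).
rewrite size_tuple !ltn_ord -ki -kj kq => /(_ isT) h1 /(_ isT) h2.
by move: h2 h1; rewrite /excess ki kj lij => <-; rewrite ltnNge -kj qk'.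
Qed.

Lemma left_char_unitri p (l : p.-tuple int) (u : 'M[K]_p) : upper_unitri u -> left_char l u = 1.
Proof.
move=> uu; apply: big1 => q _; apply: unitri_minor => //.
by rewrite (leq_trans (col_length_le _ _)) // size_tuple.
Qed.

Lemma unitri1 p : upper_unitri (1%:M : 'M[K]_p).
Proof. by split=> [|i]; rewrite ?mxE ?eqxx // trmx1 scalar_mx_is_trig. Qed.

Lemma invariant_eval_fixed (Q : floor_space) u1 u2 : F Q -> unipotent_invariant a b Q ->
    upper_unitri u1 -> upper_unitri u2 -> keeps_rows lp u1 -> keeps_rows lm u2 ->
  ev 1%:M 1%:M Q *m u2^T = u1^T *m ev 1%:M 1%:M Q.
Proof.
move=> FQ iQ uu1 uu2 k1 k2; rewrite -(invariant_eval 1%:M 1%:M iQ uu1 uu2) !mul1mx.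
have := floor_eval_left 1%:M 1%:M FQ k1 k2; rewrite !mulmx1 => ->.
by rewrite !left_char_unitri // mul1r scale1r.
Qed.

Lemma keeps_rows1 p (l : seq int) : keeps_rows l (1%:M : 'M[K]_p).
Proof. by apply: trig_keeps_rows; apply: scalar_mx_is_trig. Qed.

Lemma delta_mulmx_entry p q (E : 'M[K]_(p, q)) i (k : 'I_p) j : (delta_mx k i *m E) k j = E i j.
Proof.
rewrite mxE (bigD1 i) //= mxE !eqxx mul1r big1 ?addr0 // => l /negPf li.
by rewrite mxE li andbF mul0r.
Qed.

Lemma mulmx_delta_entry p q (E : 'M[K]_(p, q)) i j (k : 'I_q) : (E *m delta_mx j k) i k = E i j.
Proof.
rewrite mxE (bigD1 j) //= mxE !eqxx mulr1 big1 ?addr0 // => l /negPf lj.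
by rewrite mxE lj mulr0.
Qed.

(** The value at the identity has a single nonzero entry, because the heights of
    the entries are distinct. If the pair [(i, j)] of this entry were not good,
    left equivariance would hold for an elementary matrix [1 + E_(i,i+1)] or
    [1 + E_(j-1,j)]; it fixes the value at the identity, and this forces the
    entry to vanish. Subtracting a multiple of [pi_poly i j] leaves an invariant
    that vanishes at the identity. *)
Lemma invariant_eigenvector (Q : floor_space) h : F Q -> Q != 0 -> unipotent_invariant a b Q ->
    floor_rep a b t1 t2 Q = (torus_char K m n a b * 2%:R ^+ h) *: Q ->
  exists i j c, [/\ good_row lp i, good_col lm j, c != 0 & Q = c *: pi_poly i j].
Proof.
move=> FQ Q0 iQ eQ; pose E := ev 1%:M 1%:M Q.
have E0 : E != 0 by apply: contra_neq Q0; apply: invariant_eq0 FQ iQ.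
have [i [j Eij]] : exists i j, E i j != 0.
  apply: contrapT => hE; case/eqP: E0; apply: matrix_ext => i j; rewrite [RHS]mxE.
  by apply/eqP; apply: contraT => nz; case: hE; exists i, j.
have hgt k l : E k l != 0 -> torus_char K m n a b * 2%:R ^+ h = torus_char1 K a b lp lm * 2%:R ^+ pair_height k l.
  move=> nz; have := torus_eval a b char0 k l FQ; rewrite eQ -/E => e; apply: (mulIf nz).
  by rewrite -e /E [RHS]mxE floor_scale_entry point_evalZ; congr (_ * _); rewrite mxE.
have EE : E = E i j *: delta_mx i j.
  apply: matrix_ext => k l; rewrite [RHS]mxE [delta_mx _ _ _ _]mxE.
  have [/andP[/eqP -> /eqP ->]|kl] := boolP ((k == i) && (l == j)); first by rewrite mulr1.
  rewrite mulr0; apply/eqP; apply: contraT => Ekl.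
  have := hgt _ _ Ekl; rewrite (hgt _ _ Eij) => /(mulfI (torus_char1_neq0 a b char0 lp lm)).
  move=> /(two_expI char0) /(pair_height_inj n_gt0)[ik jl].
  by rewrite ik jl !eqxx in kl.
have gi : good_row lp i.
  rewrite /good_row; apply: contraT; rewrite negb_or negbK => /andP[im /eqP li].
  have im' : (i.+1 < m)%N by rewrite ltn_neqAle im ltn_ord.
  pose i' := Ordinal im'; have ii' : (i < i')%N by [].
  have := invariant_eval_fixed FQ iQ (elementary_unitri ii') (unitri1 n)
     (elementary_keeps_rows (l := lp) (i := i) (j := i') dlp (erefl _) li) (@keeps_rows1 n lm).
  rewrite trmx1 mulmx1 -/E /elementary raddfD /= trmx1 mulmxDl mul1mx => /esym/eqP.
  rewrite -subr_eq0 addrAC subrr add0r trmx_delta => /eqP/matrixP/(_ i' j).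
  by move/eqP; rewrite delta_mulmx_entry [X in _ == X]mxE (negPf Eij).
have gj : good_col lm j.
  rewrite /good_col; apply: contraT; rewrite negb_imply negbK => /andP[j0 /eqP lj].
  have jn : (j.-1 < n)%N by rewrite (leq_ltn_trans (leq_pred _)).
  pose j' := Ordinal jn; have jj' : (j' < j)%N by rewrite /= prednK.
  have := invariant_eval_fixed FQ iQ (unitri1 m) (elementary_unitri jj') (@keeps_rows1 m lp)
     (elementary_keeps_rows (l := lm) (i := j') (j := j) dlm (esym (prednK j0)) lj).
  rewrite trmx1 mul1mx -/E /elementary raddfD /= trmx1 mulmxDr mulmx1 => /eqP.
  rewrite -subr_eq0 addrAC subrr add0r trmx_delta => /eqP/matrixP/(_ i j').
  by move/eqP; rewrite mulmx_delta_entry [X in _ == X]mxE (negPf Eij).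
move: (E i j) Eij EE => c c0 EE; exists i, j, c; split=> //; apply/eqP; rewrite -subr_eq0 -scaleN1r addrC.
set Q' := _ + Q; apply/eqP; apply: (@invariant_eq0 _ _ _ a b char0 lp lm).
- case: floor_weight_subspace => F0 FD; apply: FD => //.
  by apply: (subspaceZ (L := F)); [exact: floor_weight_subspace|exact: pi_poly_floor].
- move=> u1 u2 uu1 uu2; rewrite floor_act_linear iQ //; congr (_ *: _ + _).
  have := floor_act_linear a b u1 u2 c (pi_poly i j) 0; rewrite addr0 => ->.
  have -> : floor_rep a b u1 u2 0 = 0 :> floor_space.
    by have := floor_act_linear a b u1 u2 (-1) Q Q; rewrite scaleN1r addNr scaleN1r addNr.
  by rewrite addr0 pi_poly_unitri.
- rewrite floor_eval_linear -/E EE scaleN1r.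
  have := floor_eval_linear 1%:M 1%:M c (pi_poly i j) 0; rewrite addr0 => ->.
  rewrite pi_poly_eval1.
  have -> : ev 1%:M 1%:M (0 : floor_space) = 0.
    by have := floor_eval_linear 1%:M 1%:M (-1) Q Q; rewrite scaleN1r addNr scaleN1r addNr.
  by rewrite addr0 addNr.
Qed.

End Classification.

(** * Matrix coefficients *)

Section PolynomialFunctions.

Variables (K : fieldType) (m n : nat).
Local Notation P := (Defs.even_poly K m n).
Local Notation X1 := (gen1 K m n).
Local Notation X2 := (gen2 K m n).

Definition polynomial_fun (f : 'M[K]_m -> 'M[K]_n -> K) : Prop :=
  exists p : P, forall g1 g2, point_eval g1 g2 p = f g1 g2.

Lemma polynomial_fun_ext f f' : (forall g1 g2, f g1 g2 = f' g1 g2) ->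
  polynomial_fun f -> polynomial_fun f'.
Proof. by move=> e [p pf]; exists p => g1 g2; rewrite pf. Qed.

Lemma polynomial_fun_const c : polynomial_fun (fun _ _ => c).
Proof. by exists c%:MP => g1 g2; rewrite point_evalC. Qed.

Lemma polynomial_funD f f' : polynomial_fun f -> polynomial_fun f' ->
  polynomial_fun (fun g1 g2 => f g1 g2 + f' g1 g2).
Proof. by move=> [p pf] [q qf]; exists (p + q) => g1 g2; rewrite rmorphD /= pf qf. Qed.

Lemma polynomial_funM f f' : polynomial_fun f -> polynomial_fun f' ->
  polynomial_fun (fun g1 g2 => f g1 g2 * f' g1 g2).
Proof. by move=> [p pf] [q qf]; exists (p * q) => g1 g2; rewrite rmorphM /= pf qf. Qed.

Lemma polynomial_fun_sum (I : Type) (r : seq I) (f : I -> 'M[K]_m -> 'M[K]_n -> K) :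
  (forall i, polynomial_fun (f i)) -> polynomial_fun (fun g1 g2 => \sum_(i <- r) f i g1 g2).
Proof.
move=> pf; elim: r => [|i r IH].
  by apply: polynomial_fun_ext (polynomial_fun_const 0) => g1 g2; rewrite big_nil.
apply: polynomial_fun_ext (polynomial_funD (pf i) IH) => g1 g2.
by rewrite big_cons.
Qed.

Lemma polynomial_fun_entry1 i j : polynomial_fun (fun g1 _ => g1 i j).
Proof.
exists (X1 i j) => g1 g2; have /matrixP/(_ i j) := point_eval1 g1 g2.
by rewrite mxE.
Qed.

Lemma polynomial_fun_entry2 i j : polynomial_fun (fun _ g2 => g2 i j).
Proof.
exists (X2 i j) => g1 g2; have /matrixP/(_ i j) := point_eval2 g1 g2.
by rewrite mxE.
Qed.

Lemma polynomial_fun_adj i j : polynomial_fun (fun g1 _ => \adj g1 i j).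
Proof.
exists (\adj X1 i j) => g1 g2.
rewrite -[in RHS](point_eval1 g1 g2) -map_mx_adj [RHS]mxE.
by [].
Qed.

Lemma apolar_translate_polynomial (p q : P) :
  polynomial_fun (fun g1 g2 => apolar (translate g1 g2 p) q).
Proof.
elim/mpoly_var_ind: p q => [c|p p' IH IH'|e p IH] q.
- by apply: polynomial_fun_ext (polynomial_fun_const (apolar c%:MP q)) => g1 g2; rewrite translateC.
- apply: polynomial_fun_ext (polynomial_funD (IH q) (IH' q)) => g1 g2.
  by rewrite rmorphD /= apolarDl.
have [x ->] : exists x : even_index m n, e = enum_rank x by exists (enum_val e); rewrite enum_valK.
case: x => -[i j].
- pose f k (g1 : 'M[K]_m) (g2 : 'M[K]_n) := g1 k j *
    apolar (translate g1 g2 p) q^`M(enum_rank (inl (i, k) : even_index m n)).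
  apply: (@polynomial_fun_ext (fun g1 g2 => \sum_k f k g1 g2)) => [g1 g2|]; last first.
    by apply: polynomial_fun_sum => k; apply: polynomial_funM; [apply: polynomial_fun_entry1|apply: IH].
  rewrite rmorphM /= translate_var1 mulr_suml apolar_suml; apply: eq_bigr => k _.
  by rewrite -scalerAl apolarZl apolar_mulX.
- pose f k (g1 : 'M[K]_m) (g2 : 'M[K]_n) := g2 k j *
    apolar (translate g1 g2 p) q^`M(enum_rank (inr (i, k) : even_index m n)).
  apply: (@polynomial_fun_ext (fun g1 g2 => \sum_k f k g1 g2)) => [g1 g2|]; last first.
    by apply: polynomial_fun_sum => k; apply: polynomial_funM; [apply: polynomial_fun_entry2|apply: IH].
  rewrite rmorphM /= translate_var2 mulr_suml apolar_suml; apply: eq_bigr => k _.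
  by rewrite -scalerAl apolarZl apolar_mulX.
Qed.

(** This makes the density of the big cell applicable to matrix coefficients. *)
Lemma floor_form_polynomial a b (Q Q' : floor_space K m n) :
  exists p : P, forall g1 g2, g1 \in unitmx -> g2 \in unitmx ->
    point_eval g1 g2 p = (\det g1 / det_char a b g1 g2) * floor_form (floor_rep a b g1 g2 Q) Q'.
Proof.
pose f i j k l (g1 : 'M[K]_m) (g2 : 'M[K]_n) :=
  \adj g1 k i * g2 j l * apolar (translate g1 g2 (Q k l)) (Q' i j).
have [p pf] : polynomial_fun (fun g1 g2 => \sum_i \sum_j \sum_k \sum_l f i j k l g1 g2).
  do 4!apply: polynomial_fun_sum => ?.
  apply: polynomial_funM; last exact: apolar_translate_polynomial.
  by apply: polynomial_funM; [apply: polynomial_fun_adj|apply: polynomial_fun_entry2].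
exists p => g1 g2 ug1 ug2; rewrite pf /floor_form.
have d1 : \det g1 != 0 by rewrite -unitfE -unitmxE.
have d2 : \det g2 != 0 by rewrite -unitfE -unitmxE.
have dc : det_char a b g1 g2 != 0 by rewrite mulf_neq0 // expfz_neq0.
do 2!(rewrite mulr_sumr; apply: eq_bigr => ? _).
rewrite floor_act_entry.
do 2!(rewrite apolar_suml mulr_sumr; apply: eq_bigr => ? _).
rewrite apolarZl /f /invmx ug1 [fun_of_matrix (_ *: _) _ _]mxE.
set c := det_char _ _ _ _; set x := \adj g1 _ _; set d := \det g1; set z := apolar _ _.
by field; rewrite d1 dc.
Qed.

End PolynomialFunctions.

(** * The first floor over a field of characteristic zero *)

Section Decomposition.

Variables (K : fieldType) (m n : nat) (a b : int).
Hypotheses (char0 : [pchar K] =i pred0) (n_gt0 : (0 < n)%N).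
Variables (lp : m.-tuple int) (lm : n.-tuple int).
Hypotheses (dlp : dominant lp) (dlm : dominant lm).
Local Notation floor_space := (floor_space K m n).
Local Notation rep := (@floor_rep K m n a b).
Local Notation t1 := (torus1 K m n).
Local Notation t2 := (torus2 K n).
Local Notation F := (@floor_weight K m n lp lm).
Local Notation pi_poly := (pi_poly K lp lm).
Local Notation tchar := (torus_char K m n a b).

Definition good (p : 'I_m * 'I_n) : bool := good_row lp p.1 && good_col lm p.2.

Lemma eigen_floor_ge (w : floor_space) h : rep t1 t2 w = (tchar * 2%:R ^+ h) *: w -> floor_ge h w.
Proof. by move=> e i j u nz; rewrite (torus_eigen_height char0 e nz). Qed.

(** A torus eigenvector of maximal height in a submodule is fixed by the
    unipotent radical, since [u w - w] has only larger heights and would yield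
    another eigenvector if it were not zero. *)
Lemma submodule_contains_pi (L : floor_space -> Prop) (v : floor_space) :
    subspace L -> (forall g1 g2 w, g1 \in unitmx -> g2 \in unitmx -> L w -> L (rep g1 g2 w)) ->
    (forall w, L w -> F w) -> L v -> v != 0 ->
  exists2 p, good p & L (pi_poly p.1 p.2).
Proof.
move=> sL LG LF Lv v0; have [B hB] := floor_height_bound K n_gt0 dlp dlm.
have LD w : L w -> L (rep t1 t2 w) by apply: LG; rewrite ?torus1_unit ?torus2_unit.
pose Ph h := `[< exists2 w, L w & w != 0 /\ rep t1 t2 w = (tchar * 2%:R ^+ h) *: w >].
have ex : exists h, Ph h.
  have [|h _ [w Lw [w0 ew]]] := @torus_eigenvector _ _ _ a b char0 L 0 B v sL LD Lv v0.
    by move=> i j u /(hB _ (LF _ Lv)).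
  by exists h; apply/asboolP; exists w.
have bnd h : Ph h -> (h <= B)%N.
  move=> /asboolP[w Lw [w0 ew]]; have [i [j [u nz]]] := floor_coef_neq0 w0.
  by rewrite -(torus_eigen_height char0 ew nz) ltnW // (hB _ (LF _ Lw)).
case: (ex_maxnP ex bnd) => h /asboolP[w Lw [w0 ew]] hmax.
have iw : unipotent_invariant a b w.
  move=> u1 u2 uu1 uu2; apply/eqP; rewrite -subr_eq0; apply: contraT => d0.
  have Ld : L (rep u1 u2 w - w) by apply: subspaceB => //; apply: LG; rewrite ?unitri_unit.
  have [|h' /andP[hh' _] hw] := @torus_eigenvector _ _ _ a b char0 L h.+1 B _ sL LD Ld d0.
    move=> i j u nz; rewrite (hB _ (LF _ Ld)) // andbT.
    exact: (floor_rep_raises n_gt0 uu1 uu2 (eigen_floor_ge ew)) nz.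
  by have /hmax := introT (asboolP _) hw; rewrite leqNgt hh'.
have [i [j [c [gi gj c0 e]]]] := invariant_eigenvector char0 n_gt0 dlp dlm (LF _ Lw) w0 iw ew.
exists (i, j); first by rewrite /good gi gj.
by apply: (subspaceZ_inv c0 sL); rewrite -e.
Qed.

(** The eigenvalue of a unitriangular pair is 1, as it does not change the terms
    of lowest height. *)
Lemma primitive_floor (w : floor_space) : F w -> w != 0 ->
    (forall g1 g2, g1 \in unitmx -> g2 \in unitmx -> is_trig_mx g1^T -> is_trig_mx g2^T ->
       exists c : K, rep g1 g2 w = c *: w) ->
  exists p, good p /\ exists2 c : K, c != 0 & w = c *: pi_poly p.1 p.2.
Proof.
move=> Fw w0 prim; have [i [j [u nz]]] := floor_coef_neq0 w0.
have ew : rep t1 t2 w = (tchar * 2%:R ^+ (pair_height i j + mon_height u)) *: w.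
  have [||||c e] := prim t1 t2; rewrite ?torus1_unit ?torus2_unit ?torus1_tr ?torus2_tr ?torus1_trig ?torus2_trig //.
  rewrite e; congr (_ *: _); apply: (mulIf nz).
  by have := torus_coef a b char0 w i j u; rewrite e floor_scale_entry mcoeffZ.
have iw : unipotent_invariant a b w.
  move=> u1 u2 uu1 uu2; have [||||c e] := prim u1 u2; rewrite ?unitri_unit //; try by [case: uu1|case: uu2].
  have := floor_rep_raises n_gt0 uu1 uu2 (eigen_floor_ge ew) (a := a) (b := b) (i := i) (j := j) (u := u).
  rewrite ltnn e floor_add_entry floor_opp_entry floor_scale_entry mcoeffB mcoeffZ.
  rewrite -[X in _ - X]mul1r -mulrBl mulf_eq0 (negPf nz) orbF subr_eq0.
  by case: (eqVneq c 1) => [->|_ /(_ isT)//]; rewrite scale1r.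
have [i' [j' [c [gi gj c0 e]]]] := invariant_eigenvector char0 n_gt0 dlp dlm Fw w0 iw ew.
by exists (i', j'); split; [rewrite /good gi gj|exists c].
Qed.

(** ** Orthogonality *)

Lemma pi_poly_torus p : good p ->
  rep t1 t2 (pi_poly p.1 p.2) = (torus_char1 K a b lp lm * 2%:R ^+ pair_height p.1 p.2) *: pi_poly p.1 p.2.
Proof.
case: p => i j /andP[gi gj]; rewrite /=.
have e : rep t1 t2 (pi_poly i j) = pi_char lp lm a b t1 t2 i j *: pi_poly i j.
  by apply: pi_poly_borel; rewrite ?torus1_unit ?torus1_tr ?torus2_tr ?torus1_trig ?torus2_trig.
rewrite e; congr (_ *: _).
have := torus_eval a b char0 i j (pi_poly_floor K dlp dlm gi gj); rewrite e.
rewrite mxE floor_scale_entry point_evalZ.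
have -> : point_eval 1%:M 1%:M (pi_poly i j i j) = 1.
  by have /matrixP/(_ i j) := pi_poly_eval1 K lp lm i j; rewrite mxE [in RHS]mxE !eqxx.
by rewrite pi_poly_eval1 [in RHS]mxE !eqxx !mulr1.
Qed.

(** The torus element equals its transpose and has distinct eigenvalues on the two
    vectors. *)
Lemma pi_poly_orth p q : good p -> good q -> p != q ->
  floor_form (pi_poly p.1 p.2) (pi_poly q.1 q.2) = 0.
Proof.
move=> gp gq pq; set x := pi_poly _ _; set y := pi_poly _ _.
have formZl c z z' : floor_form (c *: z) z' = c * floor_form z z'.
  by rewrite /floor_form mulr_sumr; apply: eq_bigr => i _; rewrite mulr_sumr; apply: eq_bigr => j _;
     rewrite floor_scale_entry apolarZl.
have := floor_form_act a b t1 t2 x y; rewrite torus1_tr torus2_tr !pi_poly_torus //.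
rewrite formZl [RHS]floor_formC formZl [floor_form y x]floor_formC => /eqP.
rewrite -subr_eq0 -mulrBl mulf_eq0 => /orP[|/eqP //].
rewrite subr_eq0 => /eqP /(mulfI (torus_char1_neq0 a b char0 lp lm)).
move=> /(two_expI char0) /(pair_height_inj n_gt0)[e1 e2].
by case/eqP: pq; apply/eqP; rewrite -pair_eqE /= /pair_eq e1 e2 !eqxx.
Qed.

(** On the big cell, [g = L * U], the factor [U] fixes one vector and the
    transpose of [L] multiplies the other by a scalar. *)
Lemma pi_poly_orbit_orth p q g1 g2 : good p -> good q -> p != q ->
    g1 \in unitmx -> g2 \in unitmx ->
  floor_form (rep g1 g2 (pi_poly p.1 p.2)) (pi_poly q.1 q.2) = 0.
Proof.
move=> gp gq pq ug1 ug2.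
have [f hf] := floor_form_polynomial a b (pi_poly p.1 p.2) (pi_poly q.1 q.2).
have f0 : f = 0.
  apply: (big_cell_vanishing char0) => L1 U1 L2 U2 tL1 uL1 uU1 tL2 uL2 uU2.
  rewrite hf ?unitmx_mul ?uL1 ?uL2 ?unitri_unit //.
  rewrite -(floor_act_comp a b _ uL1 (unitri_unit uU1) uL2 (unitri_unit uU2)) pi_poly_unitri // floor_form_act.
  rewrite pi_poly_borel ?unitmx_tr ?trmxK // floor_formC.
  have := floor_form_linear (pi_char lp lm a b L1^T L2^T q.1 q.2) (pi_poly q.1 q.2) 0 (pi_poly p.1 p.2).
  rewrite addr0 => ->; rewrite pi_poly_orth 1?eq_sym // mulr0 add0r.
  rewrite [floor_form 0 _]big1 ?mulr0 // => i _; rewrite big1 // => j _.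
  by rewrite floor_zero_entry apolarC apolar0r.
have := hf g1 g2 ug1 ug2; rewrite f0 rmorph0 => /esym/eqP.
rewrite !mulf_eq0 invr_eq0 => /orP[/orP[|]|/eqP //].
  by move: ug1; rewrite unitmxE unitfE => /negPf ->.
have d1 : \det g1 != 0 by rewrite -unitfE -unitmxE.
have d2 : \det g2 != 0 by rewrite -unitfE -unitmxE.
by rewrite /det_char mulf_eq0 !(negPf (expfz_neq0 _ _)).
Qed.

(** The coefficients are integers, and not all of them are zero. *)
Lemma pi_poly_norm i j : floor_form (pi_poly i j) (pi_poly i j) != 0.
Proof.
have [k hk] : exists k : 'I_m -> 'I_n -> nat, forall r s,
    apolar (pi_poly i j r s) (pi_poly i j r s) = (k r s)%:R /\ (pi_poly i j r s != 0 -> (0 < k r s)%N).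
  have h r s : exists k, apolar (pi_poly i j r s) (pi_poly i j r s) = k%:R /\ (pi_poly i j r s != 0 -> (0 < k)%N).
    by have [k ek kp] := apolar_int_coef (pi_poly_int_coef K lp lm i j r s); exists k; split => // /kp; apply.
  exists (fun r s => projT1 (cid (h r s))) => r s; exact: (projT2 (cid (h r s))).
rewrite /floor_form.
under eq_bigr => r _ do under eq_bigr => s _ do rewrite (proj1 (hk r s)).
under eq_bigr do rewrite -natr_sum.
rewrite -natr_sum; set N := (\sum_r _)%N.
suff : (0 < N)%N by case: N => // N' _; apply: natr_neq0.
rewrite /N (bigD1 i) //= (bigD1 j) //= !addn_gt0 (proj2 (hk i j)) //.
apply: contraNneq (oner_neq0 K) => e0.
have /matrixP/(_ i j) := pi_poly_eval1 K lp lm i j.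
by rewrite [in LHS]mxE e0 rmorph0 [in RHS]mxE !eqxx => /esym/eqP.
Qed.

(** ** Complete reducibility *)

Definition unit_pair := {g : 'M[K]_m * 'M[K]_n | (g.1 \in unitmx) && (g.2 \in unitmx)}.

Definition pair_rep (g : unit_pair) : floor_space -> floor_space := rep (val g).1 (val g).2.

Lemma unit_pair_ex g1 g2 : g1 \in unitmx -> g2 \in unitmx -> exists g : unit_pair, val g = (g1, g2).
Proof.
move=> ug1 ug2; have ug : ((g1, g2).1 \in unitmx) && ((g1, g2).2 \in unitmx) by rewrite ug1 ug2.
by exists (exist _ (g1, g2) ug).
Qed.

Lemma unit_pairP (g : unit_pair) : ((val g).1 \in unitmx) /\ ((val g).2 \in unitmx).
Proof. exact/andP/(valP g). Qed.

Lemma pair_rep_comp g h : exists k, forall x, pair_rep g (pair_rep h x) = pair_rep k x.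
Proof.
have [[ug1 ug2] [uh1 uh2]] := (unit_pairP g, unit_pairP h).
have [k ek] : exists k : unit_pair, val k = ((val g).1 *m (val h).1, (val g).2 *m (val h).2).
  by apply: unit_pair_ex; rewrite unitmx_mul ?ug1 ?ug2.
by exists k => x; rewrite /pair_rep floor_act_comp // ek.
Qed.

Lemma pair_rep1 : exists e, forall x, pair_rep e x = x.
Proof.
have [e ee] := unit_pair_ex (unitmx1 K m) (unitmx1 K n).
by exists e => x; rewrite /pair_rep ee floor_act1.
Qed.

Definition pair_tr (g : unit_pair) : unit_pair :=
  projT1 (cid (@unit_pair_ex (val g).1^T (val g).2^T
    (etrans (unitmx_tr _) (proj1 (unit_pairP g))) (etrans (unitmx_tr _) (proj2 (unit_pairP g))))).

Lemma pair_trE g : val (pair_tr g) = ((val g).1^T, (val g).2^T).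
Proof. by rewrite /pair_tr; case: (cid _). Qed.

Lemma pair_rep_linear g c x y : pair_rep g (c *: x + y) = c *: pair_rep g x + pair_rep g y.
Proof. exact: floor_act_linear. Qed.

Lemma floor_form_rep g x y : floor_form (pair_rep g x) y = floor_form x (pair_rep (pair_tr g) y).
Proof. by rewrite /pair_rep floor_form_act pair_trE. Qed.

Lemma floor_weight_submodule : submodule pair_rep F.
Proof. by split; [exact: floor_weight_subspace|move=> g x; exact: floor_weight_rep]. Qed.

Local Notation pi_ p := (pi_poly p.1 p.2).

Lemma submodule_contains_primitive L : submodule pair_rep L -> (forall x, L x -> F x) ->
  (exists2 x, L x & x != 0) -> exists2 p, good p & L (pi_ p).
Proof.
move=> [sL LG] LF [x Lx x0]; apply: submodule_contains_pi Lx x0 => // g1 g2 w ug1 ug2.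
by have [g eg] := unit_pair_ex ug1 ug2; move=> /(LG g); rewrite /pair_rep eg.
Qed.

Lemma pair_rep_orth p q g : good p -> good q -> p != q ->
  floor_form (pair_rep g (pi_ p)) (pi_ q) = 0.
Proof. by have [ug1 ug2] := unit_pairP g; move=> gp gq pq; apply: pi_poly_orbit_orth. Qed.

Lemma good_pi_floor p : good p -> F (pi_ p).
Proof. by case/andP; apply: pi_poly_floor. Qed.

Definition pi_span (p : 'I_m * 'I_n) : floor_space -> Prop := orbit_span pair_rep (pi_ p).

Lemma pi_span_submodule p : submodule pair_rep (pi_span p).
Proof. exact: orbit_span_submodule pair_rep_linear pair_rep_comp _. Qed.

Lemma pi_span_mem p : pi_span p (pi_ p).
Proof. exact: orbit_span_refl pair_rep1 _. Qed.

Theorem pi_span_irreducible p L : good p -> submodule pair_rep L ->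
    (forall x, L x -> pi_span p x) ->
  (forall x, L x -> x = 0) \/ (forall x, pi_span p x -> L x).
Proof.
apply: (orbit_span_irreducible pair_rep_comp pair_rep1
  (@floor_form_linear K m n) (@floor_formC K m n) floor_form_rep floor_weight_submodule
  good_pi_floor submodule_contains_primitive pair_rep_orth (fun p _ => pi_poly_norm p.1 p.2)).
Qed.

Theorem pi_span_full x : F x <->
  exists u, (forall p, good p -> pi_span p (u p)) /\ x = \sum_(p | good p) u p.
Proof.
have [k [e eF]] := floor_weight_finite K lp lm.
apply: (orbit_sum_full pair_rep_linear pair_rep_comp pair_rep1
  (@floor_form_linear K m n) (@floor_formC K m n) floor_form_rep floor_weight_submodule
  eF good_pi_floor submodule_contains_primitive pair_rep_orth (fun p _ => pi_poly_norm p.1 p.2)).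
Qed.

Theorem pi_span_direct u : (forall p, good p -> pi_span p (u p)) ->
  \sum_(p | good p) u p = 0 -> forall p, good p -> u p = 0.
Proof.
apply: (orbit_sum_direct pair_rep_linear pair_rep_comp pair_rep1
  (@floor_form_linear K m n) (@floor_formC K m n) floor_form_rep floor_weight_submodule
  good_pi_floor submodule_contains_primitive pair_rep_orth (fun p _ => pi_poly_norm p.1 p.2)).
Qed.

End Decomposition.

(** * Identification of the first floor *)

Section LinearSpanImage.

Variables (K : fieldType) (V W : lmodType K) (f : V -> W).
Hypothesis fL : forall (c : K) x y, f (c *: x + y) = c *: f x + f y.

Lemma linear_zero : f 0 = 0.
Proof. by have := fL (-1) 0 0; rewrite !scaleN1r !addNr. Qed.

Lemma lin_span_image (X : V -> Prop) (Y : W -> Prop) :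
    (forall w, Y w <-> exists2 x, X x & w = f x) ->
  forall w, lin_span Y w <-> exists2 x, lin_span X x & w = f x.
Proof.
move=> XY w; have [X0 XD] := lin_span_subspace X; have [Y0 YD] := lin_span_subspace Y; split.
  apply: (lin_span_min (L := fun w => exists2 x, lin_span X x & w = f x)).
    split=> [|c _ _ [x Xx ->] [y Xy ->]]; first by exists 0; rewrite ?linear_zero.
    by exists (c *: x + y); [apply: XD|rewrite fL].
  by move=> {}w /XY[x Xx ->]; exists x => //; apply: lin_span_gen.
move=> [x Xx ->]; move: x Xx; apply: (lin_span_min (L := fun x => lin_span Y (f x))).
  split=> [|c x y Lx Ly]; first by rewrite linear_zero.
  by rewrite fL; apply: YD.
by move=> x Xx; apply: lin_span_gen; apply/XY; exists x.
Qed.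

End LinearSpanImage.

Section CentralMorphism.

Variables (R : comNzRingType) (S : nzRingType) (theta : {rmorphism R -> S}) (m n : nat).
Hypothesis theta_central : forall p y, theta p * y = y * theta p.

Lemma linear_form_single (Z : 'M[S]_(m, n)) (p : R) i j :
  linear_form theta Z (\matrix_(k, l) (p *+ ((k == i) && (l == j)))) = theta p * Z i j.
Proof.
rewrite /linear_form (bigD1 i) //= [X in _ + X]big1 ?addr0 => [|k /negPf ki].
  rewrite (bigD1 j) //= [X in _ + X]big1 ?addr0 => [|l /negPf lj].
    by rewrite mxE !eqxx.
  by rewrite mxE lj andbF rmorph0 mul0r.
by rewrite big1 // => l _; rewrite mxE ki rmorph0 mul0r.
Qed.

(** The formula for [pi_ij], with [c1] and [c2] the powers of the determinants and
    the summation ranges turned into zero coefficients. *)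
Lemma primitive_form (Z : 'M[S]_(m, n)) (A1 A2 : R) (c1 c2 : S) (i : 'I_m) (j : 'I_n)
    (u u' : 'I_m -> R) (v v' : 'I_n -> R) :
    (forall y, c1 * y = y * c1) -> (forall y, c2 * y = y * c2) ->
    (forall r, u' r = if (i <= r)%N then u r else 0) ->
    (forall s, v' s = if (s <= j)%N then (-1) ^+ (s + j) * v s else 0) ->
  (theta A1 * c1) * (theta A2 * c2) *
    \sum_(r < m | (i <= r)%N) theta (u r) * \sum_(s < n | (s <= j)%N)
       (-1) ^+ (s + j) * theta (v s) * Z r s =
  c1 * c2 * linear_form theta Z (\matrix_(r, s) (A1 * A2 * u' r * v' s)).
Proof.
move=> c1C c2C u'E v'E.
have -> : (theta A1 * c1) * (theta A2 * c2) = c1 * c2 * theta (A1 * A2).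
  by rewrite rmorphM -c1C -!mulrA; congr (_ * _); rewrite [RHS]mulrA c2C -mulrA c2C.
rewrite -!mulrA; congr (_ * (_ * _)); rewrite /linear_form mulr_sumr big_mkcond; apply: eq_bigr => r _.
case: ifP => ir; last first.
  by rewrite big1 // => s _; rewrite mxE u'E ir mulr0 mul0r rmorph0 mul0r.
rewrite mulrA mulr_sumr big_mkcond; apply: eq_bigr => s _.
case: ifP => sj; last by rewrite mxE v'E sj mulr0 rmorph0 mul0r.
by rewrite mxE u'E v'E ir sj !rmorphM rmorph_sign -!mulrA.
Qed.

End CentralMorphism.

(** Only the last exponent of the highest weight vector can be negative. *)
Lemma leading_factors (S : unitRingType) p (l : p.-tuple int) (D : nat -> S) (c : nat) :
    dominant l -> (0 < p)%N -> ((0 < c < p)%N -> l`_c.-1 != l`_c) ->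
  \prod_(a < p) D a.+1 ^ (l`_a - l`_a.+1 - (a.+1 == c)%:Z) =
  (\prod_(a < p.-1) D a.+1 ^+ (excess l a - excess l a.+1 - (a.+1 == c))) * D p ^ (last 0 l - (p == c)%:Z).
Proof.
move=> dl; case: p l => // p l in dl * => _ lc; rewrite big_ord_recr /=.
have szl : size l = p.+1 by rewrite size_tuple.
have -> : l`_p.+1 = 0 by rewrite nth_default // szl.
rewrite (last_nth_weight l) szl /= subr0; congr (_ * _); apply: eq_bigr => a _.
have ap := ltn_ord a; have al : (a.+1 < size l)%N by rewrite szl ltnS.
rewrite [RHS]exprnP; congr (_ ^ _).
have le1 := excess_le dl (leqnSn a) al.
have h : ((a.+1 == c) <= excess l a - excess l a.+1)%N.
  case: eqP => // ac; rewrite subn_gt0 ltn_neqAle le1 andbT -eqz_nat !excessE ?(ltnW al) //.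
  apply/eqP => /addIr e; have := lc; rewrite -ac /= ltnS ap e eqxx.
  by move=> /(_ isT).
rewrite -!subzn // !excessE ?(ltnW al) //.
ring.
Qed.

Lemma central_split (R : comNzRingType) (S : nzRingType) (theta : {rmorphism R -> S}) (d1 d2 : S) u v :
    (forall p y, theta p * y = y * theta p) ->
  d1 * theta u * d2 * theta v = d1 * d2 * theta (u * v).
Proof. by move=> tC; rewrite rmorphM -!mulrA; congr (_ * _); rewrite mulrA tC -mulrA. Qed.

Lemma central_linear (R : comNzRingType) (S : nzRingType) (theta : {rmorphism R -> S}) (t : S) k p q :
    (forall p y, theta p * y = y * theta p) ->
  t * theta (k * p + q) = theta k * (t * theta p) + t * theta q.
Proof. by move=> tC; rewrite rmorphD rmorphM mulrDr mulrA -(tC k) -mulrA. Qed.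

Section Model.

Variables (K : fieldType) (m n : nat) (lp : m.-tuple int) (lm : n.-tuple int).
Local Notation P := (Defs.even_poly K m n).
Local Notation X1 := (gen1 K m n).
Local Notation X2 := (gen2 K m n).
Local Notation E := (KGL K m n).
Local Notation floor_space := (floor_space K m n).
Local Notation th := (@theta K m n).
Local Notation a := (last 0 lp).
Local Notation b := (last 0 lm).

(** The parametrization of the induced module of the even subgroup. *)
Definition floor_head (p : P) : E := floor_twist K m n a b * th p.

Lemma floor_head_linear (c : K) p q : floor_head (c *: p + q) = c *: floor_head p + floor_head q.
Proof.
have -> : c *: p + q = c%:MP * p + q by rewrite mul_mpolyC.
apply: etrans (central_linear (floor_twist K m n a b) c%:MP p q (@theta_central K m n)) _.
apply: (congr1 (fun z => z + floor_head q)); apply: etrans (esym (KGL_scaleE c _)).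
by apply: (congr1 (fun z => z * floor_head p)); apply: thetaC.
Qed.

Lemma twist_gen (T : nat -> seq 'I_m) (U : nat -> seq 'I_n) :
  Dplus K n (firsts m m) ^ a * (\prod_(q < ncols lp) Dplus K n (T q)) *
    Dminus K m (firsts n n) ^ b * (\prod_(q < ncols lm) Dminus K m (U q)) =
  floor_head ((\prod_(q < ncols lp) minor_on X1 (T q)) * (\prod_(q < ncols lm) minor_on X2 (U q))).
Proof.
have e1 : Dplus K n (firsts m m) = th (\det X1).
  by apply: etrans (Dplus_theta _ _ _) _; congr (th _); apply: minor_on_all.
have e2 : Dminus K m (firsts n n) = th (\det X2).
  by apply: etrans (Dminus_theta _ _ _) _; congr (th _); apply: minor_on_all.
have e3 : \prod_(q < ncols lp) Dplus K n (T q) = th (\prod_(q < ncols lp) minor_on X1 (T q)).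
  by apply: etrans (esym (rmorph_prod _ _ _ _)); apply: eq_bigr => q _; apply: Dplus_theta.
have e4 : \prod_(q < ncols lm) Dminus K m (U q) = th (\prod_(q < ncols lm) minor_on X2 (U q)).
  by apply: etrans (esym (rmorph_prod _ _ _ _)); apply: eq_bigr => q _; apply: Dminus_theta.
rewrite e1 e2 e3 e4.
exact: (central_split (th (\det X1) ^ a) (th (\det X2) ^ b) _ _ (@theta_central K m n)).
Qed.

Lemma H0_weight_space w : H0 lp lm w <-> exists2 p, weight_space lp lm p & w = floor_head p.
Proof.
apply: (lin_span_image floor_head_linear) => {}w; split.
  move=> [T [U [tT tU ->]]].
  exists ((\prod_(q < ncols lp) minor_on X1 (T q)) * (\prod_(q < ncols lm) minor_on X2 (U q))).
    by do 2!eexists; split; [exists T|exists U|].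
  exact: twist_gen.
move=> [p [_ [_ [[T tT ->] [U tU ->] ->]]] ->]; exists T, U; split=> //.
exact: esym (twist_gen T U).
Qed.

Lemma floor_linear c (Q Q' : floor_space) : floor a b (c *: Q + Q') = c *: floor a b Q + floor a b Q'.
Proof.
have -> : c *: Q + Q' = (c%:MP *: (Q : 'M[P]_(m, n)) + Q' : 'M[P]_(m, n)).
  apply: matrix_ext => i j; rewrite [LHS]floor_add_entry floor_scale_entry.
  by rewrite [RHS]mxE [X in _ = X + _]mxE mul_mpolyC.
by apply: etrans (floorD _ _ _ _) _; congr (_ + _); apply: floorZ.
Qed.

Definition single_entry (p : P) (i : 'I_m) (j : 'I_n) : floor_space :=
  \matrix_(k, l) (p *+ ((k == i) && (l == j))).

Lemma floor_single p i j : floor a b (single_entry p i j) = floor_head p * Y K m n i j.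
Proof.
apply: etrans (mulrA _ _ _); congr (_ * _).
exact: linear_form_single.
Qed.

Lemma lin_span_single Q :
  lin_span (fun Q => exists p i j, weight_space lp lm p /\ Q = single_entry p i j) Q <-> floor_weight lp lm Q.
Proof.
have [W0 WD] := weight_space_subspace K lp lm; split.
  apply: (lin_span_min (L := @floor_weight K m n lp lm)).
    split=> [r s|c x y Lx Ly r s]; first by rewrite floor_zero_entry.
    by rewrite floor_add_entry floor_scale_entry; apply: WD.
  move=> _ [p [i [j [Wp ->]]]] r s; rewrite mxE; case: (_ && _) => //=.
move=> FQ.
have -> : Q = \sum_i \sum_j single_entry (Q i j) i j.
  apply: floor_spaceP => r s; rewrite floor_sum_entry (bigD1 r) //= [X in _ + X]big1 ?addr0 => [|k /negPf kr].
    rewrite floor_sum_entry (bigD1 s) //= [X in _ + X]big1 ?addr0 => [|l /negPf ls].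
      by rewrite mxE !eqxx.
    by rewrite mxE [s == l]eq_sym ls andbF.
  by rewrite floor_sum_entry big1 // => l _; rewrite mxE [r == k]eq_sym kr.
have sS := lin_span_subspace (fun Q => exists p i j, weight_space lp lm p /\ Q = single_entry p i j).
apply: subspace_sum => // i _; apply: subspace_sum => // j _.
by apply: lin_span_gen; exists (Q i j), i, j.
Qed.

Lemma F1_floor (w : E) : F1 lp lm w <-> exists2 Q, floor_weight lp lm Q & w = floor a b Q.
Proof.
have h := @lin_span_image _ floor_space E (floor a b) floor_linear
  (fun Q => exists p i j, weight_space lp lm p /\ Q = single_entry p i j)
  (fun w => exists x i j, H0 lp lm x /\ w = x * Y K m n i j).
apply: iff_trans (h _ w) _.
  move=> {}w; split=> [[x [i [j [/H0_weight_space[p Wp ->] ->]]]]|].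
    exists (single_entry p i j); first by exists p, i, j.
    exact: esym (floor_single p i j).
  move=> [_ [p [i [j [Wp ->]]]] ->]; exists (floor_head p), i, j; split.
    by apply/H0_weight_space; exists p.
  exact: floor_single.
by split=> -[Q LQ ->]; exists Q => //; apply/lin_span_single.
Qed.

End Model.

(** A repeated column. *)
Lemma row_minor_repeat (R : comNzRingType) p (A : 'M[R]_p) (i r : 'I_p) : (r < i)%N -> row_minor A i r = 0.
Proof.
move=> ri; have [f sf] := seq_columns (size_rcons_firsts i r).
rewrite /row_minor (minor_onE _ (ltn_ord i) (size_rcons_firsts i r) sf) -det_tr.
have fE b : val (f b) = if (b < i)%N then val b else val r.
  rewrite -[in LHS]sf nth_rcons size_firsts ?(ltnW (ltn_ord i)) //; case: ltnP => bi.
    by rewrite (nth_firsts _ (ltn_trans bi (ltn_ord i))).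
  by rewrite ifT // eqn_leq bi andbT -ltnS.
apply: (@determinant_alternate _ _ _ (Ordinal (leqW ri)) ord_max).
  by rewrite -val_eqE /= ltn_eqF.
by move=> k; rewrite !mxE; congr (A _ _); apply: val_inj; rewrite !fE /= ri ltnn.
Qed.

Lemma rcons_firsts p (i : 'I_p) : rcons (firsts p i) i = firsts p i.+1.
Proof.
apply: (@eq_from_nth _ i) => [|k]; first by rewrite size_rcons_firsts size_firsts.
rewrite size_rcons_firsts ltnS => ki; rewrite nth_rcons size_firsts ?(ltnW (ltn_ord i)) //.
have kp := leq_ltn_trans ki (ltn_ord i).
rewrite [RHS](nth_firsts _ kp) // ; case: ltnP => ki'; first by rewrite (nth_firsts _ kp).
have -> : k == i by rewrite eqn_leq ki.
by apply: val_inj => /=; apply/eqP; rewrite eqn_leq ki'.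
Qed.

Lemma rmorph_lead (R : pzRingType) (S : pzRingType) (theta : {rmorphism R -> S}) N (e : nat -> nat)
    (x : nat -> R) (D : nat -> S) : (forall k, D k = theta (x k)) ->
  \prod_(a < N) D a.+1 ^+ e a = theta (\prod_(a < N) x a.+1 ^+ e a).
Proof. by move=> De; rewrite rmorph_prod; apply: eq_bigr => a _; rewrite rmorphXn De. Qed.

Lemma central_expz (S : unitRingType) (d : S) (z : int) : (forall y, d * y = y * d) ->
  forall y, d ^ z * y = y * d ^ z.
Proof. by move=> dC y; apply/esym/commrXz/esym/dC. Qed.

(** For the last row the minor is the determinant, which raises its exponent
    by one. *)
Lemma primitive_form_last (R : comNzRingType) (S : unitRingType) (theta : {rmorphism R -> S}) m n
    (Z : 'M[S]_(m, n)) (A1 A2 d1 d2 : R) (x y : int) (i : 'I_m) (j : 'I_n)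
    (u : 'I_m -> R) (v v' : 'I_n -> R) :
    (forall p y, theta p * y = y * theta p) -> theta d1 \is a GRing.unit ->
    (forall r : 'I_m, (i <= r)%N -> u r = d1) ->
    (forall r : 'I_m, (i <= r)%N -> r = i) ->
    (forall s, v' s = if (s <= j)%N then (-1) ^+ (s + j) * v s else 0) ->
  (theta A1 * theta d1 ^ (x - 1)) * (theta A2 * theta d2 ^ y) *
    \sum_(r < m | (i <= r)%N) theta (u r) * \sum_(s < n | (s <= j)%N)
       (-1) ^+ (s + j) * theta (v s) * Z r s =
  theta d1 ^ x * theta d2 ^ y * linear_form theta Z (\matrix_(r, s) (A1 * A2 * (r == i)%:R * v' s)).
Proof.
move=> tC ud ud1 lasti v'E.
have u'E (r : 'I_m) : (r == i)%:R = (if (i <= r)%N then 1 else 0) :> R.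
  case: ifP => ir; first by rewrite (lasti _ ir) eqxx.
  by rewrite -val_eqE /=; case: eqP => // ri; rewrite ri leqnn in ir.
have h := primitive_form (u := fun=> 1) theta Z A1 A2 (central_expz x (tC d1)) (central_expz y (tC d2)) u'E v'E.
apply: etrans _ h.
have -> : \sum_(r < m | (i <= r)%N) theta (u r) *
       \sum_(s < n | (s <= j)%N) (-1) ^+ (s + j) * theta (v s) * Z r s =
     theta d1 * \sum_(r < m | (i <= r)%N) theta 1 * \sum_(s < n | (s <= j)%N) (-1) ^+ (s + j) * theta (v s) * Z r s.
  by rewrite mulr_sumr; apply: eq_bigr => r ir; rewrite ud1 // rmorph1 mul1r.
rewrite mulrA; congr (_ * _).
have -> : theta d1 ^ x = theta d1 ^ (x - 1) * theta d1.
  by rewrite -[X in _ = _ * X]expr1z -exprzDr // subrK.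
by rewrite -mulrA -tC -!mulrA.
Qed.

Section PrimitiveIdentification.

Variables (K : fieldType) (m n : nat) (lp : m.-tuple int) (lm : n.-tuple int).
Hypotheses (dlp : dominant lp) (dlm : dominant lm).
Local Notation X1 := (gen1 K m n).
Local Notation X2 := (gen2 K m n).
Local Notation th := (@theta K m n).

Lemma leading_part1 i : good_row lp i ->
  \prod_(a < m) Dplus K n (firsts m a.+1) ^ (lp`_a - lp`_a.+1 - (a == i)%:Z) =
  th (lead1 lp X1 i) * th (\det X1) ^ (last 0 lp - (i.+1 == m)%:Z).
Proof.
move=> gi; have m0 : (0 < m)%N by apply: leq_ltn_trans (ltn_ord i).
have cond : (0 < i.+1 < m)%N -> lp`_i.+1.-1 != lp`_i.+1.
  by move: gi; rewrite /good_row => /orP[/eqP ->|//]; rewrite ltnn andbF.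
apply: etrans (leading_factors (fun k => Dplus K n (firsts m k)) dlp m0 cond) _.
rewrite [m == _]eq_sym.
have e1 : Dplus K n (firsts m m) = th (\det X1).
  by apply: etrans (Dplus_theta _ _ _) _; congr (th _); apply: minor_on_all.
have e2 := rmorph_lead (theta := th) m.-1 (fun a => excess lp a - excess lp a.+1 - (a.+1 == i.+1))%N
  (fun k => Dplus_theta K n (firsts m k)).
by rewrite e1 e2.
Qed.

Lemma leading_part2 j : good_col lm j ->
  \prod_(b < n) Dminus K m (firsts n b.+1) ^ (lm`_b - lm`_b.+1 - (b.+1 == j)%:Z) =
  th (lead2 lm X2 j) * th (\det X2) ^ last 0 lm.
Proof.
move=> gj; have n0 : (0 < n)%N by apply: leq_ltn_trans (ltn_ord j).
have cond : (0 < j < n)%N -> lm`_j.-1 != lm`_j.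
  by case/andP=> j0 _; move: gj; rewrite /good_col j0.
apply: etrans (leading_factors (fun k => Dminus K m (firsts n k)) dlm n0 cond) _.
have -> : (n == j) = false by rewrite gtn_eqF.
rewrite subr0.
have e1 : Dminus K m (firsts n n) = th (\det X2).
  by apply: etrans (Dminus_theta _ _ _) _; congr (th _); apply: minor_on_all.
have e2 := rmorph_lead (theta := th) n.-1 (fun a => excess lm a - excess lm a.+1 - (a.+1 == j))%N
  (fun k => Dminus_theta K m (firsts n k)).
by rewrite e1 e2.
Qed.

Lemma pi_vector_floor i j : good_row lp i -> good_col lm j ->
  pi_vector K lp lm i j = floor (last 0 lp) (last 0 lm) (pi_poly K lp lm i j).
Proof.
move=> gi gj; have head := congr2 *%R (leading_part1 gi) (leading_part2 gj).
apply: (etrans (congr1 (fun z => z * _) head)).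
under eq_bigr => r _ do rewrite Dplus_theta.
under eq_bigr => r _ do under eq_bigr => s _ do rewrite Dminus_theta.
have v'E s : col_minor X2 j s = if (s <= j)%N then (-1) ^+ (s + j) * minor_on X2 (rem s (firsts n j.+1)) else 0.
  by [].
case: (eqVneq i.+1 m) => im.
  have lasti (r : 'I_m) : (i <= r)%N -> r = i.
    by move=> ir; apply: val_inj => /=; have := ltn_ord r; lia.
  have ud1 (r : 'I_m) : (i <= r)%N -> minor_on X1 (rcons (firsts m i) r) = \det X1.
    by move=> /lasti ->; rewrite rcons_firsts im minor_on_all.
  have := primitive_form_last (Y K m n) (lead1 lp X1 i) (lead2 lm X2 j) (\det X2) (last 0 lp) (last 0 lm)
    (@theta_central K m n) (theta_det1_unit K m n) ud1 lasti v'E.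
  move=> h; apply: etrans h _; congr (_ * linear_form _ _ _).
  by apply: matrix_ext => r s; rewrite !mxE /row_part im eqxx.
have u'E r : row_part X1 i r = if (i <= r)%N then minor_on X1 (rcons (firsts m i) r) else 0.
  rewrite /row_part (negPf im); case: leqP => // ri; exact: row_minor_repeat.
rewrite subr0.
have h := (primitive_form (@theta K m n) (Y K m n) (lead1 lp X1 i) (lead2 lm X2 j)
  (central_expz (last 0 lp) (@theta_central K m n (\det X1)))
  (central_expz (last 0 lm) (@theta_central K m n (\det X2))) u'E v'E).
exact: h.
Qed.

End PrimitiveIdentification.

(** * Transfer to the coordinate ring *)

Section GroupElements.

Variables (K : fieldType) (m n : nat).

Lemma Gev_block (g : 'M[K]_(m + n)) : g \in @Gev K m n ->
  exists g1 g2, [/\ g1 \in unitmx, g2 \in unitmx & g = block_mx g1 0 0 g2].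
Proof.
move=> /and3P[ug /eqP ur /eqP dl]; have e : g = block_mx (ulsubmx g) 0 0 (drsubmx g).
  by rewrite -[LHS]submxK ur dl.
exists (ulsubmx g), (drsubmx g); split=> //.
  by move: ug; rewrite {1}e !unitmxE det_ublock unitrM => /andP[].
by move: ug; rewrite {1}e !unitmxE det_ublock unitrM => /andP[].
Qed.

Lemma block_Gev (g1 : 'M[K]_m) (g2 : 'M[K]_n) : g1 \in unitmx -> g2 \in unitmx ->
  block_mx g1 0 0 g2 \in @Gev K m n.
Proof.
move=> ug1 ug2; apply/and3P; split.
- by rewrite unitmxE det_ublock unitrM -!unitmxE ug1.
- by rewrite block_mxKur.
- by rewrite block_mxKdl.
Qed.

Lemma block_upper_borel (g1 : 'M[K]_m) (g2 : 'M[K]_n) : g1 \in unitmx -> g2 \in unitmx ->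
  (block_mx g1 0 0 g2 \in @Gev_upper_borel K m n) = is_trig_mx g1^T && is_trig_mx g2^T.
Proof.
move=> ug1 ug2; rewrite unfold_in block_Gev //= tr_block_mx trmx0.
by rewrite is_trig_block_mx // eqxx.
Qed.

End GroupElements.

(** Representation theory of polynomial matrices is carried over by an injective
    equivariant parametrization [f] of the first floor. *)
Section Transfer.

Variables (K : fieldType) (m n : nat) (a b : int) (lp : m.-tuple int) (lm : n.-tuple int).
Hypotheses (dlp : dominant lp) (dlm : dominant lm).
Local Notation E := (KGL K m n).
Local Notation floor_space := (floor_space K m n).
Local Notation F := (@floor_weight K m n lp lm).
Local Notation rep := (@floor_rep K m n a b).
Local Notation pi_poly := (pi_poly K lp lm).
Local Notation good := (good lp lm).

Variable f : floor_space -> E.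
Hypothesis fL : forall (c : K) x y, f (c *: x + y) = c *: f x + f y.
Hypothesis f_inj : injective f.
Hypothesis f_act : forall g1 g2 Q, g1 \in unitmx -> g2 \in unitmx ->
  act (block_mx g1 0 0 g2) (f Q) = f (rep g1 g2 Q).
Hypothesis f_floor : forall w, F1 lp lm w <-> exists2 Q, F Q & w = f Q.
Hypothesis f_pi : forall i j, good_row lp i -> good_col lm j -> pi_vector K lp lm i j = f (pi_poly i j).

Lemma f0 : f 0 = 0. Proof. exact: linear_zero fL. Qed.

Lemma fZ c x : f (c *: x) = c *: f x.
Proof. by have := fL c x 0; rewrite addr0 f0 addr0. Qed.

Lemma f_eq0 x : f x = 0 -> x = 0.
Proof. by move=> fx; apply: f_inj; rewrite fx f0. Qed.

Lemma f_sum (I : finType) (S : pred I) (u : I -> floor_space) :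
  f (\sum_(i | S i) u i) = \sum_(i | S i) f (u i).
Proof.
apply: (big_morph f) => [x y|]; last exact: f0.
by have := fL 1 x y; rewrite !scale1r.
Qed.

Definition f_image (L : floor_space -> Prop) (w : E) : Prop := exists2 Q, L Q & w = f Q.

Lemma f_image_submodule L : submodule (@pair_rep K m n a b) L -> Gev_submodule (f_image L).
Proof.
move=> [[L0 LD] LG]; split.
- by exists 0; rewrite ?f0.
- by move=> c _ _ [x Lx ->] [y Ly ->]; exists (c *: x + y); [apply: LD|rewrite fL].
- move=> g _ /Gev_block[g1 [g2 [ug1 ug2 ->]]] [x Lx ->]; exists (rep g1 g2 x); last exact: f_act.
  have [h eh] := unit_pair_ex ug1 ug2.
  by have := LG h x Lx; rewrite /pair_rep eh.
Qed.

Lemma f_preimage_submodule (M : E -> Prop) : Gev_submodule M ->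
  submodule (@pair_rep K m n a b) (fun Q => M (f Q)).
Proof.
move=> [M0 MD MG]; split; first split.
- by rewrite f0.
- by move=> c x y Mx My; rewrite fL; apply: MD.
- move=> h x Mx; have [uh1 uh2] := unit_pairP h.
  by rewrite /pair_rep -f_act //; apply: MG => //; apply: block_Gev.
Qed.

Lemma f_pi_primitive i j c : c != 0 -> Gev_primitive (f (c *: pi_poly i j)).
Proof.
move=> c0; split.
  apply/eqP => /f_eq0 e0; have /matrixP/(_ i j) := pi_poly_eval1 K lp lm i j.
  have -> : pi_poly i j = 0 by rewrite -[LHS]scale1r -(mulVf c0) -scalerA e0 scaler0.
  by rewrite mxE floor_zero_entry rmorph0 mxE !eqxx => /esym/eqP; rewrite oner_eq0.
move=> g bg; have /andP[/Gev_block[g1 [g2 [ug1 ug2 eg]]] _] := bg.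
move: bg; rewrite eg block_upper_borel // => /andP[tg1 tg2].
exists (pi_char lp lm a b g1 g2 i j); rewrite f_act // -fZ.
have := floor_act_linear a b g1 g2 c (pi_poly i j) 0.
rewrite pi_poly_borel // addr0 => ->.
by rewrite (_ : rep g1 g2 0 = 0) ?addr0 ?scalerA 1?mulrC //; apply: linear_zero (floor_act_linear a b g1 g2).
Qed.

Lemma f_pi_F1 i j c : good_row lp i -> good_col lm j -> F1 lp lm (f (c *: pi_poly i j)).
Proof.
move=> gi gj; apply/f_floor; exists (c *: pi_poly i j) => //.
by apply: (subspaceZ (L := F)); [apply: floor_weight_subspace|apply: pi_poly_floor].
Qed.

Lemma pi_vector_primitive i j : good_row lp i -> good_col lm j ->
  F1 lp lm (pi_vector K lp lm i j) /\ Gev_primitive (pi_vector K lp lm i j).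
Proof.
move=> gi gj; rewrite f_pi // -[pi_poly i j]scale1r; split; first exact: f_pi_F1.
exact: f_pi_primitive (oner_neq0 K).
Qed.

Hypotheses (char0 : [pchar K] =i pred0) (n_gt0 : (0 < n)%N).

Lemma complete_good : pi_complete K lp lm good.
Proof.
move=> w; split; last first.
  move=> [[i j] /andP[gi gj] [c c0 ->]]; rewrite f_pi // -fZ.
  by split; [apply: f_pi_F1|apply: f_pi_primitive].
move=> [/f_floor[Q FQ ->] [Q0 QB]].
have [|g1 g2 ug1 ug2 tg1 tg2|p [gp [c c0 ->]]] := @primitive_floor K m n a b char0 n_gt0 lp lm dlp dlm Q FQ.
- by apply: contra_neq Q0 => ->; apply: f0.
- have [|c e] := QB (block_mx g1 0 0 g2); first by rewrite block_upper_borel // tg1.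
  by exists c; apply: f_inj; rewrite -f_act // fZ.
exists p => //; exists c => //; rewrite fZ; case/andP: gp => gi gj.
by rewrite f_pi.
Qed.

Lemma f_image_choice (L : 'I_m * 'I_n -> floor_space -> Prop) (u : 'I_m * 'I_n -> E) :
    (forall p, good p -> f_image (L p) (u p)) ->
  exists v, (forall p, good p -> L p (v p)) /\ (forall p, good p -> u p = f (v p)).
Proof.
move=> Lu; have h p : exists x, good p -> L p x /\ u p = f x.
  have [/Lu[x Lx e]|] := boolP (good p); last by exists 0.
  by exists x.
exists (fun p => projT1 (cid (h p))); split=> p gp.
  by case: (projT2 (cid (h p)) gp).
by case: (projT2 (cid (h p)) gp).
Qed.

Lemma decomposition_good : F1_decomposition K lp lm good.
Proof.
exists (fun p => f_image (@pi_span K m n a b lp lm p)); split.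
  move=> p gp; have /andP[gi gj] := gp; have [_ prim] := pi_vector_primitive gi gj.
  have Mp : f_image (@pi_span K m n a b lp lm p) (pi_vector K lp lm p.1 p.2).
    by exists (pi_poly p.1 p.2); [apply: pi_span_mem|apply: f_pi].
  split=> //; split.
  - exact/f_image_submodule/pi_span_submodule.
  - by exists (pi_vector K lp lm p.1 p.2) => //; case: prim.
  - move=> L sL LM; have [x Lx|L0|LL] := pi_span_irreducible (a := a) (b := b) char0 n_gt0 dlp dlm gp (f_preimage_submodule sL).
    + by have [y Ly /f_inj ->] := LM _ Lx.
    + by left=> w Lw; have [y _ e] := LM _ Lw; rewrite e; rewrite e in Lw; rewrite (L0 _ Lw) f0.
    + by right=> w [x Sx ->]; apply: LL.
split=> [w|u /f_image_choice[v [Sv uv]] u0 p gp].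
  split=> [/f_floor[Q /(pi_span_full a b char0 n_gt0 dlp dlm)[u [Su ->]] ->]
          |[u [/f_image_choice[v [Sv uv]] ->]]].
    exists (fun p => f (u p)); split; last exact: f_sum.
    by move=> p gp; exists (u p); first exact: Su.
  apply/f_floor; exists (\sum_(p | good p) v p).
    by apply/(pi_span_full a b char0 n_gt0 dlp dlm); exists v.
  by rewrite f_sum; apply: eq_bigr.
rewrite uv // (pi_span_direct char0 n_gt0 dlp dlm Sv _ gp) ?f0 //.
by apply: f_eq0; rewrite f_sum -[RHS]u0; apply: eq_bigr => q gq; rewrite uv.
Qed.

End Transfer.

Lemma row_condition_good m (lp : m.-tuple int) i : row_condition lp i -> good_row lp i.
Proof. by rewrite /row_condition /good_row => /orP[/andP[_ ->]|/andP[->]]; rewrite ?orbT. Qed.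

Lemma good_row_cases m (lp : m.-tuple int) i : good_row lp i = row_condition lp i || (i.+1 == m).
Proof.
rewrite /row_condition /good_row; have [im|im] := eqVneq i.+1 m; first by rewrite !orbT.
have -> : (i.+1 < m)%N by rewrite ltn_neqAle im ltn_ord.
by rewrite /= !orbF.
Qed.

Lemma row_condition_last m (lp : m.-tuple int) i : last 0 lp != 0 -> row_condition lp i = good_row lp i.
Proof.
move=> l0; rewrite good_row_cases; case: eqVneq => im; last by rewrite orbF.
rewrite orbT /row_condition im eqxx ltnn /=.
have -> : (i : nat) = m.-1 by apply: (congr1 predn im).
by have := last_nth_weight lp; rewrite size_tuple => <-.
Qed.

Theorem proposition3p4 (K : closedFieldType) (hK : 2%N \notin [pchar K])
    (m n : nat) (hm : (0 < m)%N) (hn : (0 < n)%N)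
    (lp : m.-tuple int) (lm : n.-tuple int)
    (hlp : dominant lp) (hlm : dominant lm) :
  (forall (i : 'I_m) (j : 'I_n), row_condition lp i -> col_condition lm j ->
     F1 lp lm (pi_vector K lp lm i j)
     /\ Gev_primitive (pi_vector K lp lm i j))
  /\
  ([pchar K] =i pred0 ->
     (last 0 lp != 0 ->
        let idx := [pred p | row_condition lp p.1 & col_condition lm p.2] in
        pi_complete K lp lm idx /\ F1_decomposition K lp lm idx)
     /\
     (last 0 lp = 0 ->
        let idx := [pred p : 'I_m * 'I_n
          | row_condition lp p.1 || (p.1.+1 == m) & col_condition lm p.2] in
        pi_complete K lp lm idx /\ F1_decomposition K lp lm idx)).
Proof.
pose a := last 0 lp; pose b := last 0 lm; pose f : floor_space K m n -> KGL K m n := floor a b.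
have fL : forall (c : K) x y, f (c *: x + y) = c *: f x + f y by apply: floor_linear.
have f_inj : injective f by apply: floor_inj.
have f_act (g1 : 'M[K]_m) (g2 : 'M[K]_n) Q : g1 \in unitmx -> g2 \in unitmx ->
    act (block_mx g1 0 0 g2) (f Q) = f (floor_rep a b g1 g2 Q).
  by move=> ug1 ug2; rewrite floor_rep.unlock; apply: act_floor.
have f_floor w : F1 lp lm w <-> exists2 Q, floor_weight lp lm Q & w = f Q by apply: F1_floor.
have f_pi (i : 'I_m) (j : 'I_n) : good_row lp i -> good_col lm j ->
    pi_vector K lp lm i j = f (pi_poly K lp lm i j).
  exact: pi_vector_floor.
split=> [i j /row_condition_good gi gj|char0].
  exact: (pi_vector_primitive hlp hlm fL f_inj f_act f_floor f_pi gi gj).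
have all_good : pi_complete K lp lm (good lp lm) /\ F1_decomposition K lp lm (good lp lm).
  by split; [apply: (complete_good hlp hlm fL f_inj f_act f_floor f_pi char0 hn)
            |apply: (decomposition_good hlp hlm fL f_inj f_act f_floor f_pi char0 hn)].
split=> l0 idx.
  suff -> : (idx : pred _) = good lp lm by [].
  by apply/funext => p; rewrite /idx /= row_condition_last.
suff -> : (idx : pred _) = good lp lm by [].
by apply/funext => p; rewrite /idx /= -good_row_cases.
Qed.
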